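(* Let $(M,g)$ be a compact Kähler manifold with nonnegative holomorphic bisectional curvature, let $a\neq 0$ be a real constant, and let $u$ be a positive smooth solution on $M\times[0,T)$, $0<T\le\infty$, of the nonlinear heat equation $$\frac{\partial}{\partial t}u=\Delta u+au\ln u .$$ Then for all $t\in(0,T)$, at every point of $M$, $$\nabla_i\nabla_{\bar j}\ln u+\frac{a}{1-e^{-at}}\,g_{i\bar j}>0 .$$
   Context: Let $g=(g_{i\bar j})$ be a Kähler metric in local holomorphic coordinates. $\nabla$ is its Levi-Civita (Chern) connection and $\Delta A=\frac12 g^{k\bar l}(\nabla_k\nabla_{\bar l}+\nabla_{\bar l}\nabla_k)A$, so $\Delta A=g^{k\bar l}\nabla_k\nabla_{\bar l}A=g^{k\bar l}\partial_k\partial_{\bar l}A$ on functions (half the Riemannian Laplacian in the usual normalization). The curvature is $R_{i\bar jk\bar l}=-g_{p\bar j}\,\partial_{\bar l}\Gamma^p_{ik}$ with $\Gamma^p_{ik}=g^{p\bar q}\partial_k g_{i\bar q}$ (so it is positive on complex projective space with the Fubini–Study metric). Nonnegative holomorphic bisectional curvature means $R_{i\bar jk\bar l}v^i\overline{v^j}w^k\overline{w^l}\ge0$ for all $v,w\in T^{1,0}_xM$ and all $x\in M$. An inequality $S_{i\bar j}>0$ means that the Hermitian form $S$ is positive definite at each point. *)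

(* Defs.v *)
From HB Require Import structures.
From mathcomp Require Import all_boot all_order all_algebra.
From mathcomp Require Import complex.
From mathcomp Require Import all_classical all_reals all_analysis.
Import Order.TTheory GRing.Theory Num.Theory.
Import numFieldNormedType.Exports.

Set Implicit Arguments.
Unset Strict Implicit.
Unset Printing Implicit Defensive.

Local Open Scope classical_set_scope.
Local Open Scope ring_scope.

(* The bare type R[i] carries no topology in the library: only sorts of
   abstract numeric structures do, whence this alias.  With it,
   'rV[Cplx R]_n is a normed module over Cplx R, so that [differentiable]
   means complex differentiable. *)
Definition Cplx (R : realType) : numClosedFieldType := complex R.

(* Real partial derivatives of complex-valued functions on a space E with
   real coordinates indexed by J: [move j h x] is x with its j-th real
   coordinate increased by h.  Difference quotients only use points of D, so
   the derivatives are one-sided at the boundary points of D (such as t = 0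
   in M x [0, T)). *)
Section RealPartialDerivatives.
Context (R : realType) (E : topologicalType) (J : Type).
Variables (move : J -> R -> E -> E) (D : set E).
Implicit Types (j : J) (f : E -> Cplx R) (x : E).

Definition diff_quotient j f x : R -> Cplx R :=
  fun h => (f (move j h x) - f x) / h%:C%C.

Definition step_filter j x : set_system R :=
  within [set h | D (move j h x)] 0^'.

Definition has_partial j f x : Prop :=
  cvg (diff_quotient j f x @ step_filter j x).

Definition partial j f x : Cplx R :=
  lim (diff_quotient j f x @ step_filter j x).

Fixpoint Ck (k : nat) f : Prop :=
  {within D, continuous f} /\
  if k is k'.+1 then
    forall j, (forall x, D x -> has_partial j f x) /\ Ck k' (partial j f)
  else True.

Definition smooth f : Prop := forall k, Ck k f.

End RealPartialDerivatives.

Section LocalCalculus.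
Context (R : realType) (n : nat).
Local Notation C := (Cplx R).

(* The real coordinates of C^n: (k, false) is x^k and (k, true) is y^k, where
   z^k = x^k + i y^k. *)
Definition space_move (j : 'I_n * bool) (h : R) (z : 'rV[C]_n) : 'rV[C]_n :=
  z + ((if j.2 then 'i else 1) * h%:C%C) *: delta_mx 0 j.1.

(* The real coordinates of C^n x R: None is the time t. *)
Definition spacetime_move (j : option ('I_n * bool)) (h : R)
    (x : 'rV[C]_n * R) : 'rV[C]_n * R :=
  if j is Some j' then (space_move j' h x.1, x.2) else (x.1, x.2 + h).

Definition d_ (k : 'I_n) (f : 'rV[C]_n -> C) (z : 'rV[C]_n) : C :=
  2^-1 * (partial space_move setT (k, false) f z
          - 'i * partial space_move setT (k, true) f z).

Definition dbar_ (k : 'I_n) (f : 'rV[C]_n -> C) (z : 'rV[C]_n) : C :=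
  2^-1 * (partial space_move setT (k, false) f z
          + 'i * partial space_move setT (k, true) f z).

(* nabla_i nabla_jbar f for a function f; no connection coefficient enters,
   since the mixed Christoffel symbols of the Chern connection vanish. *)
Definition complex_hessian (f : 'rV[C]_n -> C) (i j : 'I_n)
    (z : 'rV[C]_n) : C :=
  d_ i (dbar_ j f) z.

Definition hermitian_posdef (S : 'M[C]_n) : Prop :=
  (forall i j, S j i = (S i j)^*) /\
  (forall v : 'rV[C]_n, v != 0 ->
     0 < \sum_i \sum_j S i j * v 0 i * (v 0 j)^*).

Variable g : 'rV[C]_n -> 'M[C]_n.

(* g^{k lbar}, normalized by \sum_l g_{i lbar} g^{k lbar} = delta_i^k; hence
   the transposition. *)
Definition metric_inv (k l : 'I_n) (z : 'rV[C]_n) : C := invmx (g z) l k.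

Definition christoffel (p i k : 'I_n) (z : 'rV[C]_n) : C :=
  \sum_q metric_inv p q z * d_ k (fun w => g w i q) z.

Definition curvature (i j k l : 'I_n) (z : 'rV[C]_n) : C :=
  - \sum_p g z p j * dbar_ l (christoffel p i k) z.

Definition laplacian (f : 'rV[C]_n -> C) (z : 'rV[C]_n) : C :=
  \sum_k \sum_l metric_inv k l z * complex_hessian f k l z.

End LocalCalculus.

Record complex_atlas (R : realType) (n : nat) (M : topologicalType) :=
  ComplexAtlas {
  chart_index : Type;
  chart_dom : chart_index -> set M;
  chart : chart_index -> M -> 'rV[Cplx R]_n;
  chart_inv : chart_index -> 'rV[Cplx R]_n -> M;
  chart_dom_open : forall i, open (chart_dom i);
  chart_cover : forall p, exists i, chart_dom i p;
  chart_image_open : forall i, open (chart i @` chart_dom i);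
  chartK : forall i p, chart_dom i p -> chart_inv i (chart i p) = p;
  chart_continuous : forall i, {within chart_dom i, continuous (chart i)};
  chart_inv_continuous :
    forall i, {within chart i @` chart_dom i, continuous (chart_inv i)};
  chart_holomorphic : forall i j p, chart_dom i p -> chart_dom j p ->
    differentiable (chart j \o chart_inv i) (chart i p)
}.

Definition chart_image (R : realType) (n : nat) (M : topologicalType)
    (X : complex_atlas R n M) (i : chart_index X) : set 'rV[Cplx R]_n :=
  chart i @` chart_dom i.

(* [metric i z j k] is g_{j kbar} at the point with coordinates z in the
   chart i.  The Jacobian acts on row vectors on the right: ('J F z) j k is
   the derivative of the k-th component of F along z^j. *)
Record kahler_metric (R : realType) (n : nat) (M : topologicalType)
    (X : complex_atlas R n M) := KahlerMetric {
  metric : chart_index X -> 'rV[Cplx R]_n -> 'M[Cplx R]_n;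
  metric_smooth : forall i j k,
    smooth (@space_move R n) (chart_image i) (fun z => metric i z j k);
  metric_posdef : forall i z, chart_image i z -> hermitian_posdef (metric i z);
  metric_transition : forall i j p, chart_dom i p -> chart_dom j p ->
    let A := 'J (chart j \o chart_inv i) (chart i p) in
    metric i (chart i p) =
      A *m metric j (chart j p) *m (map_mx Num.conj A)^T;
  metric_kahler : forall i j k l z, chart_image i z ->
    d_ k (fun w => metric i w j l) z = d_ j (fun w => metric i w k l) z
}.

Definition nonneg_bisectional (R : realType) (n : nat) (M : topologicalType)
    (X : complex_atlas R n M) (g : kahler_metric X) : Prop :=
  forall (c : chart_index X) (x : M), chart_dom c x ->
  forall v w : 'rV[Cplx R]_n,
  0 <= \sum_i \sum_j \sum_k \sum_l
         curvature (metric g c) i j k l (chart c x)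
         * v 0 i * (v 0 j)^* * w 0 k * (w 0 l)^*.

Section HeatEquation.
Context (R : realType) (n : nat) (M : topologicalType).
Variable X : complex_atlas R n M.

Definition local_rep (f : M -> R) (c : chart_index X)
    (z : 'rV[Cplx R]_n) : Cplx R :=
  (f (chart_inv c z))%:C%C.

Definition local_cylinder (T : \bar R) (c : chart_index X) :
    set ('rV[Cplx R]_n * R) :=
  [set x | chart_image c x.1 /\ 0 <= x.2 /\ (x.2%:E < T)%E].

Definition local_rep_time (u : M -> R -> R) (c : chart_index X)
    (x : 'rV[Cplx R]_n * R) : Cplx R :=
  local_rep (u^~ x.2) c x.1.

Definition smooth_on_cylinder (T : \bar R) (u : M -> R -> R) : Prop :=
  forall c : chart_index X,
    smooth (@spacetime_move R n) (local_cylinder T c) (local_rep_time u c).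

Definition log_heat_solution (g : kahler_metric X) (a : R) (T : \bar R)
    (u : M -> R -> R) : Prop :=
  forall (c : chart_index X) (p : M) (t : R),
    chart_dom c p -> 0 <= t -> (t%:E < T)%E ->
    partial (@spacetime_move R n) (local_cylinder T c) None
      (local_rep_time u c) (chart c p, t) =
    laplacian (metric g c) (local_rep (u^~ t) c) (chart c p)
    + (a * u p t * ln (u p t))%:C%C.

End HeatEquation.

(* Main.v *)
From HB Require Import structures.
Require Import Defs.
From mathcomp Require Import all_boot all_order all_algebra.
From mathcomp Require Import complex ring lra.
From mathcomp Require Import all_classical all_reals all_analysis.
Import Order.TTheory GRing.Theory Num.Theory.
Import numFieldNormedType.Exports.
Set Implicit Arguments.
Unset Strict Implicit.
Unset Printing Implicit Defensive.
Local Open Scope classical_set_scope.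
Local Open Scope ring_scope.

(* Let f = ln u, so that f_t = Delta f + |nabla f|^2 + a f, and set
   P = nabla nabla-bar f + psi(t) g with the barrier psi(t) = k / eta(t + s), where
   eta(t) = (1 - e^(-a t)) / a, s > 0 and k = eta(t1 + s) / eta(t1) > 1.  Then
   psi(t1) = a / (1 - e^(-a t1)) and psi' + psi^2 - a psi = k (k - 1) / eta(t + s)^2 > 0, while
   psi(0) tends to infinity as s tends to 0; by compactness P is positive at t = 0 for small s.

   If P degenerated at a first time tau in (0, t1], let v be a null vector of P at (z, tau), extend
   it to a holomorphic field nu whose covariant derivative vanishes at z, and let F = P(nu, nu-bar).
   F(., tau) has a minimum at z, so its complex Hessian there is nonnegative.  Differentiating the
   equation of f along v and v-bar, and using P v = 0, the quantity
   d/dt P(v, v-bar) - tr(g^-1 Hess F) is the sum of (psi' + psi^2 - a psi) g(v, v-bar) > 0, of a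
   square, and of two curvature terms that are nonnegative because the bisectional curvature is.
   Hence d/dt P(v, v-bar) > 0 at the first time where P(v, v-bar) vanishes, a contradiction. *)

(** * Complex numbers over a real type *)

(** The function 1 / eta(t), which is the coefficient a / (1 - e^(-a t)) of the conclusion, solves
    psi' + psi^2 - a psi = 0 exactly. As a barrier it would give only a weak inequality at a null
    vector, and it is infinite at t = 0, where the comparison has to start. The shift s makes the
    barrier finite on [0, t1]. The factor k > 1 makes the supersolution inequality strict, and k is
    tied to s so that the barrier still takes the desired value at t1. The strict conclusion at t1
    is then read off directly, without a limit in s; the price is a barrier that depends on t1.

    The computation at a null vector lives in one chart, but the compactness arguments compare
    charts. Transition maps are only assumed complex differentiable, so the invariance of nabla
    nabla-bar f cannot be taken from a second-order chain rule. This is why some function theory is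
    needed: Goursat's lemma and the mean value property, applied to a holomorphic function of one
    variable built from two Taylor expansions. *)

Section ComplexBasics.
Variable R : realType.
Local Notation C := (Cplx R).

Implicit Types (z w : C).
Definition toC (x : R) : C := x%:C%C.

Fact toC_is_additive : zmod_morphism toC.
Proof. exact: (raddfB (real_complex R)). Qed.
Fact toC_is_multiplicative : monoid_morphism toC.
Proof. by split; [exact: (rmorph1 (real_complex R)) | exact: (rmorphM (real_complex R))]. Qed.
HB.instance Definition _ := GRing.isZmodMorphism.Build R C toC toC_is_additive.
HB.instance Definition _ := GRing.isMonoidMorphism.Build R C toC toC_is_multiplicative.

Lemma toCD x y : toC (x + y) = toC x + toC y. Proof. exact: rmorphD. Qed.
Lemma toCM x y : toC (x * y) = toC x * toC y. Proof. exact: rmorphM. Qed.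
Lemma toCV x : toC x^-1 = (toC x)^-1. Proof. exact: fmorphV. Qed.
Lemma toC0 : toC 0 = 0. Proof. exact: rmorph0. Qed.
Lemma toC1 : toC 1 = 1. Proof. exact: rmorph1. Qed.
Lemma toCnat n : toC n%:R = n%:R. Proof. exact: rmorph_nat. Qed.

Definition re (z : C) : R := complex.Re z.
Definition im (z : C) : R := complex.Im z.

Arguments re z : simpl never.
Arguments im z : simpl never.
Lemma reD x y : re (x + y) = re x + re y. Proof. by case: x; case: y. Qed.
Lemma reN x : re (- x) = - re x. Proof. by case: x. Qed.
Lemma reB x y : re (x - y) = re x - re y. Proof. by rewrite reD reN. Qed.
Lemma imD x y : im (x + y) = im x + im y. Proof. by case: x; case: y. Qed.
Lemma imN x : im (- x) = - im x. Proof. by case: x. Qed.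
Lemma imB x y : im (x - y) = im x - im y. Proof. by rewrite imD imN. Qed.
Lemma re_toC r : re (toC r) = r. Proof. by []. Qed.
Lemma im_toC r : im (toC r) = 0. Proof. by []. Qed.
Lemma reM x y : re (x * y) = re x * re y - im x * im y.
Proof. by case: x; case: y. Qed.
Lemma imM x y : im (x * y) = re x * im y + im x * re y.
Proof. by case: x => a b; case: y => c d; rewrite /im /re /= . Qed.
Lemma conjE (z : C) : z^* = (z^*)%C. Proof. by []. Qed.
Lemma re_conj z : re z^* = re z. Proof. by rewrite conjE; case: z. Qed.
Lemma im_conj z : im z^* = - im z. Proof. by rewrite conjE; case: z. Qed.
Lemma iE : 'i = 'i%C :> C. Proof. by []. Qed.
Lemma re_i : re 'i = 0. Proof. by rewrite iE. Qed.
Lemma im_i : im 'i = 1. Proof. by rewrite iE. Qed.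
Lemma re1 : re (1 : C) = 1. Proof. by []. Qed.
Lemma im1 : im (1 : C) = 0. Proof. by []. Qed.
Lemma re0 : re (0 : C) = 0. Proof. by []. Qed.
Lemma eqC (x y : C) : re x = re y -> im x = im y -> x = y.
Proof. by case: x => a b; case: y => c d; rewrite /re /im /= => -> ->. Qed.
Lemma reimE z : z = toC (re z) + 'i * toC (im z).
Proof. by apply: eqC; rewrite ?reD ?imD ?reM ?imM ?re_i ?im_i ?re_toC ?im_toC; ring. Qed.
Lemma leC (x y : C) : (x <= y) = (im y == im x) && (re x <= re y).
Proof. exact: lecE. Qed.
Lemma ltC (x y : C) : (x < y) = (im y == im x) && (re x < re y).
Proof. exact: ltcE. Qed.
Lemma re_mono (z w : C) : z <= w -> re z <= re w.
Proof. by rewrite leC => /andP[]. Qed.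
Lemma toC_le x y : (toC x <= toC y) = (x <= y). Proof. exact: lecR. Qed.
Lemma toC_lt x y : (toC x < toC y) = (x < y). Proof. exact: ltcR. Qed.
Lemma toC_inj : injective toC. Proof. by move=> x y []. Qed.
Lemma toC_eq0 x : (toC x == 0) = (x == 0).
Proof. by rewrite -(inj_eq toC_inj) rmorph0. Qed.
Lemma toC_conj x : (toC x)^* = toC x.
Proof. by apply: eqC; rewrite ?re_conj ?im_conj ?im_toC ?oppr0. Qed.
Lemma toC_norm x : `|toC x| = toC `|x|.
Proof. by rewrite [LHS]normc_def /= expr0n addr0 sqrtr_sqr. Qed.
Lemma norm_re z : `|z| = toC (re `|z|).
Proof. by apply: eqC => //; rewrite im_toC; apply: ger0_Im; exact: normr_ge0. Qed.
Lemma re_le_norm z : toC `|re z| <= `|z|.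
Proof. exact: normc_ge_Re. Qed.
Lemma re_mi z : re (- ('i : C) * z) = im z.
Proof. by rewrite reM !reN !imN re_i im_i; ring. Qed.
Lemma norm_mi z : `|- ('i : C) * z| = `|z|.
Proof. by rewrite normrM normrN normCi mul1r. Qed.
Lemma im_le_norm z : toC `|im z| <= `|z|.
Proof. by rewrite -re_mi -(norm_mi z); exact: re_le_norm. Qed.
Lemma norm_le_reim z : `|z| <= toC (`|re z| + `|im z|).
Proof.
rewrite [X in `|X|]reimE (le_trans (ler_normD _ _))// normrM normCi mul1r !toC_norm.
by rewrite rmorphD.
Qed.
Lemma gt0C (e : C) : 0 < e -> exists2 d : R, 0 < d & e = toC d.
Proof.
rewrite ltC /= => /andP[/eqP h1 h2]; exists (re e) => //.
by apply: eqC => //; rewrite im_toC.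
Qed.
Lemma ge0C (e : C) : 0 <= e -> exists2 d : R, 0 <= d & e = toC d.
Proof.
rewrite leC /= => /andP[/eqP h1 h2]; exists (re e) => //.
by apply: eqC => //; rewrite im_toC.
Qed.
Lemma real_toC (z : C) : z^* = z -> z = toC (re z).
Proof.
move=> h; apply: eqC => //; rewrite im_toC; have := congr1 im h.
by rewrite im_conj => h'; apply/eqP; rewrite -eqNr h'.
Qed.

(** A positive element of [Cplx R] is real, so real radii suffice to test convergence. *)
Lemma cvgCP (T : Type) (F : set_system T) {FF : Filter F} (f : T -> C) (l : C) :
  f @ F --> l <-> forall e : R, 0 < e -> \forall t \near F, `|l - f t| < toC e.
Proof.
split=> [h e e0|h].
  by move/cvgrPdist_lt : h => /(_ (toC e)); apply; rewrite (_ : 0 = toC 0) ?rmorph0// toC_lt.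
apply/cvgrPdist_lt => e /gt0C[d d0 ->]; exact: h.
Qed.

Lemma cvg_toC (T : Type) (F : set_system T) {FF : Filter F} (f : T -> R) (l : R) :
  f @ F --> l -> (toC \o f) @ F --> toC l.
Proof.
move=> h; apply/cvgCP => e e0; move/cvgrPdist_lt : h => /(_ e e0).
apply: filterS => t; by rewrite /= -rmorphB toC_norm toC_lt.
Qed.

Lemma cvg_re (T : Type) (F : set_system T) {FF : Filter F} (f : T -> C) (l : C) :
  f @ F --> l -> (re \o f) @ F --> re l.
Proof.
move=> /cvgCP h; apply/cvgrPdist_lt => e e0; apply: filterS (h e e0) => t /=.
by rewrite -reB -toC_lt; apply: le_lt_trans; exact: re_le_norm.
Qed.

Lemma cvg_conj (T : Type) (F : set_system T) {FF : Filter F} (f : T -> C) (l : C) :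
  f @ F --> l -> (fun t => (f t)^*) @ F --> l^*.
Proof.
move=> /cvgCP h; apply/cvgCP => e e0; apply: filterS (h e e0) => t /=.
by rewrite -rmorphB norm_conjC.
Qed.

Lemma near_cvg (T : Type) (U : topologicalType) (F : set_system T) {FF : Filter F}
    (f g : T -> U) (l : U) : f @ F --> l ->
  (\forall t \near F, f t = g t) -> g @ F --> l.
Proof.
move=> fl fg; apply: cvg_trans fl; apply: near_eq_cvg.
by apply: filterS fg => t ->.
Qed.

(** While the imaginary part of a coordinate moves from 0 to its final value, its modulus stays
    below the final one; this keeps the path of [box_mvt] inside the box. *)
Lemma norm_re_im_mono (a b t : R) : `|t| <= `|b| ->
  `|toC a + 'i * toC t| <= `|toC a + 'i * toC b|.
Proof.
move=> tb; rewrite !(normc_def (_ : R[i])) -!/(toC _) toC_le -!/(re _) -!/(im _).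
rewrite !reD !imD !reM !imM !re_toC !im_toC re_i im_i.
rewrite !(mul0r, mul1r, mulr0, subr0, addr0, add0r).
by apply: ler_wsqrtr; rewrite lerD2l -(real_normK (num_real t)) -(real_normK (num_real b)) ler_sqr ?nnegrE.
Qed.

End ComplexBasics.
Arguments re {R} z : simpl never.
Arguments im {R} z : simpl never.
Arguments toC {R} x : simpl never.

(** * Complex-valued curves of a real parameter and mean value inequalities *)

Section Curves.
Variable R : realType.
Local Notation C := (Cplx R).
Implicit Types (c : R -> C) (l : C).

(** The quotient has the shape of [diff_quotient], so that a partial derivative is literally the
    derivative of a curve. *)
Definition is_dcurve c (t : R) l :=
  ((fun h => (c (t + h) - c t) / toC h) @ 0^') --> l.

Lemma re_divC (z : C) (h : R) : re (z / toC h) = re z / h.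
Proof.
have -> : (toC h)^-1 = toC h^-1 by rewrite fmorphV.
by rewrite reM re_toC im_toC mulr0 subr0.
Qed.

Lemma is_dcurve_re c t l : is_dcurve c t l -> is_derive t 1 (re \o c) (re l).
Proof.
move=> /cvg_re h.
have {}h : (fun h => h^-1 *: ((re \o c) (h *: 1 + t) - (re \o c) t)) @ 0^' --> re l.
  rewrite (_ : (fun h => _) = re \o (fun h => (c (t + h) - c t) / toC h))//.
  by apply/funext => k; rewrite /= re_divC reB [k *: 1]mulr1 [t + k]addrC [RHS]mulrC.
split; first by apply/cvg_ex; exists (re l).
exact: cvg_lim h.
Qed.

Lemma is_dcurveZ (k : C) c t l : is_dcurve c t l -> is_dcurve (fun s => k * c s) t (k * l).
Proof.
move=> h; rewrite /is_dcurve (_ : (fun s => _) = cst k \* (fun s => (c (t + s) - c t) / toC s)).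
  exact: cvgM (cvg_cst k) h.
by apply/funext => s; rewrite /= -mulrBr mulrA.
Qed.

Lemma eq_dcurve c d t l : c =1 d -> is_dcurve c t l -> is_dcurve d t l.
Proof. by move=> /funext ->. Qed.

Lemma is_dcurveD c d t l m : is_dcurve c t l -> is_dcurve d t m ->
  is_dcurve (fun s => c s + d s) t (l + m).
Proof.
move=> hc hd; apply: (near_cvg (cvgD hc hd)); apply: nearW => s.
by rewrite fctE -mulrDl; congr (_ / _); ring.
Qed.

Lemma is_dcurve_cst (a : C) t : is_dcurve (fun=> a) t 0.
Proof.
by apply: (near_cvg (cvg_cst 0)); apply: nearW => k; rewrite subrr mul0r.
Qed.

Lemma is_dcurve_lin (a : C) t : is_dcurve (fun s => toC s * a) t a.
Proof.
apply: (near_cvg (cvg_cst a)).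
have : \forall h \near (0 : R)^', h != 0 by exact: nbhs_dnbhs_neq.
apply: filterS => h h0; rewrite /= -mulrBl -rmorphB addrAC subrr add0r mulrAC.
by rewrite divff ?mul1r// toC_eq0.
Qed.

Lemma is_dcurve_sq (a : C) : is_dcurve (fun s => toC s * toC s * a) 0 0.
Proof.
have h0 : (fun h : R => toC h) @ 0^' --> (0 : C).
  rewrite -(rmorph0 (@toC R)); apply: cvg_toC; exact: nbhs_dnbhs.
rewrite -[X in is_dcurve _ _ X](mul0r a); apply: (near_cvg (cvgM h0 (cvg_cst a))).
have : \forall h \near (0 : R)^', h != 0 by exact: nbhs_dnbhs_neq.
apply: filterS => h h0'; rewrite /= add0r rmorph0 !mul0r subr0.
by field; rewrite toC_eq0.
Qed.

Lemma is_dcurveN c t l : is_dcurve c t l -> is_dcurve (fun s => - c s) t (- l).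
Proof.
move=> h; have := @is_dcurveZ (-1) _ _ _ h; rewrite mulN1r (_ : (fun s => -1 * c s) = fun s => - c s)//.
by apply/funext => s; rewrite mulN1r.
Qed.

Lemma mvt_re c dc (a b e : R) : a <= b ->
  (forall t, a <= t <= b -> is_dcurve c t (dc t)) ->
  (forall t, a <= t <= b -> `|dc t| <= toC e) ->
  `|re (c b) - re (c a)| <= e * (b - a).
Proof.
rewrite le_eqVlt => /orP[/eqP <-|ab] dcE dce; first by rewrite !subrr normr0 mulr0.
have [x xab ->] : exists2 x, x \in `]a, b[%R &
    (re \o c) b - (re \o c) a = re (dc x) * (b - a).
  apply: MVT => // [x xab|].
    apply: is_dcurve_re; apply: dcE; move: xab.
    by rewrite in_itv /= => /andP[/ltW -> /ltW ->].
  apply: derivable_within_continuous => x; rewrite in_itv /= => xab.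
  by have [] := is_dcurve_re (dcE _ xab).
rewrite normrM (ger0_norm (_ : 0 <= b - a)) ?subr_ge0 ?(ltW ab)//.
rewrite ler_wpM2r ?subr_ge0 ?(ltW ab)// -toC_le (le_trans (re_le_norm _))//.
by apply: dce; move: xab; rewrite in_itv /= => /andP[/ltW -> /ltW ->].
Qed.

(** The mean value theorem applies to real functions only. The imaginary part is reached as the real
    part of [- 'i * c], and adding the two estimates costs the factor 2. *)
Lemma mvt_norm c dc (a b e : R) : a <= b ->
  (forall t, a <= t <= b -> is_dcurve c t (dc t)) ->
  (forall t, a <= t <= b -> `|dc t| <= toC e) ->
  `|c b - c a| <= toC (2 * e * (b - a)).
Proof.
move=> ab dcE dce; rewrite (le_trans (norm_le_reim _))// toC_le mulr_natl.
rewrite reB imB mulrDl lerD//; first exact: mvt_re dce.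
pose k : C := - 'i.
have := @mvt_re (fun t => k * c t) (fun t => k * dc t) a b e ab.
rewrite /= !re_mi; apply => t tab; first by apply: is_dcurveZ; exact: dcE.
by rewrite norm_mi; exact: dce.
Qed.

Lemma is_dcurve_opp c t l : is_dcurve c (- t) l -> is_dcurve (fun s => c (- s)) t (- l).
Proof.
move=> h; have : (fun h => (c (- t + h) - c (- t)) / toC h) \o -%R @ 0^' --> l.
  apply: (cvg_comp _ _ _ h) => A [e /= e0 he]; exists e => //= y ye y0.
  by apply: he; rewrite /= ?oppr_eq0 //; move: ye; rewrite /= !sub0r !normrN.
move=> h'; apply: (near_cvg (cvgN h')); apply: nearW => s; rewrite !fctE /=.
by rewrite rmorphN invrN mulrN opprK opprD.
Qed.

Lemma mvt_norm0 c dc (h e : R) :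
  (forall t, `|t| <= `|h| -> is_dcurve c t (dc t)) ->
  (forall t, `|t| <= `|h| -> `|dc t| <= toC e) ->
  `|c h - c 0| <= toC (2 * e * `|h|).
Proof.
wlog h0 : c dc h / 0 <= h => [hw|] cd dce.
  have [h0|/ltW h0] := leP 0 h; first exact: hw cd dce.
  have := hw (fun s => c (- s)) (fun s => - dc (- s)) (- h).
  rewrite oppr_ge0 opprK oppr0 normrN; apply => [|t th|t th]; first exact: h0.
    by apply: is_dcurve_opp; apply: cd; rewrite normrN.
  by rewrite normrN; apply: dce; rewrite normrN.
have th' t : 0 <= t <= h -> `|t| <= `|h|.
  by move=> /andP[t0 th]; rewrite (ger0_norm t0) (ger0_norm h0).
have := @mvt_norm c dc 0 h e h0; rewrite subr0 (ger0_norm h0); apply => t /th'.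
  exact: cd.
exact: dce.
Qed.

End Curves.

(** * Partial derivatives *)

Section Partials.
Context (R : realType) (E : topologicalType) (J : Type).
Variables (move : J -> R -> E -> E) (D : set E).
Local Notation C := (Cplx R).
Local Notation step := (step_filter move D).
Local Notation pd := (partial move D).
Implicit Types (f g : E -> C) (j : J) (x : E) (l : C).

Definition is_partial j f x l := diff_quotient move j f x @ step j x --> l.

Global Instance step_filter_filter j x : Filter (step j x).
Proof. exact: within_filter. Qed.

Lemma diff_quotientE j f x (h : R) :
  diff_quotient move j f x h = (f (move j h x) - f x) / toC h.
Proof. by []. Qed.

Lemma within_continuousP f : {within D, continuous f} <->
  forall x, D x -> f @ within D (nbhs x) --> f x.
Proof. exact: subspace_continuousP. Qed.

Lemma within_continuous_ext f g : (forall y, D y -> f y = g y) ->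
  {within D, continuous f} -> {within D, continuous g}.
Proof.
move=> fg /within_continuousP h; apply/within_continuousP => x Dx.
rewrite -fg//; apply: (near_cvg (h x Dx)).
by rewrite near_withinE; apply: nearW => y; exact: fg.
Qed.

(** Properness makes limits unique, so that the [lim] inside [partial] agrees with any limit that is
    exhibited. It holds for open sets and also at the closed end of a time interval. *)
Hypothesis step_proper : forall j x, D x -> ProperFilter (step j x).

Lemma is_partialE j f x l : D x -> is_partial j f x l -> pd j f x = l.
Proof. by move=> Dx h; have := step_proper j Dx => ?; exact: cvg_lim h. Qed.

Lemma has_partialP j f x : has_partial move D j f x -> is_partial j f x (pd j f x).
Proof. by []. Qed.

Lemma is_partial_has j f x l : is_partial j f x l -> has_partial move D j f x.
Proof. by move=> h; apply/cvg_ex; exists l. Qed.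

Lemma step_near0 j x : (fun h : R => toC h) @ step j x --> (0 : C).
Proof.
rewrite -(rmorph0 (@toC R)); apply: cvg_toC.
by move=> A /nbhs_dnbhs; exact: cvg_within.
Qed.

Lemma step_neq0 j x : \forall h \near step j x, h != 0.
Proof.
have : \forall h \near (0:R)^', h != 0 by exact: nbhs_dnbhs_neq.
exact: cvg_within.
Qed.

Lemma step_in j x : \forall h \near step j x, D (move j h x).
Proof. by apply: (@withinT _ _ _); exact: filterT. Qed.

Lemma is_partial_cvg j f x l : is_partial j f x l ->
  f (move j h x) @[h --> step j x] --> f x.
Proof.
move=> h; rewrite -[f x]add0r -[X in X + _](mulr0 l).
apply: (near_cvg (cvgD (cvgM h (step_near0 j x)) (cvg_cst (f x)))).
apply: filterS (step_neq0 j x) => k k0.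
by rewrite fctE /= divfK ?subrK// toC_eq0.
Qed.

Lemma is_partial_eq j f g x l : (forall y, D y -> f y = g y) -> D x ->
  is_partial j f x l -> is_partial j g x l.
Proof.
move=> fg Dx /near_cvg; apply.
by apply: filterS (step_in j x) => k Dk; rewrite !diff_quotientE !fg.
Qed.

Lemma is_partial_cst j x (a : C) : is_partial j (fun=> a) x 0.
Proof.
apply: (near_cvg (cvg_cst 0)); apply: nearW => k.
by rewrite !diff_quotientE subrr mul0r.
Qed.

Lemma is_partialD j f g x l m : is_partial j f x l -> is_partial j g x m ->
  is_partial j (fun y => f y + g y) x (l + m).
Proof.
move=> hf hg; apply: (near_cvg (cvgD hf hg)); apply: nearW => k.
by rewrite !diff_quotientE fctE -mulrDl; congr (_ / _); ring.
Qed.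

Lemma is_partialM j f g x l m : is_partial j f x l -> is_partial j g x m ->
  is_partial j (fun y => f y * g y) x (l * g x + f x * m).
Proof.
move=> hf hg; have cf := is_partial_cvg hf.
apply: (near_cvg (cvgD (cvgM hf (cvg_cst (g x))) (cvgM cf hg))); apply: nearW => k.
by rewrite !diff_quotientE fctE /= mulrAC mulrA -mulrDl; congr (_ / _); ring.
Qed.

Lemma is_partial_conj j f x l : is_partial j f x l ->
  is_partial j (fun y => (f y)^*) x l^*.
Proof.
move=> /cvg_conj/near_cvg; apply; apply: nearW => k.
rewrite !diff_quotientE -rmorphB rmorphM fmorphV; congr (_ / _).
exact: toC_conj.
Qed.

Lemma is_partialV j f x l : f x != 0 -> is_partial j f x l ->
  is_partial j (fun y => (f y)^-1) x (- l * (f x)^-1 * (f x)^-1).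
Proof.
move=> f0 hf; have cf := is_partial_cvg hf.
apply: (near_cvg (cvgM (cvgM (cvgN hf) (cvgV f0 cf)) (cvg_cst (f x)^-1))).
have fk : \forall k \near step j x, f (move j k x) != 0.
  move/cvgCP : cf; have n0 : 0 < re `|f x| by rewrite -toC_lt -norm_re rmorph0 normr_gt0.
  move=> /(_ _ n0); apply: filterS => k; rewrite -norm_re; apply: contraTneq => ->.
  by rewrite subr0 ltxx.
apply: filterS fk => k fk0; rewrite !diff_quotientE !fctE /=.
rewrite [LHS](_ : _ = - ((f (move j k x) - f x) / toC k) / f (move j k x) / f x)//.
have [->|k0] := eqVneq (toC k) 0; first by rewrite invr0 !mulr0 oppr0 !mul0r.
by field; rewrite fk0 f0 k0.
Qed.

(* Caratheodory's form of the derivative of [k] at [r x] turns the quotient of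
   [k \o r] into a product. *)
Lemma is_partial_comp j (r : E -> R) (k : R -> R) x l dk :
  is_derive (r x) 1 k dk -> is_partial j (fun y => toC (r y)) x l ->
  is_partial j (fun y => toC (k (r y))) x (toC dk * l).
Proof.
move=> kd hr; have cr : (fun h => r (move j h x)) @ step j x --> r x.
  exact: (cvg_re (is_partial_cvg hr)).
pose q y := if y == r x then dk else (k y - k (r x)) / (y - r x).
have cq : q @ r x --> q (r x).
  have [kd1 kd2] := kd.
  have h : h^-1 *: (k (h *: 1 + r x) - k (r x)) @[h --> 0^'] --> dk.
    by rewrite -kd2; exact: kd1.
  rewrite {2}/q eqxx; apply/cvgrPdist_lt => e e0.
  move/cvgrPdist_lt : h => /(_ _ e0) /nbhs_ballP [d /= d0 hd].
  apply/nbhs_ballP; exists d => // y; rewrite /ball /= => yd; rewrite /q.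
  case: eqP => [_|/eqP yx]; first by rewrite subrr normr0.
  have := hd (y - r x); rewrite /ball /= sub0r normrN distrC subr_eq0 => /(_ yd yx).
  by rewrite [_ *: 1]mulr1 subrK mulrC.
have : (fun h => toC (q (r (move j h x)))) @ step j x --> toC (q (r x)).
  by apply: cvg_toC; exact: cvg_comp cr cq.
rewrite {2}/q eqxx => h; apply: (near_cvg (cvgM h hr)); apply: nearW => s.
rewrite !diff_quotientE /= mulrA; congr (_ / _); rewrite -!rmorphB -rmorphM; congr toC.
rewrite /q; case: eqP => [->|/eqP h']; first by rewrite !subrr mulr0.
by rewrite divfK// subr_eq0.
Qed.

Local Notation Ckl := (Ck move D).

Lemma Ck_cont k f : Ckl k f -> {within D, continuous f}.
Proof. by case: k => [|k] []. Qed.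

Lemma Ck_ext k f g : (forall y, D y -> f y = g y) -> Ckl k f -> Ckl k g.
Proof.
elim: k f g => [|k ih] f g fg [cf].
  by move=> _; split; [exact: within_continuous_ext cf | exact: I].
move=> pf; split; first exact: within_continuous_ext cf.
move=> j; have [h1 h2] := pf j.
have ph x : D x -> is_partial j g x (pd j f x).
  by move=> Dx; exact: (is_partial_eq fg Dx (has_partialP (h1 x Dx))).
split; first by move=> x Dx; exact: (is_partial_has (ph x Dx)).
by apply: (ih (pd j f) _ _ h2) => y Dy; rewrite (is_partialE Dy (ph y Dy)).
Qed.

(** The closure properties of [Ck] below rest on this lemma: a candidate [df] for the derivatives is
    exhibited, and it only has to agree with [partial] on [D]. *)
Lemma CkS k f (df : J -> E -> C) : {within D, continuous f} ->
  (forall j x, D x -> is_partial j f x (df j x)) ->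
  (forall j, Ckl k (df j)) -> Ckl k.+1 f.
Proof.
move=> cf pf kf; split; first exact: cf.
move=> j; split; first by move=> x Dx; exact: (is_partial_has (pf j x Dx)).
by apply: (@Ck_ext k (df j) _ _ (kf j)) => y Dy; rewrite (is_partialE Dy (pf j y Dy)).
Qed.

Lemma Ck_partial k f j x : Ckl k.+1 f -> D x -> is_partial j f x (pd j f x).
Proof. by move=> [_ /(_ j)[h _]] Dx; exact: (has_partialP (h x Dx)). Qed.

Arguments Ck_partial {k f} j {x}.

Lemma Ck_pd k f j : Ckl k.+1 f -> Ckl k (pd j f).
Proof. by move=> [_ /(_ j)[]]. Qed.

Arguments Ck_pd {k f} j.

Lemma CkW k f : Ckl k.+1 f -> Ckl k f.
Proof.
elim: k f => [|k ih] f hf; first by split; [exact: Ck_cont hf | exact: I].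
split; first exact: Ck_cont hf.
move=> j; split; first by move=> x Dx; exact: (is_partial_has (Ck_partial j hf Dx)).
exact: (ih _ (Ck_pd j hf)).
Qed.

Lemma within_continuousD f g : {within D, continuous f} -> {within D, continuous g} ->
  {within D, continuous (fun y => f y + g y)}.
Proof.
move=> /within_continuousP hf /within_continuousP hg; apply/within_continuousP => x Dx.
exact: (cvgD (hf x Dx) (hg x Dx)).
Qed.

Lemma within_continuousM f g : {within D, continuous f} -> {within D, continuous g} ->
  {within D, continuous (fun y => f y * g y)}.
Proof.
move=> /within_continuousP hf /within_continuousP hg; apply/within_continuousP => x Dx.
exact: (cvgM (hf x Dx) (hg x Dx)).
Qed.

Lemma within_continuous_conj f : {within D, continuous f} ->
  {within D, continuous (fun y => (f y)^*)}.
Proof.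
move=> /within_continuousP hf; apply/within_continuousP => x Dx.
exact: (cvg_conj (hf x Dx)).
Qed.

Lemma within_continuousV f : (forall x, D x -> f x != 0) -> {within D, continuous f} ->
  {within D, continuous (fun y => (f y)^-1)}.
Proof.
move=> f0 /within_continuousP hf; apply/within_continuousP => x Dx.
exact: (cvgV (f0 x Dx) (hf x Dx)).
Qed.

Lemma within_continuous_cst (a : C) : {within D, continuous (fun=> a : C)}.
Proof. by apply/within_continuousP => x Dx; exact: cvg_cst. Qed.

Lemma CkD k f g : Ckl k f -> Ckl k g -> Ckl k (fun y => f y + g y).
Proof.
elim: k f g => [|k ih] f g hf hg.
  by split; [exact: within_continuousD (Ck_cont hf) (Ck_cont hg) | exact: I].
apply: (@CkS k _ (fun j y => pd j f y + pd j g y)).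
- exact: within_continuousD (Ck_cont hf) (Ck_cont hg).
- by move=> j x Dx; exact: (is_partialD (Ck_partial j hf Dx) (Ck_partial j hg Dx)).
- by move=> j; exact: (ih _ _ (Ck_pd j hf) (Ck_pd j hg)).
Qed.

Lemma CkM k f g : Ckl k f -> Ckl k g -> Ckl k (fun y => f y * g y).
Proof.
elim: k f g => [|k ih] f g hf hg.
  by split; [exact: within_continuousM (Ck_cont hf) (Ck_cont hg) | exact: I].
apply: (@CkS k _ (fun j y => pd j f y * g y + f y * pd j g y)).
- exact: within_continuousM (Ck_cont hf) (Ck_cont hg).
- by move=> j x Dx; exact: (is_partialM (Ck_partial j hf Dx) (Ck_partial j hg Dx)).
- move=> j; exact: (CkD (ih _ _ (Ck_pd j hf) (CkW hg)) (ih _ _ (CkW hf) (Ck_pd j hg))).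
Qed.

Lemma Ck_cst k a : Ckl k (fun=> a).
Proof.
elim: k a => [|k ih] a; first by split; [exact: within_continuous_cst | exact: I].
apply: (@CkS k _ (fun j y => 0)); first exact: within_continuous_cst.
  by move=> j x _; exact: is_partial_cst.
by move=> j; exact: ih.
Qed.

Lemma Ck_conj k f : Ckl k f -> Ckl k (fun y => (f y)^*).
Proof.
elim: k f => [|k ih] f hf.
  by split; [exact: within_continuous_conj (Ck_cont hf) | exact: I].
apply: (@CkS k _ (fun j y => (pd j f y)^*)).
- exact: within_continuous_conj (Ck_cont hf).
- by move=> j x Dx; exact: (is_partial_conj (Ck_partial j hf Dx)).
- by move=> j; exact: (ih _ (Ck_pd j hf)).
Qed.

Lemma CkV k f : (forall x, D x -> f x != 0) -> Ckl k f -> Ckl k (fun y => (f y)^-1).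
Proof.
move=> f0; elim: k => [|k ih] hf.
  by split; [exact: within_continuousV (Ck_cont hf) | exact: I].
apply: (@CkS k _ (fun j y => - 1 * pd j f y * (f y)^-1 * (f y)^-1)).
- exact: within_continuousV (Ck_cont hf).
- by move=> j x Dx; rewrite mulN1r; exact: (is_partialV (f0 x Dx) (Ck_partial j hf Dx)).
- move=> j; have fk := ih (CkW hf).
  exact: (CkM (CkM (CkM (Ck_cst k (-1)) (Ck_pd j hf)) fk) fk).
Qed.

Lemma Ck_ln k (r : E -> R) : (forall x, D x -> 0 < r x) ->
  Ckl k (fun y => toC (r y)) -> Ckl k (fun y => toC (ln (r y))).
Proof.
move=> r0 hr.
have cl : {within D, continuous (fun y => toC (ln (r y)))}.
  apply/within_continuousP => x Dx; apply: cvg_toC.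
  have /within_continuousP/(_ x Dx)/cvg_re rc := Ck_cont hr.
  apply: (cvg_comp _ _ rc); exact: (continuous_ln (r0 x Dx)).
case: k hr => [|k] hr; first by split; [exact: cl | exact: I].
apply: (@CkS k _ (fun j y => toC (r y)^-1 * pd j (fun y => toC (r y)) y)).
- exact: cl.
- move=> j x Dx; apply: is_partial_comp; last exact: (Ck_partial j hr Dx).
  exact: (is_derive1_ln (r0 x Dx)).
- move=> j; apply: CkM; last exact: (Ck_pd j hr).
  apply: (@Ck_ext k (fun y => (toC (r y))^-1)); first by move=> y _; rewrite fmorphV.
  by apply: CkV (CkW hr) => x Dx; rewrite toC_eq0 gt_eqF// r0.
Qed.

End Partials.

Arguments Ck_partial {R E J move D k f} j {x}.
Arguments Ck_pd {R E J move D k f} j.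

(** * Symmetry of second partial derivatives *)

Section OpenDomain.
Context (R : realType) (E : topologicalType) (J : Type).
Variables (move : J -> R -> E -> E) (D : set E).
Local Notation C := (Cplx R).
Local Notation pd := (partial move D).
Local Notation Ckl := (Ck move D).
Implicit Types (f g : E -> C) (j : J) (x : E).

(** The commuting flows along the coordinates, reduced to what the symmetry of second derivatives
    uses. Both C^n and C^n x R are instances. *)
Definition move_action :=
  [/\ (forall j x, move j 0 x = x),
      (forall j s t x, move j (s + t) x = move j s (move j t x)),
      (forall i j s t x, move i s (move j t x) = move j t (move i s x)) &
      (forall i j x (A : set E), nbhs x A -> exists2 d : R, 0 < d &
         forall s t, `|s| <= d -> `|t| <= d -> A (move i s (move j t x)))].

Hypothesis mv : move_action.
Lemma interior_step (A : set E) j x : nbhs x A -> step_filter move A j x = 0^'.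
Proof.
move=> nA; have [m0 _ _ mn] := mv; have [d d0 dA] := mn j j x A nA.
apply/seteqP; split=> B hB.
  have {}hB : \forall t \near (0 : R)^', A (move j t x) -> B t by exact: hB.
  have : \forall t \near (0 : R)^', A (move j t x).
    exists d => // t /=; rewrite sub0r normrN => td _.
    by have := dA t 0; rewrite m0; apply; rewrite ?normr0 ltW.
  by move=> nAt; apply: filterS2 hB nAt => t h1 h2; exact: h1 h2.
by apply: filterS hB => t Bt _.
Qed.

Hypothesis oD : open D.

Lemma open_step j x : D x -> step_filter move D j x = 0^'.
Proof. by move=> Dx; exact: interior_step (open_nbhs_nbhs (conj oD Dx)). Qed.

Lemma open_step_proper j x : D x -> ProperFilter (step_filter move D j x).
Proof. by move=> Dx; rewrite (open_step j Dx); exact: Proper_dnbhs_numFieldType. Qed.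

Lemma move_curve j f t x l : D (move j t x) -> is_partial move D j f (move j t x) l ->
  is_dcurve (fun s => f (move j s x)) t l.
Proof.
move=> Dx; rewrite /is_partial (open_step j Dx) => h.
have [m0 mD mc mn] := mv.
by apply: (near_cvg h); apply: nearW => s; rewrite diff_quotientE [t + s]addrC mD.
Qed.

Lemma eqC_eps (a b : C) (k : R) : 0 < k ->
  (forall e : R, 0 < e -> `|a - b| <= toC (k * e)) -> a = b.
Proof.
move=> k0 h; apply/eqP; rewrite -subr_eq0 -normr_eq0; apply/negP => /negP n0.
have [d d0 dE] : exists2 d : R, 0 < d & `|a - b| = toC d.
  by apply: gt0C; rewrite lt_neqAle eq_sym n0 normr_ge0.
have := h (d / (2 * k)); rewrite dE toC_le divr_gt0 ?mulr_gt0// => /(_ isT).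
apply/negP; rewrite -ltNge (_ : k * _ = d / 2) ?ltr_pdivrMr ?ltr_pMr//; first by lra.
by field; rewrite gt_eqF.
Qed.

Lemma open_continuous f x : {within D, continuous f} -> D x ->
  forall e : R, 0 < e -> nbhs x [set y | D y /\ `|f y - f x| <= toC e].
Proof.
move=> /within_continuousP/(_ x) h Dx e e0.
have /cvgCP/(_ e e0) := h Dx; rewrite near_withinE => {}h.
have nD := open_nbhs_nbhs (conj oD Dx).
by apply: filterS2 h nD => y h1 h2; split=> //; rewrite distrC ltW// h1.
Qed.

(** The mean value inequality is applied twice. In direction j, the function [c1] has as derivative
    the increment of [pd j f] in direction i minus its expected value; that derivative is bounded by
    the mean value inequality in direction i for [c2], using the continuity of the second derivative
    at x. *)
Lemma second_difference i j f x : Ckl 2 f -> D x -> forall e : R, 0 < e ->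
  exists2 d : R, 0 < d & forall h, `|h| <= d ->
  `|f (move i h (move j h x)) - f (move j h x) - f (move i h x) + f x
    - toC h * toC h * pd i (pd j f) x| <= toC (4 * e * `|h| * `|h|).
Proof.
move=> f2 Dx e e0; have [m0 mD mc mn] := mv.
have f1 := Ck_pd j f2.
set c := pd i (pd j f) x.
have [d d0 dD] := mn i j x _ (open_continuous (Ck_cont (Ck_pd i f1)) Dx e0).
exists d => // h hd.
pose c1 t := f (move i h (move j t x)) - f (move j t x) - toC h * toC t * c.
pose dc1 t := pd j f (move i h (move j t x)) - pd j f (move j t x) - toC h * c.
have in_d (t : R) : `|t| <= `|h| -> `|t| <= d by move=> /le_trans; apply.
have Dst (s t : R) : `|s| <= `|h| -> `|t| <= `|h| -> D (move i s (move j t x)).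
  by move=> sh th; have [] := dD s t (in_d s sh) (in_d t th).
have z0 : `|0 : R| <= `|h| by rewrite normr0.
have sp := open_step_proper.
have c1D (t : R) : `|t| <= `|h| -> is_dcurve c1 t (dc1 t).
  move=> th; rewrite /c1 /dc1; apply: is_dcurveD.
    apply: is_dcurveD.
      rewrite (_ : (fun s => _) = fun s => f (move j s (move i h x))); last first.
        by apply/funext => s; rewrite mc.
      rewrite mc; apply: move_curve; first by rewrite -mc; exact: Dst.
      by apply: (Ck_partial j f2); rewrite -mc; exact: Dst.
    rewrite -mulN1r (_ : (fun s => _) = fun s => -1 * f (move j s x)); last first.
      by apply/funext => s; rewrite mulN1r.
    apply: is_dcurveZ; have D0t : D (move j t x) by have := Dst 0 t z0 th; rewrite m0.
    by apply: move_curve; [exact: D0t | exact: (Ck_partial j f2 D0t)].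
  rewrite (_ : (fun s => _) = fun s => toC s * (- (toC h * c))); last first.
    by apply/funext => s; ring.
  exact: is_dcurve_lin.
have dc1e (t : R) : `|t| <= `|h| -> `|dc1 t| <= toC (2 * e * `|h|).
  move=> th; pose c2 s := pd j f (move i s (move j t x)) - toC s * c.
  pose dc2 s := pd i (pd j f) (move i s (move j t x)) - c.
  have := @mvt_norm0 _ c2 dc2 h e.
  rewrite /c2 m0 (_ : (_ - _) - _ = dc1 t); last by rewrite /dc1 rmorph0; ring.
  apply=> s sh; last by have [] := dD s t (in_d s sh) (in_d t th).
  apply: is_dcurveD; last first.
    rewrite (_ : (fun s => _) = fun s => toC s * (- c)); first exact: is_dcurve_lin.
    by apply/funext => s0; ring.
  by apply: move_curve; [exact: Dst | apply: (Ck_partial i f1); exact: Dst].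
have := mvt_norm0 c1D dc1e; rewrite /c1 !m0 => H.
rewrite (_ : _ - _ = f (move i h (move j h x)) - f (move j h x) - toC h * toC h * c
   - (f (move i h x) - f x - toC h * toC 0 * c)); last by rewrite rmorph0; ring.
by apply: (le_trans H); rewrite toC_le; nra.
Qed.

(** The second difference is symmetric in i and j, and both mixed derivatives approximate it after
    division by h^2. The constant 8 is 4 from each approximation. *)
Lemma clairaut i j f x : Ckl 2 f -> D x -> pd i (pd j f) x = pd j (pd i f) x.
Proof.
move=> f2 Dx; apply: (@eqC_eps _ _ 8) => // e e0.
have [m0 mD mc mn] := mv.
have [d d0 hd] := second_difference i j f2 Dx e0.
have [d' d'0 hd'] := second_difference j i f2 Dx e0.
pose h := Num.min d d'.
have h0 : 0 < h by rewrite lt_min d0.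
have h1 : `|h| <= d by rewrite gtr0_norm// ge_min lexx.
have h2 : `|h| <= d' by rewrite gtr0_norm// ge_min lexx orbT.
have := hd' h h2; have := hd h h1; rewrite !(gtr0_norm h0) (mc j i).
set A := f _; set B := f _; set B' := f _; set a := pd _ _ _; set b := pd _ _ _.
move=> H1 H2.
have H : `|toC h * toC h * (a - b)| <= toC (8 * e * h * h).
  rewrite (_ : _ * _ = (A - B' - B + f x - toC h * toC h * b)
    - (A - B - B' + f x - toC h * toC h * a)); last by ring.
  rewrite (le_trans (ler_normB _ _))//.
  have -> : toC (8 * e * h * h) = toC (4 * e * h * h) + toC (4 * e * h * h).
    by rewrite -rmorphD; congr toC; ring.
  exact: lerD.
have hh : 0 < toC h * toC h by rewrite -rmorphM -(rmorph0 (@toC R)) toC_lt mulr_gt0.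
rewrite -(ler_pM2l hh) -[X in X * `|_|]ger0_norm ?(ltW hh)// -normrM (le_trans H)//.
by rewrite -!rmorphM toC_le; nra.
Qed.

End OpenDomain.

(** * Directional derivatives *)

Section Dir.
Context (R : realType) (E : topologicalType) (J : finType).
Variables (move : J -> R -> E -> E) (D : set E).
Local Notation C := (Cplx R).
Local Notation pd := (partial move D).
Local Notation smth := (smooth move D).
Implicit Types (f g : E -> C) (a b : J -> C) (x : E).

(** The coefficients are complex while the partial derivatives are real. Holomorphic,
    antiholomorphic and time derivatives thus become instances of one operator, and conjugation of
    functions becomes conjugation of coefficients. *)
Definition dir a f x : C := \sum_j a j * pd j f x.

Hypothesis sp : forall j x, D x -> ProperFilter (step_filter move D j x).

Lemma smooth_isp f j x : smth f -> D x -> is_partial move D j f x (pd j f x).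
Proof. by move=> sf Dx; exact: (Ck_partial j (sf 1) Dx). Qed.

Arguments smooth_isp {f} j {x}.

Lemma smooth_ext f g : (forall y, D y -> f y = g y) -> smth f -> smth g.
Proof. by move=> fg sf k; exact: (Ck_ext sp fg (sf k)). Qed.

Lemma smooth_cst (c : C) : smth (fun=> c).
Proof. by move=> k; exact: (Ck_cst sp). Qed.

Lemma smoothD f g : smth f -> smth g -> smth (fun y => f y + g y).
Proof. by move=> sf sg k; exact: (CkD sp (sf k) (sg k)). Qed.

Lemma smoothM f g : smth f -> smth g -> smth (fun y => f y * g y).
Proof. by move=> sf sg k; exact: (CkM sp (sf k) (sg k)). Qed.

Lemma smooth_conj f : smth f -> smth (fun y => (f y)^*).
Proof. by move=> sf k; exact: (Ck_conj sp (sf k)). Qed.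

Lemma smoothV f : (forall x, D x -> f x != 0) -> smth f -> smth (fun y => (f y)^-1).
Proof. by move=> f0 sf k; exact: (CkV sp f0 (sf k)). Qed.

Lemma smooth_ln (r : E -> R) : (forall x, D x -> 0 < r x) ->
  smth (fun y => toC (r y)) -> smth (fun y => toC (ln (r y))).
Proof. by move=> r0 sr k; exact: (Ck_ln sp r0 (sr k)). Qed.

Lemma smoothN f : smth f -> smth (fun y => - f y).
Proof.
move=> sf; apply: (smooth_ext _ (smoothM (smooth_cst (-1)) sf)) => y _.
by rewrite mulN1r.
Qed.

Lemma smooth_sum (I : Type) (r : seq I) (P : pred I) (F : I -> E -> C) :
  (forall i, smth (F i)) -> smth (fun y => \sum_(i <- r | P i) F i y).
Proof.
move=> sF; elim: r => [|i r ih].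
  by apply: (smooth_ext _ (smooth_cst 0)) => y _; rewrite big_nil.
have [Pi|nPi] := boolP (P i).
  by apply: (smooth_ext _ (smoothD (sF i) ih)) => y _; rewrite big_cons Pi.
by apply: (smooth_ext _ ih) => y _; rewrite big_cons (negbTE nPi).
Qed.

Lemma smooth_prod (I : Type) (r : seq I) (P : pred I) (F : I -> E -> C) :
  (forall i, smth (F i)) -> smth (fun y => \prod_(i <- r | P i) F i y).
Proof.
move=> sF; elim: r => [|i r ih].
  by apply: (smooth_ext _ (smooth_cst 1)) => y _; rewrite big_nil.
have [Pi|nPi] := boolP (P i).
  by apply: (smooth_ext _ (smoothM (sF i) ih)) => y _; rewrite big_cons Pi.
by apply: (smooth_ext _ ih) => y _; rewrite big_cons (negbTE nPi).
Qed.

Lemma smooth_pd f j : smth f -> smth (pd j f).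
Proof. by move=> sf k; exact: (Ck_pd j (sf k.+1)). Qed.

Lemma smooth_dir a f : smth f -> smth (dir a f).
Proof.
move=> sf; apply: smooth_sum => j; apply: smoothM; first exact: smooth_cst.
exact: smooth_pd.
Qed.

Arguments smooth_pd {f} j.

Lemma pd_eq f g j x : (forall y, D y -> f y = g y) -> smth f -> D x ->
  pd j g x = pd j f x.
Proof.
move=> fg sf Dx; apply: (is_partialE sp Dx).
exact: (is_partial_eq fg Dx (smooth_isp j sf Dx)).
Qed.

Arguments pd_eq {f g} j {x}.

Lemma dir_ext f g a x : (forall y, D y -> f y = g y) -> smth f -> D x ->
  dir a f x = dir a g x.
Proof. by move=> fg sf Dx; apply: eq_bigr => j _; rewrite (pd_eq j fg sf Dx). Qed.

Lemma pdD f g j x : smth f -> smth g -> D x ->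
  pd j (fun y => f y + g y) x = pd j f x + pd j g x.
Proof.
move=> sf sg Dx; apply: (is_partialE sp Dx).
exact: (is_partialD (smooth_isp j sf Dx) (smooth_isp j sg Dx)).
Qed.

Lemma dirD f g a x : smth f -> smth g -> D x ->
  dir a (fun y => f y + g y) x = dir a f x + dir a g x.
Proof.
move=> sf sg Dx; rewrite /dir -big_split; apply: eq_bigr => j _ /=.
by rewrite pdD// mulrDr.
Qed.

Lemma dirM f g a x : smth f -> smth g -> D x ->
  dir a (fun y => f y * g y) x = dir a f x * g x + f x * dir a g x.
Proof.
move=> sf sg Dx; rewrite /dir mulr_suml mulr_sumr -big_split; apply: eq_bigr => j _ /=.
rewrite (is_partialE sp Dx (is_partialM (smooth_isp j sf Dx) (smooth_isp j sg Dx))).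
by rewrite mulrDr mulrA mulrCA.
Qed.

Lemma dir_cst a (c : C) x : D x -> dir a (fun=> c) x = 0.
Proof.
move=> Dx; rewrite /dir big1// => j _.
by rewrite (is_partialE sp Dx (is_partial_cst move D j x c)) mulr0.
Qed.

Lemma dirZ a (c : C) f x : smth f -> D x -> dir a (fun y => c * f y) x = c * dir a f x.
Proof.
by move=> sf Dx; rewrite dirM ?dir_cst ?mul0r ?add0r//; exact: smooth_cst.
Qed.

Lemma dirN a f x : smth f -> D x -> dir a (fun y => - f y) x = - dir a f x.
Proof.
move=> sf Dx; rewrite -(dir_ext (f := fun y => -1 * f y)) ?dirZ ?mulN1r//.
  by move=> y _; rewrite mulN1r.
by apply: smoothM => //; exact: smooth_cst.
Qed.

Lemma dir_sum (I : Type) (r : seq I) (P : pred I) (F : I -> E -> C) a x :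
  (forall i, smth (F i)) -> D x ->
  dir a (fun y => \sum_(i <- r | P i) F i y) x = \sum_(i <- r | P i) dir a (F i) x.
Proof.
move=> sF Dx; elim: r => [|i r ih].
  rewrite big_nil -(dir_ext (f := fun=> 0)) ?dir_cst//; last exact: smooth_cst.
  by move=> y _; rewrite big_nil.
rewrite big_cons; have [Pi|nPi] := boolP (P i).
  rewrite -(dir_ext (f := fun y => F i y + \sum_(i <- r | P i) F i y)) ?dirD ?ih//.
  - exact: smooth_sum.
  - by move=> y _; rewrite big_cons Pi.
  - by apply: smoothD => //; exact: smooth_sum.
rewrite -(dir_ext (f := fun y => \sum_(i <- r | P i) F i y)) ?ih//.
- by move=> y _; rewrite big_cons (negbTE nPi).
- exact: smooth_sum.
Qed.

Lemma dir_conj a f x : smth f -> D x ->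
  dir a (fun y => (f y)^*) x = (dir (fun j => (a j)^*) f x)^*.
Proof.
move=> sf Dx; rewrite /dir rmorph_sum; apply: eq_bigr => j _ /=.
rewrite (is_partialE sp Dx (is_partial_conj (smooth_isp j sf Dx))) rmorphM.
by congr (_ * _); rewrite /= conjCK.
Qed.

Lemma dirV a f x : (forall y, D y -> f y != 0) -> smth f -> D x ->
  dir a (fun y => (f y)^-1) x = - dir a f x * (f x)^-1 * (f x)^-1.
Proof.
move=> f0 sf Dx; rewrite /dir -sumrN !mulr_suml; apply: eq_bigr => j _.
rewrite (is_partialE sp Dx (is_partialV (f0 x Dx) (smooth_isp j sf Dx))).
by rewrite !mulrA !mulrN mulNr.
Qed.

Lemma dir_ln a (r : E -> R) x : (forall x, D x -> 0 < r x) ->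
  smth (fun y => toC (r y)) -> D x ->
  dir a (fun y => toC (ln (r y))) x = (toC (r x))^-1 * dir a (fun y => toC (r y)) x.
Proof.
move=> r0 sr Dx; rewrite /dir mulr_sumr; apply: eq_bigr => j _.
rewrite (is_partialE sp Dx (is_partial_comp (is_derive1_ln (r0 x Dx)) (smooth_isp j sr Dx))).
by rewrite mulrCA -fmorphV.
Qed.

Lemma dir_coefD a b f x : dir (fun j => a j + b j) f x = dir a f x + dir b f x.
Proof. by rewrite /dir -big_split; apply: eq_bigr => j _; rewrite mulrDl. Qed.

Lemma dir_coefZ (c : C) a f x : dir (fun j => c * a j) f x = c * dir a f x.
Proof. by rewrite /dir mulr_sumr; apply: eq_bigr => j _; rewrite mulrA. Qed.

Lemma dir_coef_sum (I : Type) (r : seq I) (P : pred I) (a : I -> J -> C) f x :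
  dir (fun j => \sum_(i <- r | P i) a i j) f x = \sum_(i <- r | P i) dir (a i) f x.
Proof.
by rewrite /dir exchange_big; apply: eq_bigr => j _; rewrite mulr_suml.
Qed.

Lemma dir_coef_ext a b f x : a =1 b -> dir a f x = dir b f x.
Proof. by move=> ab; apply: eq_bigr => j _; rewrite ab. Qed.

Lemma pd_coef i f x : pd i f x = dir (fun k => (k == i)%:R) f x.
Proof.
rewrite /dir (bigD1 i)//= eqxx mul1r big1 ?addr0// => k /negbTE ->.
by rewrite mul0r.
Qed.

Lemma pd_dir i b f x : smth f -> D x ->
  pd i (dir b f) x = \sum_j b j * pd i (pd j f) x.
Proof.
move=> sf Dx; have sj j : smth (fun y => b j * pd j f y).
  by apply: smoothM; [exact: smooth_cst | exact: smooth_pd].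
rewrite pd_coef (dir_sum _ _ _ sj Dx); apply: eq_bigr => j _.
by rewrite dirZ -?pd_coef//; exact: smooth_pd.
Qed.

Lemma pd_dirC i b f x : move_action move -> open D -> smth f -> D x ->
  pd i (dir b f) x = dir b (pd i f) x.
Proof.
move=> mv oD sf Dx; rewrite pd_dir//; apply: eq_bigr => j _.
by rewrite (clairaut mv oD _ _ (sf 2%N) Dx).
Qed.

Lemma dirC a b f x : move_action move -> open D -> smth f -> D x ->
  dir a (dir b f) x = dir b (dir a f) x.
Proof.
move=> mv oD sf Dx.
have e (c d : J -> C) : dir c (dir d f) x =
    \sum_i \sum_j c i * d j * pd i (pd j f) x.
  apply: eq_bigr => i _; rewrite pd_dir// mulr_sumr.
  by apply: eq_bigr => j _; rewrite mulrA.
rewrite !e exchange_big; apply: eq_bigr => i _; apply: eq_bigr => j _.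
by rewrite [b _ * _]mulrC (clairaut mv oD _ _ (sf 2%N) Dx).
Qed.

End Dir.

Arguments smooth_isp {R E J move D f} j {x}.
Arguments smooth_pd {R E J move D f} j.

(** * Second-order Taylor expansion *)

Section Space.
Context (R : realType) (n : nat).
Local Notation C := (Cplx R).
Local Notation V := 'rV[C]_n.
Local Notation J := ('I_n * bool)%type.

Definition in_box (r : R) (v : V) := forall k, `|v 0 k| <= toC r.

Lemma nbhs_box (x : V) (A : set V) : nbhs x A <->
  exists2 d : R, 0 < d & forall v, in_box d v -> A (x + v).
Proof.
split.
  move=> /nbhs_ballP[e /= /gt0C[d d0 ->]] h; exists (d / 2); first exact: divr_gt0.
  move=> v vd; apply: h; split; first by rewrite -(rmorph0 (@toC R)) toC_lt.
  move=> i j; rewrite /ball /= mxE opprD addrA subrr add0r normrN ord1.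
  by apply: (le_lt_trans (vd j)); rewrite toC_lt; lra.
move=> [d d0 h]; apply/nbhs_ballP; exists (toC d).
  by rewrite /= -(rmorph0 (@toC R)) toC_lt.
move=> y [_ hy]; rewrite -[y](subrK x) addrC; apply: h => k.
by have := hy 0 k; rewrite /ball /= => /ltW; rewrite !mxE distrC.
Qed.

Definition step_vec (j : J) : V := (if j.2 then 'i else 1) *: delta_mx 0 j.1.

Lemma space_moveE j (h : R) (z : V) : space_move j h z = z + toC h *: step_vec j.
Proof. by rewrite /space_move /step_vec scalerA mulrC. Qed.

Lemma step_addE (v : V) (s : R) j k : (v + toC s *: step_vec j) 0 k =
  v 0 k + toC s * ((if j.2 then 'i else 1) * (k == j.1)%:R).
Proof. by rewrite /step_vec 4!mxE eqxx. Qed.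

Lemma step_vec_box j : in_box 1 (step_vec j).
Proof.
move=> k; rewrite rmorph1 /step_vec !mxE eqxx /= normrM.
by case: j.2; rewrite ?normCi ?normr1 mul1r; case: eqP; rewrite ?normr1 ?normr0.
Qed.

Lemma in_boxZ (c : R) v r : in_box r v -> in_box (`|c| * r) (toC c *: v).
Proof.
move=> vr k; rewrite mxE normrM toC_norm rmorphM ler_wpM2l//.
by rewrite -toC_norm normr_ge0.
Qed.

Lemma in_boxD r s v w : in_box r v -> in_box s w -> in_box (r + s) (v + w).
Proof.
by move=> hv hw k; rewrite mxE (le_trans (ler_normD _ _))// rmorphD lerD.
Qed.

Lemma in_boxW r s v : r <= s -> in_box r v -> in_box s v.
Proof. by move=> rs hv k; rewrite (le_trans (hv k))// toC_le. Qed.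

Lemma space_moveC i j (s t : R) (x : V) :
  space_move i s (space_move j t x) = space_move j t (space_move i s x).
Proof. rewrite (space_moveE i s) (space_moveE j t x) (space_moveE j t) (space_moveE i s x). exact: addrAC. Qed.

Lemma space_move_action : move_action (@space_move R n).
Proof.
split.
- by move=> j x; rewrite space_moveE rmorph0 scale0r addr0.
- by move=> j s t x; rewrite !space_moveE toCD scalerDl [X in x + X]addrC addrA.
- exact: space_moveC.
- move=> i j x A /nbhs_box[d d0 h]; exists (d / 2); first exact: divr_gt0.
  move=> s t sd td; rewrite !space_moveE -addrA; apply: h.
  have -> : d = d / 2 + d / 2 by lra.
  apply: in_boxD; [apply: in_boxW (in_boxZ t (step_vec_box j))|
    apply: in_boxW (in_boxZ s (step_vec_box i))]; by rewrite mulr1.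
Qed.

Lemma move_mvt (g : V -> C) (dg : V -> C) j (x v : V) (h e : R) :
  (forall t : R, `|t| <= `|h| -> let y := x + (v + toC t *: step_vec j) in
     is_dcurve (fun s => g (space_move j s y)) 0 (dg y) /\ `|dg y| <= toC e) ->
  `|g (x + (v + toC h *: step_vec j)) - g (x + v)| <= toC (2 * e * `|h|).
Proof.
move=> H; have := @mvt_norm0 R (fun s => g (x + (v + toC s *: step_vec j)))
  (fun s => dg (x + (v + toC s *: step_vec j))) h e.
rewrite rmorph0 scale0r addr0; apply => t th; last by have [] := H t th.
have [h1 _] := H t th; apply: (near_cvg h1); apply: nearW => s.
rewrite !space_moveE add0r rmorph0 scale0r addr0 rmorphD scalerDl.
by congr ((g _ - g _) / _); rewrite !addrA.
Qed.

Definition part_row (v : V) (m : nat) : V := \row_k (if (k < m)%N then v 0 k else 0).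

Lemma part_rowE v m k : part_row v m 0 k = if (k < m)%N then v 0 k else 0.
Proof. by rewrite mxE. Qed.

(** The segment from x to x + w is replaced by a path along the axes: one coordinate after the
    other, first its real and then its imaginary part. The path stays in the box, and each of the
    two legs per coordinate contributes at most 2 e r. *)
Lemma box_mvt (g : V -> C) (dg : J -> V -> C) (x : V) (r e : R) : 0 <= e ->
  (forall v j, in_box r v ->
     is_dcurve (fun s => g (space_move j s (x + v))) 0 (dg j (x + v))) ->
  (forall v j, in_box r v -> `|dg j (x + v)| <= toC e) ->
  forall w, in_box r w -> `|g (x + w) - g x| <= toC (n%:R * (4 * e * r)).
Proof.
move=> e0 gd ge w wr.
have H m : (m <= n)%N ->
    `|g (x + part_row w m) - g x| <= toC (m%:R * (4 * e * r)).
  elim: m => [_|m ih mn].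
    rewrite (_ : part_row w 0 = 0); last by apply/rowP => k; rewrite part_rowE mxE.
    by rewrite addr0 subrr normr0 mul0r rmorph0.
  have {ih}ih := ih (ltnW mn).
  pose i := Ordinal mn; pose a := re (w 0 i); pose b := im (w 0 i).
  have r0 : 0 <= r by rewrite -toC_le rmorph0 (le_trans _ (wr i)).
  have ar : `|a| <= r by rewrite -toC_le (le_trans (re_le_norm _) (wr i)).
  have br : `|b| <= r by rewrite -toC_le (le_trans (im_le_norm _) (wr i)).
  pose v1 := part_row w m + toC a *: step_vec (i, false).
  have v1E : v1 + toC b *: step_vec (i, true) = part_row w m.+1.
    apply/rowP => k; rewrite !step_addE !part_rowE [in RHS]ltnS [in RHS]leq_eqVlt.
    have [->|ki] := eqVneq k i.
      by rewrite [in RHS]/= [in RHS]eqxx [in RHS]/= ltnn /= add0r !mulr1 [_ * 'i]mulrC -reimE.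
    rewrite (_ : (k == m :> nat) = false) ?mulr0 ?addr0//.
    by apply/negbTE; move: ki; rewrite -val_eqE.
  have bx1 t : `|t| <= `|a| -> in_box r (part_row w m + toC t *: step_vec (i, false)).
    move=> ta k; rewrite step_addE part_rowE; have [->|ki] := eqVneq k i.
      by rewrite ltnn add0r !mulr1 toC_norm toC_le (le_trans ta).
    by rewrite !mulr0 addr0; case: ifP => // _; rewrite normr0 -toC0 toC_le.
  have bx2 t : `|t| <= `|b| -> in_box r (v1 + toC t *: step_vec (i, true)).
    move=> tb k; rewrite !step_addE part_rowE; have [->|ki] := eqVneq k i.
      rewrite ltnn add0r !mulr1 [_ * 'i]mulrC (le_trans (norm_re_im_mono a tb))//.
      by rewrite -reimE.
    by rewrite !mulr0 !addr0; case: ifP => // _; rewrite normr0 -toC0 toC_le.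
  have B1 := @move_mvt g (dg (i, false)) (i, false) x (part_row w m) a e.
  have B2 := @move_mvt g (dg (i, true)) (i, true) x v1 b e.
  have {}B1 := B1 (fun t ta => conj (gd _ _ (bx1 t ta)) (ge _ _ (bx1 t ta))).
  have {}B2 := B2 (fun t ta => conj (gd _ _ (bx2 t ta)) (ge _ _ (bx2 t ta))).
  rewrite v1E in B2.
  rewrite (_ : g _ - g x = (g (x + part_row w m.+1) - g (x + v1)) +
    (g (x + v1) - g (x + part_row w m)) + (g (x + part_row w m) - g x)); last by ring.
  rewrite (le_trans (ler_normD _ _))// (_ : toC (m.+1%:R * (4 * e * r)) =
    toC (4 * e * r) + toC (m%:R * (4 * e * r))); last first.
    by rewrite -rmorphD -natr1; congr toC; ring.
  apply: lerD => //; rewrite (le_trans (ler_normD _ _))// (le_trans (lerD B2 B1))//.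
  by rewrite -rmorphD toC_le; nra.
have := H n (leqnn n); rewrite (_ : part_row w n = w)//.
by apply/rowP => k; rewrite part_rowE ltn_ord.
Qed.

Definition real_coef (v : V) : J -> C :=
  fun j => toC (if j.2 then im (v 0 j.1) else re (v 0 j.1)).

Lemma real_coef_step v (s : R) j i :
  real_coef (v + toC s *: step_vec j) i = real_coef v i + toC s * (i == j)%:R.
Proof.
case: i => i b; case: j => j b'; rewrite /real_coef step_addE /= xpair_eqE.
rewrite -[(_ && _)%:R]toCnat -toCM -toCD; congr toC.
have [_|_] := eqVneq i j; last by rewrite !mulr0 !addr0.
rewrite mulr1; case: b; case: b' => /=;
  rewrite !(reD, imD, reM, imM) re_toC im_toC ?re_i ?im_i ?mulr1 ?mulr0 ?mul0r ?addr0 ?subr0//.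
all: by rewrite ?re1 ?im1; ring.
Qed.

Variable D : set V.
Hypothesis oD : open D.
Local Notation mv := (@space_move R n).
Implicit Types (f : V -> C) (x y v w : V) (j : J).
Local Notation pd := (partial mv D).
Local Notation drv := (dir mv D).

Lemma space_step_proper j x : D x -> ProperFilter (step_filter mv D j x).
Proof. exact: (open_step_proper space_move_action oD). Qed.

Lemma pd_dcurve f j y : Ck mv D 1 f -> D y ->
  is_dcurve (fun s => f (mv j s y)) 0 (pd j f y).
Proof.
move=> f1 Dy; have [m0 _ _ _] := space_move_action.
have := @move_curve R V J mv D space_move_action oD j f 0 y (pd j f y).
by rewrite m0; apply; [exact: Dy | exact: (Ck_partial j f1 Dy)].
Qed.

Arguments pd_dcurve {f} j {y}.

Lemma near_box f x (e : R) : {within D, continuous f} -> D x -> 0 < e ->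
  exists2 d : R, 0 < d & forall v, in_box d v -> D (x + v) /\ `|f (x + v) - f x| <= toC e.
Proof. by move=> fc Dx e0; have /nbhs_box[d d0 h] := open_continuous oD fc Dx e0; exists d. Qed.

Lemma near_box_all (P : J -> V -> R -> Prop) :
  (forall j, exists2 d : R, 0 < d & forall r v, r <= d -> in_box r v -> P j v r) ->
  exists2 d : R, 0 < d & forall r v, r <= d -> in_box r v -> forall j, P j v r.
Proof.
move=> /(_ _)/cid2-/all_sig2[d d0 hd].
(* The value 1 keeps the radius positive when there is no direction at all. *)
exists (\big[Num.min/1]_j d j).
  by elim/big_ind: _ => // a b a0 b0; rewrite lt_min a0.
move=> r v rd vr j; apply: hd => //; apply: (le_trans rd).
by rewrite (bigD1 j)//= ge_min lexx.
Qed.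

Lemma dir_real_step f x v (s : R) j :
  drv (real_coef (v + toC s *: step_vec j)) f x =
  drv (real_coef v) f x + toC s * pd j f x.
Proof.
rewrite (pd_coef mv D) -dir_coefZ -dir_coefD; apply: dir_coef_ext => i.
exact: real_coef_step.
Qed.

Lemma real_coef0 j : real_coef 0 j = 0.
Proof. by rewrite /real_coef mxE; case: j.2. Qed.

(** The choice of the precision e / (4 (n + 1)): it absorbs the constant of [box_mvt] and makes
    sense for n = 0. *)
Lemma box_const (e r : R) : 0 < e -> 0 <= r ->
  n%:R * (4 * (e / (4 * n.+1%:R)) * r) <= e * r.
Proof.
move=> e0 r0; rewrite !mulrA ler_wpM2r// -(natr1 n).
rewrite ler_pdivrMr; last by rewrite mulr_gt0// natr1 ltr0n.
rewrite mulrDr mulr1; have := ler0n R n; nra.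
Qed.

(** [box_mvt] is applied to f minus its linear part, whose partial derivatives are small near x by
    continuity. *)
Lemma frechet f x (e : R) : Ck mv D 1 f -> D x -> 0 < e ->
  exists2 d : R, 0 < d & forall r v, 0 <= r -> r <= d -> in_box r v ->
    `|f (x + v) - f x - drv (real_coef v) f x| <= toC (e * r).
Proof.
move=> f1 Dx e0; pose e' := e / (4 * n.+1%:R).
have n0 : 0 < n.+1%:R :> R by rewrite ltr0n.
have e'0 : 0 < e' by rewrite divr_gt0// mulr_gt0.
have [d d0 hd] := @near_box_all
  (fun j v r => D (x + v) /\ `|pd j f (x + v) - pd j f x| <= toC e')
  (fun j => let: ex_intro2 d d0 hd := near_box (Ck_cont (Ck_pd j f1)) Dx e'0 in
     ex_intro2 _ _ d d0 (fun r v rd vr => hd v (in_boxW rd vr))).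
exists d => // r v r0 rd vr.
pose g y := f y - drv (real_coef (y - x)) f x.
pose dg j y := pd j f y - pd j f x.
have {}hd w : in_box r w -> forall j, D (x + w) /\ `|dg j (x + w)| <= toC e'.
  by move=> wr; exact: hd wr.
have xK w : x + w - x = w by rewrite addrC addKr.
have gd w j : in_box r w -> is_dcurve (fun s => g (mv j s (x + w))) 0 (dg j (x + w)).
  move=> wr; have [Dw _] := hd w wr j.
  have h1 := pd_dcurve j f1 Dw.
  have h2 := is_dcurveN (@is_dcurve_lin R (pd j f x) 0).
  have h3 := @is_dcurve_cst R (- drv (real_coef w) f x) 0.
  have := is_dcurveD (is_dcurveD h1 h2) h3; rewrite addr0.
  apply: eq_dcurve => s.
  rewrite /g space_moveE -(addrA x) xK dir_real_step.
  by ring.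
have := box_mvt (ltW e'0) gd (fun w j wr => (hd w wr j).2) vr.
rewrite /g subrr [x + v]addrC addrK => H.
rewrite (_ : _ - _ = f (v + x) - drv (real_coef v) f x - (f x - drv (real_coef 0) f x)).
  by apply: (le_trans H); rewrite toC_le; exact: box_const.
rewrite (_ : drv (real_coef 0) f x = 0); first by rewrite addrC; ring.
by rewrite /dir big1// => j _; rewrite real_coef0 mul0r.
Qed.

(** [box_mvt] is applied to f minus its quadratic Taylor polynomial. The partial derivatives of the
    difference are the remainders in [frechet] for the functions [pd j f], of size e' r, and the box
    contributes the second factor r. *)
Lemma taylor2 f x (e : R) : smooth mv D f -> D x -> 0 < e ->
  exists2 d : R, 0 < d & forall r v, 0 <= r -> r <= d -> in_box r v ->
    `|f (x + v) - (f x + drv (real_coef v) f x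
       + 2^-1 * drv (real_coef v) (drv (real_coef v) f) x)| <= toC (e * r ^+ 2).
Proof.
move=> sf Dx e0; pose e' := e / (4 * n.+1%:R).
have n0 : 0 < n.+1%:R :> R by rewrite ltr0n.
have e'0 : 0 < e' by rewrite divr_gt0// mulr_gt0.
have sp := space_step_proper.
pose dgv j w := pd j f (x + w) - pd j f x - drv (real_coef w) (pd j f) x.
have [d1 d10 hd1] := @near_box_all
  (fun j v r => 0 <= r -> `|dgv j v| <= toC (e' * r))
  (fun j => let: ex_intro2 d d0 hd := frechet (smooth_pd j sf 1%N) Dx e'0 in
     ex_intro2 _ _ d d0 (fun r v rd vr r0 => hd r v r0 rd vr)).
have [d2 d20 hd2] := near_box (Ck_cont (sf 0%N)) Dx e0.
exists (Num.min d1 d2) => [|r v r0]; first by rewrite lt_min d10.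
rewrite le_min => /andP[rd1 rd2] vr.
pose Q w := drv (real_coef w) (drv (real_coef w) f) x.
pose g y := f y - drv (real_coef (y - x)) f x - 2^-1 * Q (y - x).
(* The expansion of the quadratic part along one coordinate; its cross terms combine by the symmetry
   of second derivatives. *)
have Qs w s j : Q (w + toC s *: step_vec j) =
    Q w + toC s * (2 * drv (real_coef w) (pd j f) x) + toC s * toC s * pd j (pd j f) x.
  have C1 k b := pd_dirC sp k b space_move_action oD sf Dx.
  have sj := smooth_pd j sf.
  rewrite /Q dir_real_step (dirC sp (real_coef w) (real_coef (w + _)) space_move_action oD sf Dx).
  by rewrite !C1 !dir_real_step !C1; ring.
have xK w : x + w - x = w by rewrite addrC addKr.
have gd w j : in_box r w -> is_dcurve (fun s => g (mv j s (x + w))) 0 (dgv j w).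
  move=> wr; have [Dw _] := hd2 w (in_boxW rd2 wr).
  have h1 := pd_dcurve j (sf 1%N) Dw.
  have h2 := is_dcurveN (@is_dcurve_lin R (pd j f x) 0).
  have h3 := @is_dcurve_cst R (- drv (real_coef w) f x - 2^-1 * Q w) 0.
  have h4 := is_dcurveN (@is_dcurve_lin R (drv (real_coef w) (pd j f) x) 0).
  have h5 := is_dcurveN (@is_dcurve_sq R (2^-1 * pd j (pd j f) x)).
  have := is_dcurveD (is_dcurveD (is_dcurveD (is_dcurveD h1 h2) h3) h4) h5.
  rewrite oppr0 !addr0; apply: eq_dcurve => s.
  rewrite /g space_moveE -(addrA x) xK dir_real_step Qs.
  by field.
pose dg j y := dgv j (y - x).
have H : `|g (x + v) - g x| <= toC (n%:R * (4 * (e' * r) * r)).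
  apply: (@box_mvt g dg x r (e' * r)) vr => [|w j wr|w j wr].
  - by rewrite mulr_ge0// ltW.
  - by rewrite /dg xK; exact: gd.
  - by rewrite /dg xK; exact: hd1.
have Q0 : Q 0 = 0 by rewrite /Q /dir big1// => j _; rewrite real_coef0 mul0r.
have D0 : drv (real_coef 0) f x = 0.
  by rewrite /dir big1// => j _; rewrite real_coef0 mul0r.
have gx : g x = f x by rewrite /g subrr Q0 D0 mulr0 !subr0.
rewrite (_ : _ - _ = g (x + v) - g x); last by rewrite gx /g xK /Q; ring.
apply: (le_trans H); rewrite toC_le.
have -> : 4 * (e' * r) * r = 4 * e' * r ^+ 2 by ring.
by apply: box_const => //; exact: sqr_ge0.
Qed.

End Space.

(** * A minimum principle for holomorphic functions *)

Section Goursat.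
Variable R : realType.
Local Notation C := (Cplx R).
Implicit Types (X : R -> R -> C) (U W Z : R -> R -> R).

Definition primitive (a : R) (f : R -> R) (y : R) : R :=
  (\int[@lebesgue_measure R]_(t in `[a, y]) f t)%R.

Lemma primitiveP (a : R) (f : R -> R) (y : R) : continuous f -> a < y -> is_derive y 1 (primitive a f) (f y).
Proof.
move=> cf ay; have yu : y < y + 1 by rewrite ltrDl.
have fi : (@lebesgue_measure R).-integrable `[a, (y + 1)] (EFin \o f).
  apply: continuous_compact_integrable; first exact: segment_compact.
  exact: continuous_subspaceT.
have [d1 d2] := continuous_FTC1_closed yu fi ay (cf y).
by split; [exact: d1 | rewrite -derive1E; exact: d2].
Qed.

Lemma mvt_exists (f df : R -> R) (a b : R) : a < b ->
  (forall t, a <= t <= b -> is_derive t 1 f (df t)) ->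
  exists2 x, a <= x <= b & f b - f a = df x * (b - a).
Proof.
move=> ab fd; have [x xab xE] : exists2 x, x \in `]a, b[%R & f b - f a = df x * (b - a).
  apply: MVT => // [x xab|].
    by apply: fd; move: xab; rewrite in_itv /= => /andP[/ltW -> /ltW ->].
  apply: derivable_within_continuous => x; rewrite in_itv /= => xab.
  by have [] := fd _ xab.
by exists x => //; move: xab; rewrite in_itv /= => /andP[/ltW -> /ltW ->].
Qed.

Lemma mvt_real (f df : R -> R) (a b e : R) : a <= b ->
  (forall t, a <= t <= b -> is_derive t 1 f (df t)) ->
  (forall t, a <= t <= b -> `|df t| <= e) ->
  `|f b - f a| <= e * (b - a).
Proof.
rewrite le_eqVlt => /orP[/eqP <-|ab] fd fe; first by rewrite !subrr normr0 mulr0.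
have [x xab ->] := mvt_exists ab fd.
rewrite normrM (ger0_norm (_ : 0 <= b - a)) ?subr_ge0 ?(ltW ab)//.
by rewrite ler_wpM2r ?subr_ge0 ?(ltW ab)// fe.
Qed.

(** Complex differentiability of X as a function of x + i y, with the derivative [c] acting by
    complex multiplication; this encodes the Cauchy-Riemann equations. *)
Definition cr_at X (x0 y0 : R) := exists c : C, forall e : R, 0 < e ->
  exists2 d : R, 0 < d & forall x y, `|x - x0| <= d -> `|y - y0| <= d ->
    `|X x y - X x0 y0 - c * (toC (x - x0) + 'i * toC (y - y0))|
      <= toC (e * (`|x - x0| + `|y - y0|)).

(** If [W x] is a primitive of re X(x, .) and [Z y] one of im X(., y), this is the imaginary part of
    the contour integral of X around the rectangle, counterclockwise. *)
Definition boundary_int W Z (a b c d : R) : R :=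
  (W b d - W b c) - (W a d - W a c) - ((Z d b - Z d a) - (Z c b - Z c a)).

Section Rectangle.
Variables (X : R -> R -> C) (W Z : R -> R -> R) (a b c d : R).
Hypotheses (ab : a < b) (cd : c < d).
Hypothesis crX : forall x y, a <= x <= b -> c <= y <= d -> cr_at X x y.
Hypothesis WX : forall x y, a <= x <= b -> c <= y <= d ->
  is_derive y 1 (W x) (re (X x y)).
Hypothesis ZX : forall x y, a <= x <= b -> c <= y <= d ->
  is_derive x 1 (Z y) (im (X x y)).

(** The affine part of X at (x0, y0) contributes nothing, because [re k] enters both pairs of
    opposite sides with the same weight L H. The remainder is at most e (L + H), integrated along a
    perimeter of length 2 (L + H). *)
Lemma boundary_int_small x0 y0 : a <= x0 <= b -> c <= y0 <= d ->
  forall e : R, 0 < e -> exists2 r : R, 0 < r & forall x y L H : R,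
  0 <= L <= r -> 0 <= H <= r -> a <= x -> x + L <= b -> c <= y -> y + H <= d ->
  x <= x0 <= x + L -> y <= y0 <= y + H ->
  `|boundary_int W Z x (x + L) y (y + H)| <= 2 * e * (L + H) ^+ 2.
Proof.
move=> x0ab y0cd e e0; have [k hk] := crX x0ab y0cd.
have [r r0 hr] := hk e e0; exists r => // x y L H /andP[L0 Lr] /andP[H0 Hr].
move=> ax xb cy yd /andP[xx0 x0x] /andP[yy0 y0y].
have dX x' y' : x <= x' <= x + L -> y <= y' <= y + H ->
    `|X x' y' - X x0 y0 - k * (toC (x' - x0) + 'i * toC (y' - y0))| <= toC (e * (L + H)).
  move=> /andP[h1 h2] /andP[h3 h4].
  have hx : `|x' - x0| <= L by rewrite ler_norml; apply/andP; split; lra.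
  have hy : `|y' - y0| <= H by rewrite ler_norml; apply/andP; split; lra.
  apply: (le_trans (hr _ _ (le_trans hx Lr) (le_trans hy Hr))).
  by rewrite toC_le ler_pM2l// lerD.
have dre x' y' : x <= x' <= x + L -> y <= y' <= y + H ->
    `|re (X x' y') - re (X x0 y0) - re k * (x' - x0) + im k * (y' - y0)| <= e * (L + H).
  move=> h1 h2; have := le_trans (re_le_norm _) (dX _ _ h1 h2); rewrite toC_le.
  rewrite !(reB, reN, reM, reD, imD, imM, re_toC, im_toC, re_i, im_i).
  by congr (`|_| <= _); ring.
have dim x' y' : x <= x' <= x + L -> y <= y' <= y + H ->
    `|im (X x' y') - im (X x0 y0) - im k * (x' - x0) - re k * (y' - y0)| <= e * (L + H).
  move=> h1 h2; have := le_trans (im_le_norm _) (dX _ _ h1 h2); rewrite toC_le.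
  rewrite !(imB, imN, reN, reM, reD, imD, imM, re_toC, im_toC, re_i, im_i).
  by congr (`|_| <= _); ring.
have xL : x <= x <= x + L by apply/andP; split; lra.
have xL' : x <= x + L <= x + L by apply/andP; split; lra.
have yH : y <= y <= y + H by apply/andP; split; lra.
have yH' : y <= y + H <= y + H by apply/andP; split; lra.
have inx x' : x <= x' <= x + L -> a <= x' <= b by move=> /andP[h1 h2]; apply/andP; split; lra.
have iny y' : y <= y' <= y + H -> c <= y' <= d by move=> /andP[h1 h2]; apply/andP; split; lra.
have BW : `|(W (x + L) (y + H) - W x (y + H) - re k * L * (y + H)) -
            (W (x + L) y - W x y - re k * L * y)| <= 2 * e * (L + H) * (y + H - y).
  apply: (@mvt_real (fun t => W (x + L) t - W x t - re k * L * t)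
    (fun t => re (X (x + L) t) - re (X x t) - re k * L)) => [|t ht|t ht].
  - by lra.
  - have h1 := WX (inx _ xL') (iny _ ht); have h2 := WX (inx _ xL) (iny _ ht).
    have -> : (fun t => W (x + L) t - W x t - re k * L * t) =
      (W (x + L) \- W x) \- (re k * L) \*: (@id R) by apply/funext.
    apply: is_deriveB; last by apply: is_derive_eq; rewrite [_ *: _]mulr1.
  - have := dre _ _ xL' ht; have := dre _ _ xL ht.
    rewrite !ler_norml => /andP[h1 h2] /andP[h3 h4].
    by apply/andP; split; lra.
have BZ : `|(Z (y + H) (x + L) - Z y (x + L) - re k * H * (x + L)) -
            (Z (y + H) x - Z y x - re k * H * x)| <= 2 * e * (L + H) * (x + L - x).
  apply: (@mvt_real (fun t => Z (y + H) t - Z y t - re k * H * t)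
    (fun t => im (X t (y + H)) - im (X t y) - re k * H)) => [|t ht|t ht].
  - by lra.
  - have h1 := ZX (inx _ ht) (iny _ yH'); have h2 := ZX (inx _ ht) (iny _ yH).
    have -> : (fun t => Z (y + H) t - Z y t - re k * H * t) =
      (Z (y + H) \- Z y) \- (re k * H) \*: (@id R) by apply/funext.
    apply: is_deriveB; last by apply: is_derive_eq; rewrite [_ *: _]mulr1.
  - have := dim _ _ ht yH'; have := dim _ _ ht yH.
    rewrite !ler_norml => /andP[h1 h2] /andP[h3 h4].
    by apply/andP; split; lra.
rewrite /boundary_int; move: BW BZ; rewrite !ler_norml => /andP[h1 h2] /andP[h3 h4].
by apply/andP; split; nra.
Qed.

Let L0 := b - a.
Let H0 := d - c.
Let Lk (k : nat) : R := L0 / 2 ^+ k.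
Let Hk (k : nat) : R := H0 / 2 ^+ k.
Let Q (k : nat) (p : R * R) : R :=
  `|boundary_int W Z p.1 (p.1 + Lk k) p.2 (p.2 + Hk k)|.
Let Q0 : R := `|boundary_int W Z a b c d|.

Lemma LkS k : Lk k = Lk k.+1 + Lk k.+1.
Proof. by rewrite /Lk exprS invfM -mulrDr; congr (_ * _); field; rewrite expf_neq0. Qed.
Lemma HkS k : Hk k = Hk k.+1 + Hk k.+1.
Proof. by rewrite /Hk exprS invfM -mulrDr; congr (_ * _); field; rewrite expf_neq0. Qed.

(** Inner edges cancel when the rectangle is cut into four, so one of the quarters carries at least
    a fourth of the absolute value. *)
Lemma bisect k p : exists q, [/\ Q k p / 4 <= Q k.+1 q,
  p.1 <= q.1, q.1 + Lk k.+1 <= p.1 + Lk k, p.2 <= q.2 & q.2 + Hk k.+1 <= p.2 + Hk k].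
Proof.
case: p => x y; set L := Lk k.+1; set H := Hk k.+1.
have L_ge0 : 0 <= L by rewrite divr_ge0 ?exprn_ge0// subr_ge0 ltW.
have H_ge0 : 0 <= H by rewrite divr_ge0 ?exprn_ge0// subr_ge0 ltW.
rewrite LkS HkS -/L -/H /=.
have split4 : Q k (x, y) <= Q k.+1 (x, y) + Q k.+1 (x + L, y) +
    Q k.+1 (x, y + H) + Q k.+1 (x + L, y + H).
  rewrite /Q LkS HkS -/L -/H /= !addrA.
  rewrite -[X in `|X|](_ : boundary_int W Z x (x + L) y (y + H)
    + boundary_int W Z (x + L) (x + L + L) y (y + H)
    + boundary_int W Z x (x + L) (y + H) (y + H + H)
    + boundary_int W Z (x + L) (x + L + L) (y + H) (y + H + H) = _); last first.
    by rewrite /boundary_int; ring.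
  do 2 (rewrite (le_trans (ler_normD _ _))// lerD2r).
  exact: ler_normD.
have [h|h1] := leP (Q k (x, y) / 4) (Q k.+1 (x, y)).
  by exists (x, y); split=> //=; lra.
have [h|h2] := leP (Q k (x, y) / 4) (Q k.+1 (x + L, y)).
  by exists (x + L, y); split=> //=; lra.
have [h|h3] := leP (Q k (x, y) / 4) (Q k.+1 (x, y + H)).
  by exists (x, y + H); split=> //=; lra.
by exists (x + L, y + H); split=> /=; lra.
Qed.

Lemma goursat : boundary_int W Z a b c d = 0.
Proof.
pose nxt k p := projT1 (cid (bisect k p)).
have nxtP k p : [/\ Q k p / 4 <= Q k.+1 (nxt k p),
    p.1 <= (nxt k p).1, (nxt k p).1 + Lk k.+1 <= p.1 + Lk k,
    p.2 <= (nxt k p).2 & (nxt k p).2 + Hk k.+1 <= p.2 + Hk k].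
  exact: projT2 (cid (bisect k p)).
pose s := fix s k := if k is k'.+1 then nxt k' (s k') else (a, c).
have Lk_ge0 k : 0 <= Lk k by rewrite divr_ge0 ?exprn_ge0// subr_ge0 ltW.
have Hk_ge0 k : 0 <= Hk k by rewrite divr_ge0 ?exprn_ge0// subr_ge0 ltW.
have sQ k : Q0 / 4 ^+ k <= Q k (s k).
  elim: k => [|k ih]; first by rewrite expr0 divr1 /Q /Lk /Hk expr0 !divr1 /L0 /H0 /= !subrKC.
  have [h _ _ _ _] := nxtP k (s k); apply: le_trans h.
  by rewrite exprSr invfM mulrA ler_pM2r// invr_gt0.
have mono k m : (k <= m)%N -> [/\ (s k).1 <= (s m).1, (s m).1 + Lk m <= (s k).1 + Lk k,
    (s k).2 <= (s m).2 & (s m).2 + Hk m <= (s k).2 + Hk k].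
  move=> km; rewrite -(subnK km); elim: (m - k)%N => [|j [h1 h2 h3 h4]].
    by rewrite add0n; split.
  have [_ g1 g2 g3 g4] := nxtP (j + k)%N (s (j + k)%N).
  by rewrite addSn /=; split; lra.
have mono' k m : (s k).1 <= (s m).1 + Lk m /\ (s k).2 <= (s m).2 + Hk m.
  have [km|/ltnW mk] := leqP k m.
    have [h1 _ h3 _] := mono _ _ km; have := Lk_ge0 m; have := Hk_ge0 m.
    by split; lra.
  have [_ h2 _ h4] := mono _ _ mk; have := Lk_ge0 k; have := Hk_ge0 k.
  by split; lra.
(* The lower left corners increase and every corner lies below every upper right one, so their
   suprema form a point common to all the rectangles. *)
pose x0 := sup (range (fun k => (s k).1)).
pose y0 := sup (range (fun k => (s k).2)).
have hx0 k : (s k).1 <= x0 <= (s k).1 + Lk k.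
  apply/andP; split.
    apply: ub_le_sup; last by exists k.
    by exists ((s k).1 + Lk k) => _ [m _ <-]; have [] := mono' m k.
  apply: ge_sup; first by exists (s 0%N).1, 0%N.
  by move=> _ [m _ <-]; have [] := mono' m k.
have hy0 k : (s k).2 <= y0 <= (s k).2 + Hk k.
  apply/andP; split.
    apply: ub_le_sup; last by exists k.
    by exists ((s k).2 + Hk k) => _ [m _ <-]; have [] := mono' m k.
  apply: ge_sup; first by exists (s 0%N).2, 0%N.
  by move=> _ [m _ <-]; have [] := mono' m k.
have L0E : Lk 0%N = b - a by rewrite /Lk expr0 divr1.
have H0E : Hk 0%N = d - c by rewrite /Hk expr0 divr1.
have x0ab : a <= x0 <= b by have := hx0 0%N; rewrite L0E /= subrKC.
have y0cd : c <= y0 <= d by have := hy0 0%N; rewrite H0E /= subrKC.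
apply/eqP; rewrite -normr_le0; apply/ler_addgt0Pl => e e0; rewrite addr0 -/Q0.
(* At precision e / M the rectangle of rank k contributes at most e / 4^k, to be compared with the
   lower bound Q0 / 4^k. *)
pose M := 2 * (L0 + H0) ^+ 2.
have L0_gt0 : 0 < L0 by rewrite subr_gt0.
have H0_gt0 : 0 < H0 by rewrite subr_gt0.
have M0 : 0 < M by rewrite mulr_gt0// exprn_gt0// addr_gt0.
have [r r0 hr] := boundary_int_small x0ab y0cd (divr_gt0 e0 M0).
have [k Lkr Hkr] : exists2 k, Lk k <= r & Hk k <= r.
  have [k hk] : exists k : nat, (L0 + H0) / r <= 2 ^+ k.
    exists (Num.truncn ((L0 + H0) / r)).+1.
    rewrite (le_trans (ltW (truncnS_gt _)))// -natrX ler_nat.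
    exact/ltnW/ltn_expl.
  by exists k; rewrite ler_pdivrMr ?exprn_gt0//; move: hk; rewrite ler_pdivrMr//; lra.
have [g1 g2 g3 g4] := mono 0%N k (leq0n k).
rewrite /= L0E H0E !subrKC in g1 g2 g3 g4.
have := hr (s k).1 (s k).2 (Lk k) (Hk k).
rewrite !Lk_ge0 !Hk_ge0 Lkr Hkr => /(_ isT isT g1 g2 g3 g4 (hx0 k) (hy0 k)).
move=> /(le_trans (sQ k)); rewrite /Lk /Hk -mulrDl exprMn exprVn -exprM mulnC exprM.
rewrite (_ : 2 ^+ 2 = 4); last by ring.
rewrite mulrA ler_pM2r ?invr_gt0 ?exprn_gt0// => /le_trans; apply.
by rewrite /M le_eqVlt; apply/orP; left; apply/eqP; field; rewrite gt_eqF// addr_gt0.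
Qed.

End Rectangle.
End Goursat.

(** * Holomorphic functions in logarithmic polar coordinates *)

Section MeanValue.
Variable R : realType.
Local Notation C := (Cplx R).
Implicit Types (chi : C -> C) (z : C).

Lemma not_le_half (m : R) : 0 < m -> m <= m / 2 -> False.
Proof. by move=> m0 h; lra. Qed.

Definition holo_at chi z0 := exists c : C, forall e : R, 0 < e ->
  exists2 d : R, 0 < d & forall z, `|z - z0| <= toC d ->
    `|chi z - chi z0 - c * (z - z0)| <= toC e * `|z - z0|.

Lemma holo_cvg chi z0 : holo_at chi z0 -> forall e : R, 0 < e ->
  exists2 d : R, 0 < d & forall z, `|z - z0| <= toC d -> `|chi z - chi z0| <= toC e.
Proof.
move=> [c hc] e e0; have [d d0 hd] := hc 1 ltr01.
have [N N0 cN] : exists2 N : R, 0 <= N & `|c| = toC N by apply: ge0C; exact: normr_ge0.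
have N1 : 0 < N + 1 by rewrite ltr_wpDl.
exists (Num.min d (e / (N + 1))); first by rewrite lt_min d0 divr_gt0.
move=> z hz; have zd : `|z - z0| <= toC d by rewrite (le_trans hz)// toC_le ge_min lexx.
have ze : `|z - z0| <= toC (e / (N + 1)) by rewrite (le_trans hz)// toC_le ge_min lexx orbT.
rewrite -[X in `|X|](subrK (c * (z - z0))) (le_trans (ler_normD _ _))//.
rewrite (le_trans (lerD (hd _ zd) (lexx _)))// normrM cN -mulrDl -toCD addrC.
rewrite (le_trans (ler_wpM2l _ ze))//; first by rewrite -toC0 toC_le ltW.
by rewrite -toCM toC_le mulrCA divff ?mulr1// gt_eqF.
Qed.

(** The exponential of s + i t. In these coordinates an annulus is the image of a rectangle, so the
    rectangular form of Goursat's lemma applies. *)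
Definition polar (s t : R) : C := toC (expR s) * (toC (cos t) + 'i * toC (sin t)).

Lemma norm_polar s t : `|polar s t| = toC (expR s).
Proof.
have n1 : `|toC (cos t) + 'i * toC (sin t)| = 1.
  rewrite (normc_def (_ : R[i])) -!/(toC _) -!/(re _) -!/(im _).
  rewrite !reD !imD !reM !imM !re_toC !im_toC re_i im_i.
  by rewrite !(mul0r, mul1r, mulr0, subr0, addr0, add0r) cos2Dsin2 sqrtr1 toC1.
by rewrite /polar normrM n1 mulr1 toC_norm ger0_norm// expR_ge0.
Qed.

Lemma polarD s t h k : polar (s + h) (t + k) = polar s t * polar h k.
Proof.
rewrite /polar expRD sinD cosD; apply: eqC;
  rewrite !(reD, imD, reM, imM, re_toC, im_toC, re_i, im_i); ring.
Qed.

Lemma linear_approx (f : R -> R) (l : R) : is_derive (0 : R) 1 f l ->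
  forall e : R, 0 < e -> exists2 d : R, 0 < d & forall h, `|h| <= d ->
    `|f h - f 0 - l * h| <= e * `|h|.
Proof.
move=> [d1 d2] e e0.
have : h^-1 *: (f (h *: 1 + 0) - f 0) @[h --> 0^'] --> l by rewrite -d2; exact: d1.
move=> /cvgrPdist_lt /(_ e e0) [d /= d0 hd].
exists (d / 2); first exact: divr_gt0.
move=> h hd2; have [->|h0] := eqVneq h 0.
  by rewrite subrr mulr0 subr0 normr0 mulr0.
have := hd h; rewrite /= sub0r normrN => /(_ _ h0).
have hd' : `|h| < d by lra.
move=> /(_ hd'); rewrite [_ *: 1]mulr1 addr0 [_ *: _]mulrC => H.
rewrite (_ : _ - _ = ((f h - f 0) / h - l) * h); last by field.
by rewrite normrM ler_pM2r ?normr_gt0// distrC ltW.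
Qed.

Lemma polar_approx (e : R) : 0 < e -> exists2 d : R, 0 < d & forall h k : R,
  `|h| <= d -> `|k| <= d ->
  `|polar h k - 1 - (toC h + 'i * toC k)| <= toC (e * (`|h| + `|k|)).
Proof.
move=> e0; pose e' := Num.min 1 (e / 8).
have e'0 : 0 < e' by rewrite lt_min ltr01 divr_gt0.
have e'1 : e' <= 1 by rewrite ge_min lexx.
have e'e : 8 * e' <= e by rewrite -ler_pdivlMl// mulrC ge_min lexx orbT.
clearbody e'.
have [d1 d10 h1] := linear_approx (is_derive_expR 0) e'0.
have [d2 d20 h2] := linear_approx (is_derive_sin 0) e'0.
have [d3 d30 h3] := linear_approx (is_derive_cos 0) e'0.
exists (Num.min (Num.min d1 d2) (Num.min d3 e')).
  by rewrite !lt_min d10 d20 d30 e'0.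
move=> h k; rewrite !le_min => /andP[/andP[hd1 _] /andP[_ he]].
move=> /andP[/andP[_ kd2] /andP[kd3 ke]].
have := h1 _ hd1; have := h2 _ kd2; have := h3 _ kd3.
rewrite expR0 sin0 cos0 oppr0 mul0r !mul1r !subr0 => A1 A2 A3.
rewrite (le_trans (norm_le_reim _))// toC_le /polar.
rewrite !(reB, imB, reN, imN, reD, imD, reM, imM, re_toC, im_toC, re_i, im_i, re1, im1).
rewrite !(mul0r, mul1r, mulr0, subr0, addr0, add0r).
move: A1 A2 A3; set E := expR h; set S := sin k; set K := cos k.
set ah := `|h|; set ak := `|k|; move=> A1 A2 A3; rewrite addr0 in A2.
have B3 : `|E - 1| <= 2 * ah.
  rewrite -[E - 1](subrK h) (le_trans (ler_normD _ _))// -/ah.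
  have : e' * ah <= ah by rewrite ler_piMl// normr_ge0.
  by lra.
have ah0 : 0 <= ah by exact: normr_ge0.
have ak0 : 0 <= ak by exact: normr_ge0.
have S1 : `|S| <= 2 * ak.
  rewrite -[S](subrK k) (le_trans (ler_normD _ _))// -/ak.
  have : e' * ak <= ak by rewrite ler_piMl// normr_ge0.
  by lra.
have re_part : `|E * K - 1 - h| <= e' * (ah + ak) + 2 * ah * (e' * ak).
  rewrite (_ : _ - h = (E - 1 - h) + (K - 1) + (E - 1) * (K - 1)); last by ring.
  rewrite (le_trans (ler_normD _ _))// lerD//.
    by rewrite (le_trans (ler_normD _ _))// mulrDr lerD.
  by rewrite normrM ler_pM.
have im_part : `|E * S - k| <= e' * ak + 2 * ah * (2 * ak).
  rewrite (_ : _ - k = (S - k) + (E - 1) * S); last by ring.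
  by rewrite (le_trans (ler_normD _ _))// lerD// normrM ler_pM.
have p1 : ah * (e' * ak) <= e' * ak.
  by rewrite ler_piMl ?(le_trans he e'1)// mulr_ge0// ltW.
have p2 : ah * ak <= e' * ak by rewrite ler_wpM2r.
have p3 : 8 * e' * (ah + ak) <= e * (ah + ak) by rewrite ler_wpM2r ?addr_ge0.
have p4 : 0 <= e' * ah by rewrite mulr_ge0// ltW.
apply: (le_trans (lerD re_part im_part)); lra.
Qed.

(** The chain rule with the exponential, whose derivative at s + i t is [polar s t]. *)
Lemma cr_polar chi s t : holo_at chi (polar s t) -> cr_at (fun s t => chi (polar s t)) s t.
Proof.
move=> [c hc]; exists (c * polar s t) => e e0.
have [N N0 cN] : exists2 N : R, 0 <= N & `|c| = toC N by apply: ge0C; exact: normr_ge0.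
have E0 := expR_gt0 s.
(* One half of e pays for the remainder of chi, as the increment of [polar] is at most 2 e^s (|h| +
   |k|). The other half pays for the remainder of the exponential, multiplied by |c| e^s; the
   denominator N + 1 also covers c = 0. *)
pose e1 := e / 2 / (2 * expR s); pose e2 := e / 2 / (expR s * (N + 1)).
have N1 : 0 < N + 1 by rewrite ltr_wpDl.
have e10 : 0 < e1 by rewrite !divr_gt0// mulr_gt0.
have e20 : 0 < e2 by rewrite !divr_gt0// mulr_gt0.
have [d1 d10 hd1] := hc e1 e10.
have [d2 d20 hd2] := polar_approx (ltr01 : 0 < (1 : R)).
have [d3 d30 hd3] := polar_approx e20.
pose d := Num.min (Num.min d2 d3) (d1 / (4 * expR s)).
exists d; first by rewrite !lt_min d20 d30 divr_gt0// mulr_gt0.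
move=> x y; rewrite !le_min => /andP[/andP[x2 x3] x1] /andP[/andP[y2 y3] y1].
set h := x - s in x1 x2 x3 *; set k := y - t in y1 y2 y3 *.
have xE : x = s + h by rewrite /h addrC subrK.
have yE : y = t + k by rewrite /k addrC subrK.
have D : polar x y - polar s t = polar s t * (polar h k - 1).
  by rewrite xE yE polarD mulrBr mulr1.
have lin : `|toC h + 'i * toC k| <= toC (`|h| + `|k|).
  by rewrite (le_trans (ler_normD _ _))// normrM normCi mul1r !toC_norm -toCD.
have D1 : `|polar h k - 1| <= toC (2 * (`|h| + `|k|)).
  rewrite -[X in `|X|](subrK (toC h + 'i * toC k)) (le_trans (ler_normD _ _))//.
  rewrite (le_trans (lerD (hd2 _ _ x2 y2) lin))// -toCD toC_le; lra.
have ND : `|polar x y - polar s t| <= toC (expR s * (2 * (`|h| + `|k|))).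
  by rewrite D normrM norm_polar toCM ler_pM2l// -toC0 toC_lt.
have small : `|polar x y - polar s t| <= toC d1.
  apply: (le_trans ND); rewrite toC_le.
  move: x1 y1; rewrite !ler_pdivlMr ?mulr_gt0//; nra.
rewrite -/(polar x y) (_ : _ - _ = (chi (polar x y) - chi (polar s t)
    - c * (polar x y - polar s t)) + c * polar s t * (polar h k - 1 - (toC h + 'i * toC k))); last first.
  by rewrite D; ring.
rewrite (le_trans (ler_normD _ _))//.
have T1 : `|chi (polar x y) - chi (polar s t) - c * (polar x y - polar s t)|
    <= toC (e / 2 * (`|h| + `|k|)).
  apply: (le_trans (hd1 _ small)); apply: (le_trans (ler_wpM2l _ ND)).
    by rewrite -toC0 toC_le ltW.
  rewrite -toCM toC_le le_eqVlt; apply/orP; left; apply/eqP.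
  by rewrite /e1; field; rewrite gt_eqF.
have T2 : `|c * polar s t * (polar h k - 1 - (toC h + 'i * toC k))|
    <= toC (e / 2 * (`|h| + `|k|)).
  rewrite normrM (normrM c) cN norm_polar -toCM (le_trans (ler_wpM2l _ (hd3 _ _ x3 y3)))//.
    by rewrite -toC0 toC_le mulr_ge0// ltW.
  rewrite -toCM toC_le mulrA ler_wpM2r ?addr_ge0//.
  rewrite /e2 mulrA ler_pdivrMr ?mulr_gt0//.
  by have := mulr_gt0 e0 E0; nra.
apply: (le_trans (lerD T1 T2)); rewrite -toCD toC_le; lra.
Qed.

Lemma polar_continuous chi s : (forall t, holo_at chi (polar s t)) ->
  continuous (fun t => re (chi (polar s t))) /\ continuous (fun t => im (chi (polar s t))).
Proof.
move=> hchi.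
have H t (e : R) : 0 < e -> \forall t' \near t,
    `|chi (polar s t) - chi (polar s t')| < toC e.
  move=> e0; have [c hc] := cr_polar (hchi t).
  have [N N0 cN] : exists2 N : R, 0 <= N & `|c| = toC N by apply: ge0C; exact: normr_ge0.
  have N1 : 0 < N + 1 by rewrite ltr_wpDl.
  have [d d0 hd] := hc 1 ltr01.
  apply/nbhs_ballP; exists (Num.min d (e / (N + 1))); first by rewrite /= lt_min d0 divr_gt0.
  move=> t' /=; rewrite /ball /= distrC lt_min => /andP[td te].
  have := hd s t'; rewrite subrr normr0 toC0 add0r (ltW d0) (ltW td) => /(_ isT isT).
  rewrite add0r mul1r => H1; rewrite distrC -[X in `|X|](subrK (c * ('i * toC (t' - t)))).
  rewrite (le_lt_trans (ler_normD _ _))//.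
  rewrite (le_lt_trans (lerD H1 (lexx _)))// !normrM normCi mul1r cN toC_norm.
  by rewrite -toCM -toCD toC_lt; move: te; rewrite ltr_pdivlMr//; nra.
split=> t; apply/cvgrPdist_lt => e e0; apply: filterS (H t e e0) => t' /=.
  by rewrite -reB -toC_lt; apply: le_lt_trans; exact: re_le_norm.
by rewrite -imB -toC_lt; apply: le_lt_trans; exact: im_le_norm.
Qed.

(** Holomorphy is known only up to radius e^s1. Stopping s at s1 gives a function continuous on the
    whole line, as [primitiveP] requires. *)
Lemma radial_continuous chi s1 t :
  (forall s, s <= s1 -> holo_at chi (polar s t)) ->
  continuous (fun s => im (chi (polar (Num.min s s1) t))).
Proof.
move=> hchi s; apply/cvgrPdist_lt => e e0.
have m1 : Num.min s s1 <= s1 by rewrite ge_min lexx orbT.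
have [c hc] := cr_polar (hchi _ m1).
have [N N0 cN] : exists2 N : R, 0 <= N & `|c| = toC N by apply: ge0C; exact: normr_ge0.
have N1 : 0 < N + 1 by rewrite ltr_wpDl.
have [d d0 hd] := hc 1 ltr01.
apply/nbhs_ballP; exists (Num.min d (e / (N + 1))); first by rewrite /= lt_min d0 divr_gt0.
move=> s' /=; rewrite /ball /= distrC lt_min => /andP[td te].
have min1 : `|Num.min s' s1 - Num.min s s1| <= `|s' - s|.
  by rewrite /Num.min; case: ltP => h1; case: ltP => h2; rewrite ler_norml;
    apply/andP; split; have := ler_norm (s' - s); have := ler_norm (s - s');
    rewrite (distrC s s'); lra.
rewrite -imB -toC_lt; apply: (le_lt_trans (im_le_norm _)).
have := hd (Num.min s' s1) t; rewrite subrr normr0 toC0 mulr0 addr0.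
rewrite (ltW d0) (le_trans min1 (ltW td)) => /(_ isT isT).
rewrite addr0 mul1r => H1; rewrite distrC.
set M := Num.min s' s1 - Num.min s s1 in H1 min1.
rewrite -[X in `|X|](subrK (c * toC M)).
rewrite (le_lt_trans (ler_normD _ _))//.
rewrite (le_lt_trans (lerD H1 (lexx _)))// normrM cN toC_norm.
rewrite -toCM -toCD toC_lt; move: te; rewrite ltr_pdivlMr//.
by have := mulr_ge0 N0 (normr_ge0 M); nra.
Qed.

(* By Goursat in logarithmic coordinates, the mean of [re chi] over a circle
   does not depend on its radius; it tends to [re (chi 0) = 0] with the radius. *)
Lemma holo_no_strict_min chi (r c : R) : 0 < r -> 0 < c ->
  (forall z, `|z| < toC r -> holo_at chi z) -> re (chi 0) = 0 ->
  (forall z, `|z| < toC r -> toC c * `|z| ^+ 2 <= toC (re (chi z))) -> False.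
Proof.
move=> r0 c0 hchi chi0 hmin.
pose s1 := ln (r / 2).
have es1 : expR s1 = r / 2 by rewrite lnK// posrE divr_gt0.
have inD s t : s <= s1 -> `|polar s t| < toC r.
  move=> ss1; rewrite norm_polar toC_lt (@le_lt_trans _ _ (expR s1))// ?ler_expR// es1; lra.
(* On the outer circle, of radius r / 2, re chi is at least [m]. On the inner one, of radius e^s0,
   continuity at 0 gives |re chi| <= m / 2. Equal means on the two circles are then impossible. *)
pose m := c * (r / 2) ^+ 2.
have m0 : 0 < m by rewrite mulr_gt0// exprn_gt0// divr_gt0.
have h0 : holo_at chi 0 by apply: hchi; rewrite normr0 -toC0 toC_lt.
have [d d0 hd] := holo_cvg h0 (divr_gt0 m0 (ltr0n R 2)).
pose s0 := Num.min (s1 - 1) (ln d).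
have s01 : s0 < s1 by rewrite gt_min ltrBlDr ltrDl ltr01.
have hs0 t : `|re (chi (polar s0 t))| <= m / 2.
  have := hd (polar s0 t); rewrite subr0 norm_polar toC_le.
  have -> : expR s0 <= d.
    by rewrite -[leRHS](lnK (_ : d \is Num.pos))// ler_expR ge_min lexx orbT.
  move=> /(_ isT) H; rewrite -[re _]subr0 -chi0 -reB -toC_le.
  exact: le_trans (re_le_norm _) H.
have hs1 t : m <= re (chi (polar s1 t)).
  have := hmin _ (inD s1 t (lexx _)); rewrite norm_polar es1.
  by rewrite -toC_le expr2 -!toCM -expr2.
pose X s t := chi (polar s t).
(* The primitives start strictly to the left of the rectangle, so that they are differentiable on
   both sides at its edges. *)
pose W s := primitive (-1) (fun t => re (X s t)).
pose Z t := primitive (s0 - 1) (fun s => im (X (Num.min s s1) t)).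
have P2 : 0 < 2 * pi :> R by rewrite mulr_gt0// pi_gt0.
have WX x y : s0 <= x <= s1 -> 0 <= y <= 2 * pi -> is_derive y 1 (W x) (re (X x y)).
  move=> /andP[_ xs1] /andP[y0 _].
  have [cre _] := polar_continuous (fun t => hchi _ (inD x t xs1)).
  apply: (primitiveP cre); lra.
have ZX x y : s0 <= x <= s1 -> 0 <= y <= 2 * pi -> is_derive x 1 (Z y) (im (X x y)).
  move=> /andP[xs0 xs1] _.
  have cim := radial_continuous (fun s (ss1 : s <= s1) => hchi _ (inD s y ss1)).
  rewrite -[X in X x y]/X -{2}(min_l xs1); apply: (primitiveP cim); lra.
have G := @goursat R X W Z s0 s1 0 (2 * pi) s01 P2
  (fun x y xs _ => cr_polar (hchi _ (inD x y (andP xs).2))) WX ZX.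
(* The sides t = 0 and t = 2 pi are the same radial segment, so their contributions cancel. *)
have Zper : Z (2 * pi) = Z 0.
  rewrite /Z (_ : (fun s => im (X (Num.min s s1) (2 * pi))) =
    fun s => im (X (Num.min s s1) 0))//.
  apply/funext => s; by rewrite /X /polar mulr_natl cos2pi sin2pi cos0 sin0.
have {G}G : W s1 (2 * pi) - W s1 0 = W s0 (2 * pi) - W s0 0.
  by move/eqP: G; rewrite /boundary_int Zper subrr subr0 subr_eq0 => /eqP.
have ss0 : s0 <= s0 <= s1 by rewrite lexx ltW.
have ss1 : s0 <= s1 <= s1 by rewrite lexx ltW.
have B0 := @mvt_real R (W s0) (fun t => re (X s0 t)) 0 (2 * pi) (m / 2) (ltW P2)
  (fun t ht => WX s0 t ss0 ht) (fun t _ => hs0 t).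
have B1 : m * (2 * pi) <= W s1 (2 * pi) - W s1 0.
  have [x _ ->] := mvt_exists P2 (fun t ht => WX s1 t ss1 ht).
  by rewrite subr0 ler_pM2r//; exact: hs1.
move: B0 B1; rewrite -G subr0 ler_norml => /andP[_ h1] h2.
have := le_trans h2 h1; rewrite (ler_pM2r P2); exact: (not_le_half m0).
Qed.

End MeanValue.

(** * Invariance of the complex Hessian under holomorphic maps *)

Section Holo.
Context (R : realType) (n : nat).
Local Notation C := (Cplx R).
Local Notation V := 'rV[C]_n.

Lemma cvg_quotient (q : C -> C) (c : C) : q h @[h --> 0^'] --> c ->
  forall e : R, 0 < e -> exists2 d : R, 0 < d & forall h, h != 0 -> `|h| <= toC d ->
    `|q h - c| <= toC e.
Proof.
move=> /cvgCP hq e e0; have /nbhs_ballP[d /= /gt0C[d' d0 ->] hd] := hq e e0.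
exists (d' / 2); first exact: divr_gt0.
move=> h h0 hd'; rewrite distrC; apply: ltW; apply: hd => //.
rewrite /ball /= sub0r normrN (le_lt_trans hd')// toC_lt; lra.
Qed.

Lemma differentiable_holo (chi : C -> C) (z : C) : differentiable chi z -> holo_at chi z.
Proof.
move=> /derivable1_diffP /cvg_ex[c hc]; exists c => e e0.
have [d d0 hd] := cvg_quotient hc e0; exists d => // w wz.
have [->|w0] := eqVneq w z; first by rewrite !subrr mulr0 subrr normr0 mulr0.
have h0 : w - z != 0 by rewrite subr_eq0.
have := hd _ h0 wz; rewrite /= [_ *: 1]mulr1 subrK => H.
rewrite (_ : _ - c * _ = ((w - z)^-1 *: (chi w - chi z) - c) * (w - z)); last first.
  by rewrite [_ *: _]mulrC; field.
by rewrite normrM; exact: ler_wpM2r.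
Qed.

Lemma line_coord_differentiable (Phi : V -> V) (z0 v : V) (z : C) k :
  differentiable Phi (z0 + z *: v) -> differentiable (fun w : C => Phi (z0 + w *: v) 0 k) z.
Proof.
move=> dP.
have h1 : differentiable (fun w : C => z0 + w *: v) z.
  by apply: differentiableD => //; exact: differentiableZr.
have h2 := differentiable_comp h1 dP.
exact: (differentiable_comp h2 (differentiable_coord _ _ _)).
Qed.

Lemma line_jacobian (Phi : V -> V) (z0 v : V) : differentiable Phi z0 ->
  forall e : R, 0 < e -> exists2 d : R, 0 < d & forall (z : C) k, `|z| <= toC d ->
    `|Phi (z0 + z *: v) 0 k - Phi z0 0 k - z * (v *m 'J Phi z0) 0 k| <= toC e * `|z|.
Proof.
move=> dP e e0; have dv : derivable Phi z0 v by exact: diff_derivable.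
have hk k : exists2 d : R, 0 < d & forall z : C, `|z| <= toC d ->
    `|Phi (z0 + z *: v) 0 k - Phi z0 0 k - z * (v *m 'J Phi z0) 0 k| <= toC e * `|z|.
  have hv : h^-1 *: (Phi (h *: v + z0) - Phi z0) @[h --> 0^'] --> v *m 'J Phi z0.
    by rewrite -(deriveEjacobian _ dP); exact: dv.
  have hc := cvg_comp _ _ hv (@coord_continuous C 1 n 0 k (v *m 'J Phi z0)).
  have [d d0 hd] := cvg_quotient hc e0; exists d => // z zd.
  have [->|z0'] := eqVneq z 0.
    by rewrite scale0r addr0 subrr mul0r subrr normr0 mulr0.
  have := hd _ z0' zd; rewrite [z *: v + z0]addrC; set l := (v *m _) 0 k.
  have -> : (z^-1 *: (Phi (z0 + z *: v) - Phi z0)) 0 k =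
      z^-1 * (Phi (z0 + z *: v) 0 k - Phi z0 0 k) by rewrite !mxE.
  move=> H; rewrite (_ : _ - _ = (z^-1 * (Phi (z0 + z *: v) 0 k - Phi z0 0 k) - l) * z); last first.
    by field.
  by rewrite normrM; exact: ler_wpM2r.
have [d hd] := choice (fun k => let: ex_intro2 d d0 h := hk k in ex_intro _ d (conj d0 h)).
exists (\big[Num.min/1]_k d k).
  by elim/big_ind: _ => // [a b a0 b0|k _]; [rewrite lt_min a0 | have [] := hd k].
move=> z k zd; have [_ h] := hd k; apply: h; apply: (le_trans zd).
by rewrite toC_le (bigD1 k)//= ge_min lexx.
Qed.

End Holo.

Lemma toC_sum (R : realType) (I : Type) (r : seq I) (P : pred I) (F : I -> R) :
  toC (\sum_(i <- r | P i) F i) = \sum_(i <- r | P i) toC (F i).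
Proof. exact: rmorph_sum. Qed.

Lemma re_scale (R : realType) (c : R) (z : Cplx R) : re (toC c * z) = c * re z.
Proof. by rewrite reM re_toC im_toC mul0r subr0. Qed.

(** * Wirtinger derivatives and the Levi form *)

Section ComplexCoordinates.
Context (R : realType) (n : nat).
Local Notation C := (Cplx R).
Local Notation V := 'rV[C]_n.
Local Notation J := ('I_n * bool)%type.
Implicit Types (v w : V) (j : J).

(** Coefficients, in the real partial derivatives, of the operator d/dz^k = (d/dx^k - i d/dy^k) / 2.
    Accordingly [dv v] is the derivative along the (1,0)-vector v and [dvb v] its conjugate. *)
Definition dz (k : 'I_n) : J -> C :=
  fun j => if j.1 == k then (if j.2 then - ('i / 2) else 2^-1) else 0.
Definition dzb (k : 'I_n) : J -> C := fun j => (dz k j)^*.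
Definition dv v : J -> C := fun j => \sum_k v 0 k * dz k j.
Definition dvb v : J -> C := fun j => (dv v j)^*.

Lemma dvE v j : dv v j = v 0 j.1 * (if j.2 then - ('i / 2) else 2^-1).
Proof.
rewrite /dv (bigD1 j.1)//= {1}/dz eqxx big1 ?addr0// => k /negbTE kj.
by rewrite /dz eq_sym kj mulr0.
Qed.

Lemma dvbE v j : dvb v j = \sum_k (v 0 k)^* * dzb k j.
Proof. by rewrite /dvb rmorph_sum; apply: eq_bigr => k _; rewrite rmorphM. Qed.

Lemma half_toC : 2^-1 = toC 2^-1 :> C.
Proof. by rewrite toCV (toCnat R 2). Qed.

Lemma real_coefE v j : real_coef v j = dv v j + dvb v j.
Proof.
rewrite /dvb dvE /real_coef; case: j.2; apply: eqC; rewrite half_toC;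
  rewrite !(reD, imD, re_conj, im_conj, reM, imM, reN, imN, re_i, im_i, re_toC, im_toC);
  by field.
Qed.

Lemma dvZ (c : C) v j : dv (c *: v) j = c * dv v j.
Proof. by rewrite !dvE mxE mulrA. Qed.

Section Derivatives.
Variable D : set V.
Local Notation mv := (@space_move R n).
Local Notation drv := (dir mv D).
Implicit Types (f : V -> C) (x : V).

Lemma dir_dv v f x : drv (dv v) f x = \sum_k v 0 k * drv (dz k) f x.
Proof. by rewrite dir_coef_sum; apply: eq_bigr => k _; rewrite dir_coefZ. Qed.

Lemma dir_dvb v f x : drv (dvb v) f x = \sum_k (v 0 k)^* * drv (dzb k) f x.
Proof.
rewrite (dir_coef_ext _ _ _ _ (dvbE v)) dir_coef_sum.
by apply: eq_bigr => k _; rewrite dir_coefZ.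
Qed.

Hypothesis oD : open D.
Let sp := space_step_proper oD.

Lemma dv_dv v w f x : smooth mv D f -> D x ->
  drv (dv v) (drv (dv w) f) x =
  \sum_k \sum_l v 0 k * w 0 l * drv (dz k) (drv (dz l) f) x.
Proof.
move=> sf Dx; rewrite dir_dv; apply: eq_bigr => k _.
have sl l : smooth mv D (fun y => w 0 l * drv (dz l) f y).
  by apply: (smoothM sp); [exact: (smooth_cst sp) | exact: (smooth_dir sp)].
rewrite -(dir_ext sp (f := fun y => \sum_l w 0 l * drv (dz l) f y)) //.
- rewrite (dir_sum sp) // mulr_sumr; apply: eq_bigr => l _.
  by rewrite (dirZ sp) ?mulrA//; exact: (smooth_dir sp).
- by move=> y _; rewrite dir_dv.
- exact: (smooth_sum sp).
Qed.

Lemma dv_dvb v w f x : smooth mv D f -> D x ->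
  drv (dv v) (drv (dvb w) f) x =
  \sum_k \sum_l drv (dz k) (drv (dzb l) f) x * v 0 k * (w 0 l)^*.
Proof.
move=> sf Dx; rewrite dir_dv; apply: eq_bigr => k _.
have sl l : smooth mv D (fun y => (w 0 l)^* * drv (dzb l) f y).
  by apply: (smoothM sp); [exact: (smooth_cst sp) | exact: (smooth_dir sp)].
rewrite -(dir_ext sp (f := fun y => \sum_l (w 0 l)^* * drv (dzb l) f y)) //.
- rewrite (dir_sum sp) // mulr_sumr; apply: eq_bigr => l _.
  rewrite (dirZ sp) //; last exact: (smooth_dir sp).
  by ring.
- by move=> y _; rewrite dir_dvb.
- exact: (smooth_sum sp).
Qed.

(** A real direction v acts as [dv v] plus its conjugate. For real f the second-order expansion
    therefore splits into the real part of a polynomial of degree 2 that is holomorphic in v, and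
    the Levi form. *)
Lemma taylor2_re f x (e : R) : smooth mv D f -> (forall y, D y -> (f y)^* = f y) ->
  D x -> 0 < e ->
  exists2 d : R, 0 < d & forall r v, 0 <= r -> r <= d -> in_box r v ->
    `|re (f (x + v)) - (re (f x) + 2 * re (drv (dv v) f x)
       + re (drv (dv v) (drv (dv v) f) x)
       + re (drv (dv v) (drv (dvb v) f) x))| <= e * r ^+ 2.
Proof.
move=> sf rf Dx e0; have [d d0 hd] := taylor2 oD sf Dx e0; exists d => // r v r0 rd vr.
have := le_trans (re_le_norm _) (hd r v r0 rd vr); rewrite toC_le.
have DE g y : drv (real_coef v) g y = drv (dv v) g y + drv (dvb v) g y.
  by rewrite -dir_coefD; apply: dir_coef_ext; exact: real_coefE.
have conjD g y : smooth mv D g -> (forall y, D y -> (g y)^* = g y) -> D y ->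
    drv (dvb v) g y = (drv (dv v) g y)^*.
  move=> sg rg Dy; rewrite -(dir_ext sp (f := fun y => (g y)^*)) //.
    by rewrite (dir_conj sp) //; congr (_^*); apply: dir_coef_ext => j; rewrite /dvb conjCK.
  exact: (smooth_conj sp).
have sD a : smooth mv D (drv a f) by exact: (smooth_dir sp).
have E1 : drv (real_coef v) (drv (real_coef v) f) x =
    drv (dv v) (drv (dv v) f) x + (drv (dv v) (drv (dv v) f) x)^*
    + 2 * drv (dv v) (drv (dvb v) f) x.
  rewrite -(dir_ext sp (f := fun y => drv (dv v) f y + drv (dvb v) f y));
    [|by move=> y _; rewrite DE|exact: (smoothD sp)|by []].
  rewrite DE !(dirD sp) // (dirC sp (dvb v) (dv v) (space_move_action R n) oD sf Dx).
  have -> : drv (dvb v) (drv (dvb v) f) x = (drv (dv v) (drv (dv v) f) x)^*.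
    rewrite -(dir_ext sp (f := fun y => (drv (dv v) f y)^*)) //.
    - by rewrite (dir_conj sp) //; congr (_^*); apply: dir_coef_ext => j; rewrite /dvb conjCK.
    - by move=> y Dy; rewrite conjD.
    - exact: (smooth_conj sp).
  by ring.
rewrite E1 DE conjD // half_toC.
rewrite !(reB, reN, reD, reM, imM, imD, re_conj, im_conj, re_toC, im_toC).
by congr (`|_| <= _); field.
Qed.

End Derivatives.

Lemma in_box_exists v : exists2 N : R, 0 < N & in_box N v.
Proof.
exists (1 + \sum_k re `|v 0 k|).
  rewrite ltr_pwDl// sumr_ge0// => k _.
  by rewrite -toC_le -norm_re toC0.
move=> k; rewrite norm_re toC_le (bigD1 k)//= addrCA lerDl addr_ge0// sumr_ge0// => l _.
by rewrite -toC_le -norm_re toC0.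
Qed.

Lemma in_box_scale (c : C) v r : in_box r v -> in_box (re `|c| * r) (c *: v).
Proof. by move=> vr k; rewrite mxE normrM toCM -norm_re ler_wpM2l. Qed.

Lemma differentiable_bigsum (F : 'I_n -> C -> C) (z : C) :
  (forall k, differentiable (F k) z) -> differentiable (fun y => \sum_k F k y) z.
Proof.
move=> dF; rewrite (_ : (fun y => _) = \sum_k F k); first exact: differentiable_sum.
by apply/funext => y; rewrite fct_sumE.
Qed.

(** X is one value expanded in two charts, with Levi forms kap and lam. Subtracting the expansions
    leaves the difference of the holomorphic parts equal to t^2 (kap - lam) up to e times t^2; the
    sign s makes the main term the positive number c0 t^2, and the errors use up at most half of
    it. *)
Lemma levi_form_estimate (X Y Z1 Z2 S1 S2 a t N M K e c0 s kap lam : R) :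
  0 <= e -> e * (N ^+ 2 + M ^+ 2 + 2 * M * K + 1) <= c0 / 2 ->
  s * (kap - lam) = c0 -> `|s| <= 1 ->
  `|X - (Y + 2 * Z1 + Z2 + t ^+ 2 * kap)| <= e * (t * N) ^+ 2 ->
  `|X - (Y + 2 * S1 + S2 + a)| <= e * (t * M) ^+ 2 ->
  `|a - t ^+ 2 * lam| <= 2 * M * K * e * t ^+ 2 ->
  c0 / 2 * t ^+ 2 <= s * (2 * S1 + S2 - 2 * Z1 - Z2).
Proof.
move=> e0 eB sc s1 A1 A2 A3.
set y := 2 * S1 + S2 - 2 * Z1 - Z2 - t ^+ 2 * (kap - lam).
have t0 : 0 <= t ^+ 2 by exact: sqr_ge0.
have : `|y| <= e * (t * N) ^+ 2 + e * (t * M) ^+ 2 + 2 * M * K * e * t ^+ 2.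
  rewrite (_ : y = (X - (Y + 2 * Z1 + Z2 + t ^+ 2 * kap))
    - (X - (Y + 2 * S1 + S2 + a)) - (a - t ^+ 2 * lam)); last by rewrite /y; ring.
  by rewrite (le_trans (ler_normB _ _))// lerD// (le_trans (ler_normB _ _))// lerD.
have eBt := ler_wpM2r t0 eB; have et : 0 <= e * t ^+ 2 by rewrite mulr_ge0.
rewrite !exprMn => hy.
have {}hy : `|y| <= c0 / 2 * t ^+ 2 by apply: (le_trans hy); lra.
have sy : `|s * y| <= c0 / 2 * t ^+ 2.
  by rewrite normrM (le_trans _ hy)// ler_piMl.
rewrite (_ : s * _ = t ^+ 2 * (s * (kap - lam)) + s * y); last by rewrite /y; ring.
by rewrite sc; move: sy; rewrite ler_norml => /andP[h _]; lra.
Qed.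

Section ChainRule.
Variables (D1 D2 : set V) (f1 f2 : V -> C) (Phi : V -> V) (z0 : V).
Hypotheses (oD1 : open D1) (oD2 : open D2).
Hypotheses (sf1 : smooth (@space_move R n) D1 f1) (sf2 : smooth (@space_move R n) D2 f2).
Hypotheses (rf1 : forall y, D1 y -> (f1 y)^* = f1 y)
  (rf2 : forall y, D2 y -> (f2 y)^* = f2 y).
Hypothesis near_Phi : \forall z \near z0,
  [/\ D1 z, differentiable Phi z, D2 (Phi z) & f1 z = f2 (Phi z)].
Local Notation drv1 := (dir (@space_move R n) D1).
Local Notation drv2 := (dir (@space_move R n) D2).
Local Notation w0 := (Phi z0).

(* Nothing is known about [Phi] beyond complex differentiability, so the chain rule for second
   derivatives is not available.  Comparing the second-order expansions of [f1] and [f2] along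
   the complex line [z0 + zeta *: v], if the two Levi forms differed then the real part of a
   holomorphic function of [zeta] would have a strict quadratic extremum at [0]. *)
Lemma levi_form_transition v :
  let w := v *m 'J Phi z0 in
  re (drv1 (dv v) (drv1 (dvb v) f1) z0) = re (drv2 (dv w) (drv2 (dvb w) f2) w0).
Proof.
move=> w; set kap := re _; set lam := re _.
apply/eqP; rewrite -subr_eq0 -normr_eq0; apply/negP => /negP dn0.
set c0 := `|kap - lam| in dn0.
have c0_gt0 : 0 < c0 by rewrite lt_neqAle eq_sym dn0 normr_ge0.
have [/= D1z dPz D2z f12] := nbhs_singleton near_Phi.
have [d1 d10 near1] := (nbhs_box z0 _).1 near_Phi.
have [N N0 vN] := in_box_exists v.
have [M1 M10 wM] := in_box_exists w.
pose M := M1 + 1; have M0 : 0 < M by rewrite addr_gt0.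
have M1M : M1 <= M by rewrite lerDl ler01.
pose l (i j : 'I_n) := drv2 (dz i) (drv2 (dzb j) f2) w0.
pose K := \sum_i \sum_j re `|l i j|.
have K0 : 0 <= K.
  by apply: sumr_ge0 => i _; apply: sumr_ge0 => j _; rewrite -toC_le -norm_re toC0.
(* The coefficients of all the errors: the two Taylor remainders, and the replacement of [eta z] by
   z w in the second Levi form. *)
pose B := N ^+ 2 + M ^+ 2 + 2 * M * K + 1.
have B0 : 0 < B by rewrite ltr_wpDl// !addr_ge0 ?sqr_ge0// !mulr_ge0// ltW.
pose e := Num.min 1 (c0 / (2 * B)).
have e0 : 0 < e by rewrite lt_min ltr01 divr_gt0// mulr_gt0.
have eB : e * B <= c0 / 2.
  have : e <= c0 / (2 * B) by rewrite ge_min lexx orbT.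
  by rewrite invfM mulrA ler_pdivlMr.
have e1 : e <= 1 by rewrite ge_min lexx.
clearbody e.
have [d2 d20 T1] := taylor2_re oD1 sf1 rf1 D1z e0.
have [d3 d30 T2] := taylor2_re oD2 sf2 rf2 D2z e0.
have [d4 d40 hJ] := line_jacobian v dPz e0.
pose eta (z : C) := Phi (z0 + z *: v) - w0.
pose p (k : 'I_n) := drv2 (dz k) f2 w0.
pose q (k m : 'I_n) := drv2 (dz k) (drv2 (dz m) f2) w0.
pose P := drv1 (dv v) f1 z0.
pose Q := drv1 (dv v) (drv1 (dv v) f1) z0.
(* The holomorphic part of the expansion of f2 along [eta z] minus that of f1 along z v. It is
   holomorphic in z since [Phi] is complex differentiable near z0, and it vanishes at 0. *)
pose chi0 (z : C) := 2 * (\sum_k eta z 0 k * p k)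
   + \sum_k \sum_m eta z 0 k * eta z 0 m * q k m - 2 * z * P - z * z * Q.
(* The sign reduces the case of a strict maximum to that of a strict minimum. *)
pose s := Num.sg (kap - lam).
have sc0 : s * (kap - lam) = c0 by rewrite /s /c0 -normrEsg.
have s1 : `|s| <= 1 by rewrite /s normr_sg; case: eqP; rewrite ?lexx ?ler01.
pose chi (z : C) := toC s * chi0 z.
pose r := Num.min (Num.min (d1 / N) (d2 / N)) (Num.min (d3 / M) d4).
have r0 : 0 < r by rewrite !lt_min !divr_gt0.
have etaE z k : eta z 0 k = Phi (z0 + z *: v) 0 k - w0 0 k by rewrite /eta !mxE.
have {}hJ (z : C) k : `|z| <= toC d4 -> `|eta z 0 k - z * w 0 k| <= toC e * `|z|.
  by rewrite etaE; exact: hJ.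
have eta0 : eta 0 = 0 by rewrite /eta scale0r addr0 subrr.
have bounds z : `|z| < toC r -> [/\ in_box d1 (z *: v), in_box d2 (z *: v),
    re `|z| * N <= d2, `|z| <= toC d4 & re `|z| * M <= d3].
  rewrite norm_re toC_lt !lt_min => /andP[/andP[h1 h2] /andP[h3 h4]].
  have vz := in_box_scale z vN.
  rewrite !ltr_pdivlMr// in h1 h2 h3.
  split; [exact: (in_boxW (ltW h1) vz)| exact: (in_boxW (ltW h2) vz)| exact: ltW| by rewrite toC_le ltW|exact: ltW].
have eta_box z : `|z| < toC r -> in_box (re `|z| * M) (eta z).
  move=> zr; have [_ _ _ z4 _] := bounds _ zr; move=> k.
  rewrite -[eta z 0 k](subrK (z * w 0 k)) (le_trans (ler_normD _ _))//.
  have H2 : `|z * w 0 k| <= toC (re `|z| * M1).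
    by have := in_box_scale z wM k; rewrite mxE.
  apply: (le_trans (lerD (hJ z k z4) H2)).
  rewrite [X in toC e * X]norm_re -toCM -toCD toC_le /M.
  have : 0 <= re `|z| by rewrite -toC_le -norm_re toC0.
  by move: e1 e0; nra.
have chi_min z : `|z| < toC r -> toC (c0 / 2) * `|z| ^+ 2 <= toC (re (chi z)).
  move=> zr; have [z1 z2 z2N z4 z3M] := bounds _ zr.
  have eb := eta_box _ zr.
  set t := re `|z| in z2N z3M eb; have zt : `|z| = toC t by rewrite -norm_re.
  have t0 : 0 <= t by rewrite -toC_le -zt toC0.
  have zz : z * z^* = toC (t ^+ 2) by rewrite expr2 toCM -zt -expr2 normCK.
  have [_ _ _ f12z] := near1 _ z1.
  have A1 := T1 (t * N) (z *: v) (mulr_ge0 t0 (ltW N0)) z2N (in_box_scale z vN).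
  have A2 := T2 (t * M) (eta z) (mulr_ge0 t0 (ltW M0)) z3M eb.
  have wE : w0 + eta z = Phi (z0 + z *: v) by rewrite /eta addrC subrK.
  rewrite f12z -wE f12 in A1.
  have E1 : drv1 (dv (z *: v)) f1 z0 = z * P.
    by rewrite (dir_coef_ext _ _ _ _ (dvZ z v)) dir_coefZ.
  have E2 : drv1 (dv (z *: v)) (drv1 (dv (z *: v)) f1) z0 = z * z * Q.
    rewrite /Q !(dv_dv oD1) // mulr_sumr; apply: eq_bigr => i _.
    by rewrite mulr_sumr; apply: eq_bigr => j _; rewrite !mxE; ring.
  have E3 : re (drv1 (dv (z *: v)) (drv1 (dvb (z *: v)) f1) z0) = t ^+ 2 * kap.
    rewrite (_ : drv1 _ _ _ = toC (t ^+ 2) * drv1 (dv v) (drv1 (dvb v) f1) z0).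
      exact: (re_scale (t ^+ 2) _).
    rewrite !(dv_dvb oD1) // -zz mulr_sumr; apply: eq_bigr => i _.
    by rewrite mulr_sumr; apply: eq_bigr => j _; rewrite !mxE rmorphM; ring.
  have E4 : drv2 (dv (eta z)) f2 w0 = \sum_k eta z 0 k * p k by rewrite dir_dv.
  have E5 : drv2 (dv (eta z)) (drv2 (dv (eta z)) f2) w0 =
      \sum_k \sum_m eta z 0 k * eta z 0 m * q k m by rewrite (dv_dv oD2).
  have E6 : `|re (drv2 (dv (eta z)) (drv2 (dvb (eta z)) f2) w0) - t ^+ 2 * lam|
      <= 2 * M * K * e * t ^+ 2.
    have hlam : t ^+ 2 * lam = re (toC (t ^+ 2) * drv2 (dv w) (drv2 (dvb w) f2) w0).
      exact: (esym (re_scale (t ^+ 2) _)).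
    rewrite hlam -reB -toC_le; apply: (le_trans (re_le_norm _)).
    rewrite !(dv_dvb oD2) // -zz mulr_sumr -sumrB.
    have eta_lin k : `|eta z 0 k - z * w 0 k| <= toC (e * t).
      by rewrite toCM -zt; exact: hJ.
    have eta_M k : `|eta z 0 k| <= toC (t * M) by exact: eb.
    have w_M k : `|z * w 0 k| <= toC (t * M).
      rewrite normrM zt toCM ler_wpM2l -?zt// (le_trans (wM k))// toC_le; exact: M1M.
    rewrite (_ : 2 * M * K * e * t ^+ 2 = K * (2 * M * e * t ^+ 2)); last by ring.
    rewrite mulr_suml toC_sum; apply: le_trans (ler_norm_sum _ _ _) _.
    apply: ler_sum => i _; rewrite mulr_sumr -sumrB mulr_suml toC_sum.
    apply: le_trans (ler_norm_sum _ _ _) _; apply: ler_sum => j _.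
    rewrite (_ : _ - _ = l i j * ((eta z 0 i - z * w 0 i) * (eta z 0 j)^*
        + z * w 0 i * (eta z 0 j - z * w 0 j)^*)); last first.
      by rewrite /l rmorphB rmorphM; ring.
    rewrite normrM toCM -norm_re ler_wpM2l// (le_trans (ler_normD _ _))//.
    rewrite 2!normrM 2!norm_conjC.
    rewrite (_ : 2 * M * e * t ^+ 2 = e * t * (t * M) + t * M * (e * t)); last by ring.
    rewrite toCD (toCM (e * t)) (toCM (t * M)).
    by apply: lerD; apply: ler_pM.
  rewrite zt /chi re_scale /chi0.
  move: A1 A2; rewrite E1 E2 E3 E4 E5.
  move: E6; set X := re (f2 _); set Y := re (f2 _); set a := re (drv2 _ _ _).
  rewrite !(reB, reN, reD) -(mulrA 2 z P) -(toCnat R 2) !re_scale.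
  set S1 := re (\sum_k _); set S2 := re (\sum_k _); set Z1 := re (z * P).
  set Z2 := re (z * z * Q).
  rewrite (expr2 (toC t)) -!toCM -expr2 toC_le => A6 A1 A2.
  exact: (levi_form_estimate (ltW e0) eB sc0 s1 A1 A2 A6).
apply: (@holo_no_strict_min R chi r (c0 / 2) r0) => //.
- by rewrite divr_gt0.
- move=> z zr; apply: differentiable_holo.
  have [z1 _ _ _ _] := bounds _ zr; have [_ dP _ _] := near1 _ z1.
  have de k : differentiable (fun z => eta z 0 k) z.
    rewrite (_ : (fun z => _) = fun z => Phi (z0 + z *: v) 0 k - w0 0 k).
      by apply: differentiableB => //; exact: line_coord_differentiable.
    by apply/funext => y; rewrite etaE.
  have did : differentiable (fun y : C => y) z by apply/derivable1_diffP; exact: derivable_id.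
  apply: differentiableM; first exact: differentiable_cst.
  apply: differentiableB; last first.
    apply: differentiableM; last exact: differentiable_cst.
    by apply: differentiableM; exact: did.
  apply: differentiableB; last first.
    apply: differentiableM; last exact: differentiable_cst.
    by apply: differentiableM; [exact: differentiable_cst | exact: did].
  apply: differentiableD.
    apply: differentiableM; first exact: differentiable_cst.
    apply: differentiable_bigsum => k.
    by apply: differentiableM; [exact: de | exact: differentiable_cst].
  apply: differentiable_bigsum => k; apply: differentiable_bigsum => m.
  apply: differentiableM; last exact: differentiable_cst.
  by apply: differentiableM; exact: de.
- rewrite /chi /chi0 eta0 !big1 => [|k _|k _].
  + by rewrite !mulr0 !mul0r !addr0 !subr0 mulr0 re0.
  + by rewrite big1// => m _; rewrite (mxE _ _ 0 k) !mul0r.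
  + by rewrite (mxE _ _ 0 k) mul0r.
Qed.

End ChainRule.
End ComplexCoordinates.

(** * Hermitian forms *)

Section HermitianForms.
Context (C : numClosedFieldType) (n : nat).
Local Open Scope sesquilinear_scope.
Implicit Types (S X P B G : 'M[C]_n) (v : 'rV[C]_n).

Definition hform S v : C := (v *m S *m v ^t*) 0 0.

Lemma hformE S v : hform S v = \sum_i \sum_j S i j * v 0 i * (v 0 j)^*.
Proof.
rewrite /hform mxE exchange_big; apply: eq_bigr => j _.
rewrite !mxE mulr_suml; apply: eq_bigr => i _.
by rewrite [v 0 i * _]mulrC.
Qed.

Lemma adjmxM m p q (A : 'M[C]_(m, p)) (B : 'M[C]_(p, q)) :
  (A *m B) ^t* = B ^t* *m A ^t*.
Proof. by rewrite trmx_mul map_mxM. Qed.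

Lemma hformD S X v : hform (S + X) v = hform S v + hform X v.
Proof. by rewrite /hform mulmxDr mulmxDl [LHS]mxE. Qed.

Lemma hformZ c S v : hform (c *: S) v = c * hform S v.
Proof. by rewrite /hform -scalemxAr -scalemxAl [LHS]mxE. Qed.

Lemma hform_real S v : S ^t* = S -> (hform S v)^* = hform S v.
Proof.
move=> hS; have e : (v *m S *m v ^t*) ^t* = v *m S *m v ^t*.
  by rewrite !adjmxM trmxCK hS mulmxA.
by rewrite /hform -{2}e [RHS]mxE [in RHS]mxE.
Qed.

Lemma hform_factor B v : hform (B *m B ^t*) v = \sum_k `|(v *m B) 0 k| ^+ 2.
Proof.
rewrite /hform mulmxA -[v *m B *m _ *m _]mulmxA -adjmxM mxE.
by apply: eq_bigr => k _; rewrite normCK !mxE.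
Qed.

Lemma row_mul_adj (U X : 'M[C]_n) k :
  (row k U *m X *m (row k U) ^t*) 0 0 = (U *m X *m U ^t*) k k.
Proof.
rewrite -row_mul [LHS]mxE [RHS]mxE; apply: eq_bigr => j _.
by rewrite !mxE.
Qed.

Lemma spectral_decomposition S : S ^t* = S ->
  exists U (d : 'rV[C]_n), [/\ U *m U ^t* = 1%:M, U ^t* *m U = 1%:M,
    S = U ^t* *m diag_mx d *m U & forall k, d 0 k = hform S (row k U)].
Proof.
move=> hS; have nS : S \is normalmx by apply/normalmxP; rewrite hS.
have := orthomx_spectralP nS; set U := spectralmx S; set d := spectral_diag S.
have uU : U \is unitarymx := spectral_unitarymx S.
rewrite invmx_unitary// => SE; exists U, d.
have UU : U *m U ^t* = 1%:M by exact/unitarymxP.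
have UU' : U ^t* *m U = 1%:M by apply: mulmx1C.
split=> // k; rewrite /hform row_mul_adj {1}SE !mulmxA UU mul1mx -mulmxA UU mulmx1.
by rewrite mxE eqxx mulr1n.
Qed.

Lemma psd_factor S : S ^t* = S -> (forall v, 0 <= hform S v) ->
  exists B, S = B *m B ^t*.
Proof.
move=> /spectral_decomposition[U [d [_ _ SE dE]]] S0.
have d0 k : 0 <= d 0 k by rewrite dE.
exists (U ^t* *m diag_mx (\row_k sqrtC (d 0 k))).
rewrite adjmxM trmxCK !mulmxA {1}SE; congr (_ *m _); rewrite -!mulmxA; congr (_ *m _).
rewrite tr_diag_mx map_diag_mx mulmx_diag; congr diag_mx.
apply/rowP => k; rewrite !mxE /= geC0_conj ?sqrtC_ge0//.
by rewrite -expr2 sqrtCK.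
Qed.

(** With P = B B^*, the trace is that of B^* X B, a sum of values of the form of X. *)
Lemma trace_psd_ge0 X P : (forall v, 0 <= hform X v) -> P ^t* = P ->
  (forall v, 0 <= hform P v) -> 0 <= \tr (X *m P).
Proof.
move=> X0 hP /(psd_factor hP)[B ->]; rewrite mulmxA mxtrace_mulC /mxtrace sumr_ge0// => k _.
by have := X0 (row k (B ^t*)); rewrite /hform row_mul_adj trmxCK mulmxA.
Qed.

(** With P = B B^* the value at v is the squared norm of v B, so it vanishes only if v B does. *)
Lemma psd_null P v : P ^t* = P -> (forall w, 0 <= hform P w) -> hform P v = 0 ->
  v *m P = 0 /\ P *m v ^t* = 0.
Proof.
move=> hP /(psd_factor hP)[B PE]; rewrite PE hform_factor => /eqP.
rewrite psumr_eq0 => [|k _]; last by rewrite exprn_ge0.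
move=> /allP vB.
have {}vB : v *m B = 0.
  apply/rowP => k; have := vB k (mem_index_enum k).
  by rewrite /= expf_eq0/= normr_eq0 => /eqP ->; rewrite mxE.
rewrite mulmxA vB mul0mx; split=> //.
by rewrite -mulmxA -adjmxM vB trmx0 map_mx0 mulmx0.
Qed.

Lemma posdef_unitmx G : (forall v, v != 0 -> 0 < hform G v) -> G \in unitmx.
Proof.
move=> G0; rewrite -row_free_unit -kermx_eq0; apply/negP => /negP /rowV0Pn[v].
move=> /sub_kermxP vG v0; have := G0 v v0.
by rewrite /hform vG mul0mx mxE ltxx.
Qed.

Lemma adj_invmx G : G \in unitmx -> G ^t* = G -> (invmx G) ^t* = invmx G.
Proof.
move=> uG hG; have : (invmx G) ^t* *m G = 1%:M.
  by rewrite -{2}hG -adjmxM mulmxV// trmx1 map_mx1.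
by move=> /(congr1 (fun X => X *m invmx G)); rewrite mulmxK// mul1mx.
Qed.

Lemma invmx_psd G : G \in unitmx -> G ^t* = G -> (forall v, 0 <= hform G v) ->
  forall v, 0 <= hform (invmx G) v.
Proof.
move=> uG hG G0 v; have := G0 (v *m invmx G).
by rewrite /hform adjmxM adj_invmx// mulmxKV// mulmxA.
Qed.

Lemma hform_congr B X v : hform (B *m X *m B ^t*) v = hform X (v *m B).
Proof. by rewrite /hform adjmxM !mulmxA. Qed.

Lemma trace_sandwich_ge0 X P B : (forall v, 0 <= hform X v) -> P ^t* = P ->
  (forall v, 0 <= hform P v) -> B ^t* = B -> 0 <= \tr (B *m X *m B *m P).
Proof.
move=> X0 hP P0 hB; apply: trace_psd_ge0 => // v.
by rewrite -{2}hB hform_congr.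
Qed.

End HermitianForms.

(** * Quantitative bounds on Hermitian forms *)

Section RealBounds.
Context (R : realType) (n : nat).
Local Notation C := (Cplx R).
Local Open Scope sesquilinear_scope.
Implicit Types (S X P G : 'M[C]_n) (v : 'rV[C]_n).

Lemma hermitian_addZ (r : R) S S' :
  S ^t* = S -> S' ^t* = S' -> (S + toC r *: S') ^t* = S + toC r *: S'.
Proof.
move=> hS hS'; apply/matrixP => i j.
by rewrite -[in RHS]hS -[in RHS]hS' !mxE rmorphD rmorphM /= toC_conj.
Qed.

Definition sqnorm v : C := \sum_k `|v 0 k| ^+ 2.

Lemma sqnorm_ge0 v : 0 <= sqnorm v.
Proof. by rewrite sumr_ge0// => k _; rewrite exprn_ge0. Qed.

Lemma sqnorm_gt0 v : v != 0 -> 0 < sqnorm v.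
Proof.
move=> v0; rewrite lt_neqAle sqnorm_ge0 andbT eq_sym; apply: contra v0.
rewrite psumr_eq0 => [/allP h|k _]; last by rewrite exprn_ge0.
apply/eqP/rowP => k; have := h k (mem_index_enum k).
by rewrite /= expf_eq0/= normr_eq0 => /eqP ->; rewrite mxE.
Qed.

Lemma hermitian_posdefP S : hermitian_posdef S <->
  S ^t* = S /\ forall v, v != 0 -> 0 < hform S v.
Proof.
split=> [[hS pS]|[hS pS]]; split.
- by apply/matrixP => i j; rewrite !mxE hS conjCK.
- by move=> v /pS; rewrite hformE.
- by move=> i j; rewrite -{1}hS !mxE.
- by move=> v /pS; rewrite hformE.
Qed.

(** The least eigenvalue serves as d; taking the minimum with 1 covers n = 0. *)
Lemma posdef_lower S : hermitian_posdef S ->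
  exists2 d : R, 0 < d & forall v, toC d * sqnorm v <= hform S v.
Proof.
move=> /hermitian_posdefP[hS pS].
have [U [d [UU UU' SE dE]]] := spectral_decomposition hS.
have rU k : row k U != 0.
  apply/negP => /eqP h; have := congr1 (fun X : 'M[C]_n => X k k) UU.
  rewrite -[U *m _](mulmx1) mulmx1 [LHS]mxE big1 => [|j _].
    by rewrite mxE eqxx => /eqP; rewrite eq_sym oner_eq0.
  by have := congr1 (fun X : 'rV[C]_n => X 0 j) h; rewrite !mxE => ->; rewrite mul0r.
have d0 k : 0 < d 0 k by rewrite dE pS.
pose m := \big[Num.min/1]_k re (d 0 k).
exists m.
  rewrite /m; elim/big_ind: _ => // [a b a0 b0|k _]; first by rewrite lt_min a0.
  by have := d0 k; rewrite ltC => /andP[].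
move=> v; have -> : hform S v = \sum_k d 0 k * `|(v *m U ^t*) 0 k| ^+ 2.
  rewrite {1}SE /hform !mulmxA -[_ *m U *m _]mulmxA.
  have -> : U *m v ^t* = (v *m U ^t*) ^t* by rewrite adjmxM trmxCK.
  rewrite mul_mx_diag mxE; apply: eq_bigr => k _; rewrite normCK !mxE.
  by rewrite mulrAC mulrC mulrA.
have -> : sqnorm v = \sum_k `|(v *m U ^t*) 0 k| ^+ 2.
  rewrite -hform_factor trmxCK UU' /hform mulmx1 mxE.
  by apply: eq_bigr => k _; rewrite normCK !mxE.
rewrite mulr_sumr ler_sum// => k _; rewrite ler_wpM2r ?exprn_ge0//.
rewrite leC im_toC re_toC; have := d0 k; rewrite ltC => /andP[-> _] /=.
by rewrite /m (bigD1 k)//= ge_min lexx.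
Qed.

Lemma hform_upper X (e : R) v : (forall i j, `|X i j| <= toC e) ->
  `|hform X v| <= toC (n%:R * e) * sqnorm v.
Proof.
move=> Xe; rewrite hformE (le_trans (ler_norm_sum _ _ _))//.
have pair i j : `|X i j * v 0 i * (v 0 j)^*| <=
    toC e * (2^-1 * (`|v 0 i| ^+ 2 + `|v 0 j| ^+ 2)).
  rewrite !normrM norm_conjC -mulrA ler_pM// ?mulr_ge0//.
  rewrite ler_pdivlMl// mulr_natl -subr_ge0.
  have -> : `|v 0 i| ^+ 2 + `|v 0 j| ^+ 2 - (`|v 0 i| * `|v 0 j|) *+ 2 =
    (`|v 0 i| - `|v 0 j|) ^+ 2 by rewrite sqrrB addrAC.
  by rewrite real_exprn_even_ge0// rpredB// normr_real.
apply: (@le_trans _ _ (\sum_i \sum_j toC e * (2^-1 * (`|v 0 i| ^+ 2 + `|v 0 j| ^+ 2)))).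
  by apply: ler_sum => i _; rewrite (le_trans (ler_norm_sum _ _ _))// ler_sum.
rewrite le_eqVlt; apply/orP; left; apply/eqP.
under eq_bigr do rewrite -mulr_sumr -mulr_sumr big_split /= sumr_const card_ord.
rewrite -mulr_sumr -mulr_sumr big_split /= sumr_const card_ord -sumrMnl -/(sqnorm v).
rewrite toCM toCnat -[\sum_(i < n) _ *+ n]/(\sum_(i < n) _ *+ n) sumrMnl -/(sqnorm v).
by rewrite -mulr_natl; field.
Qed.

End RealBounds.

(** * Derivatives of matrix-valued functions *)

Section MatrixDerivatives.
Context (R : realType) (E : topologicalType) (J : finType).
Variables (move : J -> R -> E -> E) (D : set E).
Local Notation C := (Cplx R).
Local Notation smth := (smooth move D).
Local Notation drv := (dir move D).
Local Open Scope sesquilinear_scope.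

Definition mxd p q (b : J -> C) (M : E -> 'M[C]_(p, q)) (x : E) : 'M[C]_(p, q) :=
  \matrix_(i, j) drv b (fun y => M y i j) x.

Definition smooth_mx p q (M : E -> 'M[C]_(p, q)) := forall i j, smth (fun y => M y i j).

Lemma mxdE p q b (M : E -> 'M[C]_(p, q)) x i j :
  mxd b M x i j = drv b (fun y => M y i j) x.
Proof. by rewrite mxE. Qed.

Opaque mxd.

Hypothesis sp : forall j x, D x -> ProperFilter (step_filter move D j x).
Implicit Types (b : J -> C) (x : E).

Lemma smooth_mxd p q b (M : E -> 'M[C]_(p, q)) : smooth_mx M -> smooth_mx (mxd b M).
Proof.
move=> sM i j; apply: (smooth_ext sp _ (smooth_dir sp b (sM i j))) => y _.
by rewrite mxdE.
Qed.

Lemma smooth_mxM p q r (M : E -> 'M[C]_(p, q)) (N : E -> 'M[C]_(q, r)) :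
  smooth_mx M -> smooth_mx N -> smooth_mx (fun y => M y *m N y).
Proof.
move=> sM sN i j; have s k : smth (fun y => M y i k * N y k j) by exact: (smoothM sp).
by apply: (smooth_ext sp _ (smooth_sum sp _ _ s)) => y _; rewrite mxE.
Qed.

Lemma smooth_mxD p q (M N : E -> 'M[C]_(p, q)) :
  smooth_mx M -> smooth_mx N -> smooth_mx (fun y => M y + N y).
Proof.
move=> sM sN i j.
by apply: (smooth_ext sp _ (smoothD sp (sM i j) (sN i j))) => y _; rewrite mxE.
Qed.

Lemma smooth_mx_cst p q (M : 'M[C]_(p, q)) : smooth_mx (fun=> M).
Proof. by move=> i j; exact: (smooth_cst sp). Qed.

Lemma smooth_mx_adj p q (M : E -> 'M[C]_(p, q)) :
  smooth_mx M -> smooth_mx (fun y => (M y) ^t*).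
Proof.
by move=> sM i j; apply: (smooth_ext sp _ (smooth_conj sp (sM j i))) => y _; rewrite !mxE.
Qed.

Lemma smooth_mxZ p q c (M : E -> 'M[C]_(p, q)) :
  smooth_mx M -> smooth_mx (fun y => c *: M y).
Proof.
move=> sM i j.
by apply: (smooth_ext sp _ (smoothM sp (smooth_cst sp c) (sM i j))) => y _; rewrite mxE.
Qed.

Lemma smooth_mxN p q (M : E -> 'M[C]_(p, q)) :
  smooth_mx M -> smooth_mx (fun y => - M y).
Proof.
move=> sM i j.
by apply: (smooth_ext sp _ (smoothN sp (sM i j))) => y _; rewrite mxE.
Qed.

Lemma mxd_ext p q b (M N : E -> 'M[C]_(p, q)) x :
  (forall y, D y -> M y = N y) -> smooth_mx M -> D x -> mxd b M x = mxd b N x.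
Proof.
move=> MN sM Dx; apply/matrixP => i j; rewrite !mxdE.
by apply: (dir_ext sp _ _ (sM i j) Dx) => y Dy; rewrite MN.
Qed.

Lemma mxdD p q b (M N : E -> 'M[C]_(p, q)) x : smooth_mx M -> smooth_mx N -> D x ->
  mxd b (fun y => M y + N y) x = mxd b M x + mxd b N x.
Proof.
move=> sM sN Dx; apply/matrixP => i j; rewrite mxdE [RHS]mxE !mxdE.
rewrite -(dir_ext sp (f := fun y => M y i j + N y i j)).
- exact: (dirD sp).
- by move=> y _; rewrite mxE.
- exact: (smoothD sp).
- by [].
Qed.

Lemma mxdN p q b (M : E -> 'M[C]_(p, q)) x : smooth_mx M -> D x ->
  mxd b (fun y => - M y) x = - mxd b M x.
Proof.
move=> sM Dx; apply/matrixP => i j; rewrite mxdE [RHS]mxE !mxdE.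
rewrite -(dir_ext sp (f := fun y => - M y i j)).
- exact: (dirN sp).
- by move=> y _; rewrite mxE.
- exact: (smoothN sp).
- by [].
Qed.

Lemma mxdZ p q b c (M : E -> 'M[C]_(p, q)) x : smooth_mx M -> D x ->
  mxd b (fun y => c *: M y) x = c *: mxd b M x.
Proof.
move=> sM Dx; apply/matrixP => i j; rewrite mxdE [RHS]mxE !mxdE.
rewrite -(dir_ext sp (f := fun y => c * M y i j)).
- exact: (dirZ sp).
- by move=> y _; rewrite mxE.
- by apply: (smoothM sp) => //; exact: (smooth_cst sp).
- by [].
Qed.

Lemma mxd_cst p q b (M : 'M[C]_(p, q)) x : D x -> mxd b (fun=> M) x = 0.
Proof. by move=> Dx; apply/matrixP => i j; rewrite mxdE (dir_cst sp) // mxE. Qed.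

Lemma mxdM p q r b (M : E -> 'M[C]_(p, q)) (N : E -> 'M[C]_(q, r)) x :
  smooth_mx M -> smooth_mx N -> D x ->
  mxd b (fun y => M y *m N y) x = mxd b M x *m N x + M x *m mxd b N x.
Proof.
move=> sM sN Dx; apply/matrixP => i j; rewrite mxdE 3!mxE -big_split /=.
have s k : smth (fun y => M y i k * N y k j) by exact: (smoothM sp).
rewrite -(dir_ext sp (f := fun y => \sum_k M y i k * N y k j)).
- by rewrite (dir_sum sp) //; apply: eq_bigr => k _; rewrite (dirM sp) // !mxdE.
- by move=> y _; rewrite mxE.
- exact: (smooth_sum sp).
- by [].
Qed.

Lemma mxd_adj p q b (M : E -> 'M[C]_(p, q)) x : smooth_mx M -> D x ->
  mxd b (fun y => (M y) ^t*) x = (mxd (fun j => (b j)^*) M x) ^t*.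
Proof.
move=> sM Dx; apply/matrixP => i j; rewrite mxdE [RHS]mxE [X in _ = X^*]mxE mxdE.
rewrite -(dir_ext sp (f := fun y => (M y j i)^*)).
- exact: (dir_conj sp).
- by move=> y _; rewrite !mxE.
- exact: (smooth_conj sp).
- by [].
Qed.

Lemma mxdC p q (b c : J -> C) (M : E -> 'M[C]_(p, q)) x :
  move_action move -> open D -> smooth_mx M -> D x ->
  mxd b (mxd c M) x = mxd c (mxd b M) x.
Proof.
move=> mv oD sM Dx; apply/matrixP => i j; rewrite !mxdE.
rewrite -(dir_ext sp (f := drv c (fun y => M y i j))).
- rewrite -[RHS](dir_ext sp (f := drv b (fun y => M y i j))).
  + by apply: (dirC sp b c mv oD).
  + by move=> y _; rewrite mxdE.
  + exact: (smooth_dir sp).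
  + by [].
- by move=> y _; rewrite mxdE.
- exact: (smooth_dir sp).
- by [].
Qed.

Section Inverse.
Variables (n : nat) (G H : E -> 'M[C]_n).
Hypotheses (sG : smooth_mx G) (sH : smooth_mx H).
Hypothesis HG : forall y, D y -> H y *m G y = 1%:M.

Lemma mulmx_inverse_sym y : D y -> G y *m H y = 1%:M.
Proof. by move=> Dy; apply: mulmx1C; exact: HG. Qed.

Lemma mxd_inverse b x : D x -> mxd b H x = - (H x *m mxd b G x *m H x).
Proof.
move=> Dx; have := mxdM b sH sG Dx.
rewrite -(mxd_ext _ (M := fun=> 1%:M) _ (smooth_mx_cst _) Dx) => [|y Dy]; last by rewrite HG.
rewrite mxd_cst // => /esym/eqP; rewrite addr_eq0 => /eqP/(congr1 (mulmx^~ (H x))).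
by rewrite -mulmxA mulmx_inverse_sym // mulmx1 mulNmx.
Qed.

Lemma mxd_mxd_inverse b c x : D x -> mxd b (mxd c H) x =
  H x *m mxd b G x *m H x *m mxd c G x *m H x +
  H x *m mxd c G x *m H x *m mxd b G x *m H x -
  H x *m mxd b (mxd c G) x *m H x.
Proof.
move=> Dx; have sGc := smooth_mxd c sG; have s1 := smooth_mxM sH sGc.
rewrite -(mxd_ext _ (M := fun y => - (H y *m mxd c G y *m H y))) //.
- rewrite mxdN //; last exact: smooth_mxM.
  rewrite mxdM // mxdM // !mxd_inverse // !opprD !mulmxDl !mulNmx !mulmxN !opprK !mulmxA !opprD.
  by rewrite opprK addrAC.
- by move=> y Dy; rewrite mxd_inverse.
- by apply: smooth_mxN; exact: smooth_mxM.
Qed.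

End Inverse.
End MatrixDerivatives.

(** * The evolution inequality at a null vector *)

Section EvolutionAlgebra.
Context (C : numClosedFieldType) (n : nat).
Local Open Scope sesquilinear_scope.

Lemma m00D (X Y : 'M[C]_1) : (X + Y) 0 0 = X 0 0 + Y 0 0. Proof. by rewrite mxE. Qed.
Lemma m00N (X : 'M[C]_1) : (- X) 0 0 = - X 0 0. Proof. by rewrite mxE. Qed.
Lemma m00Z c (X : 'M[C]_1) : (c *: X) 0 0 = c * X 0 0. Proof. by rewrite mxE. Qed.

(** The data at one point: [G] is the metric and [H] its inverse; [A], [B], [K] are the derivatives
    of [G] along v, along v-bar and along both; [S], [T], [Q] are the same derivatives of the
    Hessian of f. [F2] is that Hessian, [DDH] the mixed second derivative of [H], [Rv] the curvature
    contracted with v and v-bar, and [Fm] the Hessian of the test function. The columns [x] and [w]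
    are the gradient and its derivative along v. *)
Variables (G H A B K P S T Q : 'M[C]_n) (psi : C) (v : 'rV[C]_n) (x w : 'cV[C]_n).
Hypotheses (GH : G *m H = 1%:M) (HG : H *m G = 1%:M).
Hypotheses (adjH : H ^t* = H) (adjA : A ^t* = B).
Let F2 := P - psi *: G.
Let DDH := H *m A *m H *m B *m H + H *m B *m H *m A *m H - H *m K *m H.
Let Rv := A *m H *m B - K.
Let Fm := Q + psi *: K - A *m H *m (T + psi *: B) - (S + psi *: A) *m (H *m B)
   + A *m H *m P *m (H *m B).

(** The second derivative of the Laplacian of f and the traced Hessian of the test function contain
    the same derivatives of f of third and fourth order. These cancel, and the commutator is the
    curvature traced against P. *)
Lemma trace_identity :
  \tr (DDH *m F2 - H *m B *m H *m S - H *m A *m H *m T + H *m Q) - \tr (H *m Fm) =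
  \tr (H *m Rv *m H *m P).
Proof.
have mGH (X : 'M[C]_n) : X *m H *m G = X by rewrite -mulmxA HG mulmx1.
rewrite /DDH /F2 /Fm /Rv !(mulmxDl, mulmxDr, mulmxN, mulNmx, opprD, opprK).
do 3 rewrite ?mulmxA -?scalemxAr -?scalemxAl ?mulmxA.
rewrite !mGH.
rewrite !mxtraceD.
have trN (X : 'M[C]_n) : \tr (- X) = - \tr X by exact: raddfN.
rewrite !(trN, mxtraceZ).
have c1 : \tr (H *m S *m H *m B) = \tr (H *m B *m H *m S).
  by rewrite -mulmxA mxtrace_mulC mulmxA.
have c2 : \tr (H *m B *m H *m A) = \tr (H *m A *m H *m B).
  by rewrite -mulmxA mxtrace_mulC mulmxA.
have c3 : \tr (H *m A *m H *m P *m H *m B) = \tr (H *m B *m H *m A *m H *m P).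
  by rewrite -(mulmxA _ H B) mxtrace_mulC !mulmxA.
rewrite c1 c2 c3; ring.
Qed.

(** The mixed second derivative of |nabla f|^2, with the Hessian of f along v already replaced by
    -psi G. In the square, [A *m H *m x] is the connection term that makes [w] a covariant
    derivative. *)
Lemma gradient_identity :
  let y := x ^t* in let w' := w ^t* in
  ((- psi *: (v *m B) *m H + w' *m (- (H *m A *m H))) *m x + w' *m H *m w
   + ((- psi *: (v *m G) *m (- (H *m B *m H)) + y *m DDH) *m x + y *m (- (H *m B *m H)) *m w)
   + ((- psi *: (v *m G) *m H + y *m (- (H *m A *m H))) *m (- psi *: (G *m v ^t*))
      + y *m H *m (- psi *: (A *m v ^t*)))) 0 0 =
  hform Rv (y *m H) + hform H ((w - A *m H *m x) ^t*) + psi ^+ 2 * hform G v.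
Proof.
move=> y w'; rewrite /hform.
have -> : (y *m H) ^t* = H *m x by rewrite adjmxM adjH /y trmxCK.
rewrite trmxCK.
have -> : (w - A *m H *m x) ^t* = w' - y *m H *m B.
  by rewrite linearB map_mxB !adjmxM adjH adjA /w' /y mulmxA.
have mGH p (X : 'M[C]_(p, n)) : X *m H *m G = X by rewrite -mulmxA HG mulmx1.
have mHG p (X : 'M[C]_(p, n)) : X *m G *m H = X by rewrite -mulmxA GH mulmx1.
rewrite /DDH /Rv !(mulmxDl, mulmxDr, mulmxN, mulNmx, opprD, opprK, scaleNr).
do 4 rewrite ?mulmxA -?scalemxAr -?scalemxAl ?mulmxA ?scalerA ?mulNmx ?mulmxN ?scalerN.
rewrite !(mGH, mHG).
rewrite !(m00D, m00N, m00Z).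
ring.
Qed.

End EvolutionAlgebra.

Section Evolution.
Context (R : realType) (E : topologicalType) (J : finType).
Variables (move : J -> R -> E -> E) (D : set E).
Local Notation C := (Cplx R).
Local Notation smth := (smooth move D).
Local Notation drv := (dir move D).
Local Notation mxd := (mxd move D).
Local Notation smooth_mx := (smooth_mx move D).
Local Open Scope sesquilinear_scope.
Hypothesis sp : forall j x, D x -> ProperFilter (step_filter move D j x).
Hypothesis mv : move_action move.
Hypothesis oD : open D.
Variables (n : nat) (a : 'I_n -> J -> C).
Local Notation ab k := (fun j => (a k j)^*).

Lemma dir_trace b (M : E -> 'M[C]_n) x : smooth_mx M -> D x ->
  drv b (fun y => \tr (M y)) x = \tr (mxd b M x).
Proof.
move=> sM Dx; rewrite /mxtrace (dir_sum sp) //.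
by apply: eq_bigr => i _; rewrite mxdE.
Qed.

Variable v : 'rV[C]_n.
Definition av (j : J) : C := \sum_k v 0 k * a k j.
Definition avb (j : J) : C := (av j)^*.

Lemma dir_av h x : drv av h x = \sum_k v 0 k * drv (a k) h x.
Proof. by rewrite dir_coef_sum; apply: eq_bigr => k _; rewrite dir_coefZ. Qed.

Lemma dir_avb h x : drv avb h x = \sum_k (v 0 k)^* * drv (ab k) h x.
Proof.
rewrite (dir_coef_ext _ _ _ _ (b := fun j => \sum_k (v 0 k)^* * (a k j)^*)).
  by rewrite dir_coef_sum; apply: eq_bigr => k _; rewrite dir_coefZ.
by move=> j; rewrite /avb /av rmorph_sum; apply: eq_bigr => k _; rewrite rmorphM.
Qed.

(** Closedness of the (1,1)-form with coefficient matrix P. Both the metric and nabla nabla-bar f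
    have this property, and so does their combination. *)
Definition kahler_type (P : E -> 'M[C]_n) := smooth_mx P /\ forall y, D y -> forall i j k,
  drv (a k) (fun z => P z i j) y = drv (a i) (fun z => P z k j) y /\
  drv (ab k) (fun z => P z i j) y = drv (ab j) (fun z => P z i k) y.

Lemma kahler_type_row P y k : kahler_type P -> D y ->
  v *m mxd (a k) P y = row k (mxd av P y).
Proof.
move=> [sP kP] Dy; apply/rowP => j; rewrite [RHS]mxE mxdE dir_av mxE.
by apply: eq_bigr => i _; rewrite mxdE (kP y Dy i j k).1.
Qed.

Lemma kahler_type_col P y l : kahler_type P -> D y ->
  mxd (ab l) P y *m v ^t* = col l (mxd avb P y).
Proof.
move=> [sP kP] Dy; apply/colP => i; rewrite [RHS]mxE mxdE dir_avb mxE.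
by apply: eq_bigr => j _; rewrite mxdE (kP y Dy i j l).2 !mxE mulrC.
Qed.

(** Closedness trades the Hessian of P(v, v-bar) for the second derivative of P along v and v-bar,
    which is what differentiating the heat equation along v produces. *)
Lemma kahler_type_hess P x k l : kahler_type P -> D x ->
  (v *m mxd (a k) (mxd (ab l) P) x *m v ^t*) 0 0 = mxd av (mxd avb P) x k l.
Proof.
move=> kP Dx; have [sP _] := kP; have sPl := smooth_mxd sp (ab l) sP.
have sPb := smooth_mxd sp avb sP; have sPa := smooth_mxd sp av sP.
have sPk := smooth_mxd sp (a k) sP.
have cv b (M : E -> 'M[C]_n) : smooth_mx M ->
    mxd b (fun y => M y *m v ^t*) x = mxd b M x *m v ^t*.
  move=> sM; rewrite (mxdM sp) //; last exact: (smooth_mx_cst sp).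
  by rewrite (mxd_cst sp) // mulmx0 addr0.
have sc : smooth_mx (fun y => col l (mxd avb P y)).
  by move=> i j; apply: (smooth_ext sp _ (sPb i l)) => y _; rewrite [RHS]mxE.
rewrite -mulmxA -cv // -(mxd_ext sp (a k) (M := fun y => col l (mxd avb P y))) //; last first.
  by move=> y Dy; rewrite (kahler_type_col l kP Dy).
have sd b i : smth (drv b (fun y => P y i l)) by exact: (smooth_dir sp).
transitivity (drv avb (fun y => \sum_i v 0 i * drv (a k) (fun z => P z i l) y) x).
  rewrite (dir_sum sp) //; last first.
    by move=> i; apply: (smoothM sp) => //; exact: (smooth_cst sp).
  rewrite mxE; apply: eq_bigr => i _; rewrite (dirZ sp) // mxdE (dirC sp _ _ mv oD) //.
  congr (_ * _); rewrite -(dir_ext sp (f := drv avb (fun y => P y i l))) //.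
  by move=> y _; rewrite mxE mxdE.
transitivity (drv avb (drv av (fun y => P y k l)) x).
  apply: esym; apply: (dir_ext sp) => [y Dy||//]; last exact: (smooth_dir sp).
  by rewrite dir_av; apply: eq_bigr => i _; rewrite (kP.2 y Dy i l k).1.
rewrite (dirC sp _ _ mv oD) // mxdE.
apply: (dir_ext sp) => [y Dy||//]; last exact: (smooth_dir sp).
by rewrite mxdE.
Qed.

End Evolution.

Section EvolutionInequality.
Context (R : realType) (E : topologicalType) (J : finType).
Variables (move : J -> R -> E -> E) (D : set E).
Local Notation C := (Cplx R).
Local Notation smth := (smooth move D).
Local Notation drv := (dir move D).
Local Notation mxd := (mxd move D).
Local Notation smooth_mx := (smooth_mx move D).
Local Open Scope sesquilinear_scope.
Hypothesis sp : forall j x, D x -> ProperFilter (step_filter move D j x).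
Hypothesis mv : move_action move.
Hypothesis oD : open D.
Variables (n : nat) (a : 'I_n -> J -> C).
Local Notation ab k := (fun j => (a k j)^*).
Variable f : E -> C.
Hypothesis sf : smth f.
Hypothesis rf : forall y, D y -> (f y)^* = f y.

Definition gradz (y : E) : 'cV[C]_n := \col_k drv (a k) f y.
Definition gradzb (y : E) : 'rV[C]_n := \row_k drv (ab k) f y.
Definition hess (y : E) : 'M[C]_n := \matrix_(k, l) drv (a k) (drv (ab l) f) y.

Lemma smooth_gradz : smooth_mx gradz.
Proof.
move=> i j; apply: (smooth_ext sp _ (smooth_dir sp (a i) sf)) => y _.
by rewrite mxE.
Qed.

Lemma smooth_gradzb : smooth_mx gradzb.
Proof.
move=> i j; apply: (smooth_ext sp _ (smooth_dir sp (ab j) sf)) => y _.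
by rewrite mxE.
Qed.

Lemma smooth_hess : smooth_mx hess.
Proof.
move=> i j; apply: (smooth_ext sp _ (smooth_dir sp (a i) (smooth_dir sp (ab j) sf))) => y _.
by rewrite mxE.
Qed.

Lemma dir_real b y : D y -> (drv b f y)^* = drv (fun j => (b j)^*) f y.
Proof.
move=> Dy; rewrite -(dir_ext sp _ rf (smooth_conj sp sf) Dy) (dir_conj sp) //.
by rewrite conjCK.
Qed.

Lemma adj_gradz y : D y -> (gradz y) ^t* = gradzb y.
Proof. by move=> Dy; apply/rowP => k; rewrite !mxE dir_real. Qed.

Lemma adj_hess y : D y -> (hess y) ^t* = hess y.
Proof.
move=> Dy; apply/matrixP => k l; rewrite !mxE.
have e z : D z -> (drv (ab k) f z)^* = drv (a k) f z.
  by move=> Dz; rewrite dir_real //; apply: dir_coef_ext => j; rewrite conjCK.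
have sk := smooth_dir sp (ab k) sf.
rewrite (dirC sp (a k) _ mv oD sf Dy) -(dir_ext sp (ab l) e (smooth_conj sp sk) Dy).
rewrite (dir_conj sp) //; congr (_^*); apply: dir_coef_ext => j; by rewrite conjCK.
Qed.

Lemma kahler_type_hessian : kahler_type move D a hess.
Proof.
split; first exact: smooth_hess.
have h b i j y : D y -> drv b (fun z => hess z i j) y = drv b (drv (a i) (drv (ab j) f)) y.
  move=> Dy; apply: esym; apply: (dir_ext sp) => [z Dz||//]; first by rewrite mxE.
  by do 2 apply: (smooth_dir sp).
move=> y Dy i j k; split.
  rewrite (h _ i j y Dy) (h _ k j y Dy).
  by apply: (dirC sp _ _ mv oD) => //; exact: (smooth_dir sp).
have c l m : drv (ab l) (drv (a i) (drv (ab m) f)) y = drv (a i) (drv (ab l) (drv (ab m) f)) y.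
  exact: (dirC sp (ab l) (a i) mv oD (smooth_dir sp (ab m) sf) Dy).
transitivity (drv (a i) (drv (ab k) (drv (ab j) f)) y); first by rewrite (h _ i j y Dy) c.
transitivity (drv (a i) (drv (ab j) (drv (ab k) f)) y); last by rewrite (h _ i k y Dy) c.
apply: (dir_ext sp) => [z Dz||//]; last by do 2 apply: (smooth_dir sp).
exact: (dirC sp _ _ mv oD).
Qed.

Variable v : 'rV[C]_n.
Local Notation av := (av a v).
Local Notation avb := (avb a v).

Lemma mxd_gradz y : D y -> mxd avb gradz y = hess y *m v ^t*.
Proof.
move=> Dy; apply/colP => k; rewrite mxdE dir_avb [RHS]mxE; apply: eq_bigr => l _.
rewrite !mxE mulrC; congr (_ * _); rewrite (dirC sp (a k) _ mv oD sf Dy).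
apply: esym; apply: (dir_ext sp) => [z Dz||//]; last exact: (smooth_dir sp).
by rewrite mxE.
Qed.

Lemma mxd_gradzb y : D y -> mxd av gradzb y = v *m hess y.
Proof.
move=> Dy; apply/rowP => l; rewrite mxdE dir_av [RHS]mxE; apply: eq_bigr => k _.
rewrite !mxE; congr (_ * _).
apply: esym; apply: (dir_ext sp) => [z Dz||//]; last exact: (smooth_dir sp).
by rewrite mxE.
Qed.

Lemma dir_dir_hess y : D y -> drv av (drv avb f) y = hform (hess y) v.
Proof.
move=> Dy; rewrite hformE dir_av; apply: eq_bigr => k _.
have sl l : smth (fun z => (v 0 l)^* * drv (ab l) f z).
  by apply: (smoothM sp); [exact: (smooth_cst sp) | exact: (smooth_dir sp)].
rewrite -(dir_ext sp (f := fun z => \sum_l (v 0 l)^* * drv (ab l) f z)) //.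
- rewrite (dir_sum sp) // mulr_sumr; apply: eq_bigr => l _.
  rewrite (dirZ sp) //; last exact: (smooth_dir sp).
  by rewrite mxE; ring.
- by move=> z _; rewrite dir_avb.
- exact: (smooth_sum sp).
Qed.

(** [at_] stands for the time derivative and [al] for the constant of the equation. [psi] is a
    constant here: the time derivative of the barrier is accounted for later. *)
Variables (G H : E -> 'M[C]_n) (psi al : C) (at_ : J -> C) (x0 : E).
Hypothesis ktG : kahler_type move D a G.
Hypothesis sH : smooth_mx H.
Hypothesis adjG : forall y, D y -> (G y) ^t* = G y.
Hypothesis HG : forall y, D y -> H y *m G y = 1%:M.
Hypothesis adjH : (H x0) ^t* = H x0.
Hypothesis eq_f : forall y, D y ->
  drv at_ f y = \tr (H y *m hess y) + (gradzb y *m H y *m gradz y) 0 0 + al * f y.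
Hypothesis Dx0 : D x0.
Let P y := hess y + psi *: G y.
Let A := mxd av G x0.
Let B := mxd avb G x0.
Let K := mxd av (mxd avb G) x0.
Let Rv := A *m H x0 *m B - K.
Variable nu : E -> 'rV[C]_n.
Hypothesis snu : smooth_mx nu.
Hypothesis nu0 : nu x0 = v.
(* The next two hypotheses make [nu] holomorphic with vanishing covariant derivative at [x0], so
   that the coordinate derivatives of [F] at [x0] are covariant derivatives of [P]. *)
Hypothesis nu_bar : forall k y, D y -> mxd (ab k) nu y = 0.
Hypothesis nu_d : forall k y, D y -> mxd (a k) nu y = - row k (A *m H x0).
Let F y := (nu y *m P y *m (nu y) ^t*) 0 0.
Hypothesis hP : (P x0) ^t* = P x0.
Hypothesis P0 : forall w, 0 <= hform (P x0) w.
Hypothesis Pv : hform (P x0) v = 0.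
Hypothesis F_d : forall k, drv (a k) F x0 = 0.
Hypothesis F_db : forall k, drv (ab k) F x0 = 0.
Hypothesis Rv0 : forall w, 0 <= hform Rv w.
Hypothesis H0 : forall w, 0 <= hform (H x0) w.

Let sG : smooth_mx G. Proof. by case: ktG. Qed.
Let sP : smooth_mx P.
Proof. by apply: (smooth_mxD sp); [exact: smooth_hess | exact: (smooth_mxZ sp)]. Qed.

Let ktP : kahler_type move D a P.
Proof.
split=> // y Dy i j k.
have h b i' j' : drv b (fun z => P z i' j') y =
    drv b (fun z => hess z i' j') y + psi * drv b (fun z => G z i' j') y.
  have := congr1 (fun X : 'M[C]_n => X i' j') (mxdD sp b smooth_hess (smooth_mxZ sp psi sG) Dy).
  rewrite (mxdZ sp b psi sG Dy) => e; transitivity (mxd b P y i' j'); first by rewrite mxdE.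
  by rewrite e [LHS]mxE [X in _ + X]mxE !mxdE.
have [h1 h2] := kahler_type_hessian.2 y Dy i j k; have [g1 g2] := ktG.2 y Dy i j k.
by split; rewrite !h ?h1 ?h2 ?g1 ?g2.
Qed.

Let Pnu y b : D y -> mxd b (fun y => nu y *m P y *m (nu y) ^t*) y =
  mxd b nu y *m P y *m (nu y) ^t* + nu y *m mxd b P y *m (nu y) ^t*
  + nu y *m P y *m (mxd (fun j => (b j)^*) nu y) ^t*.
Proof.
move=> Dy; rewrite (mxdM sp b (smooth_mxM sp snu sP) (smooth_mx_adj sp snu) Dy).
by rewrite (mxdM sp b snu sP Dy) (mxd_adj sp b snu Dy) mulmxDl.
Qed.

Let vP : v *m P x0 = 0 /\ P x0 *m v ^t* = 0.
Proof. exact: psd_null. Qed.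

Let mxdF b y : drv b F y = mxd b (fun y => nu y *m P y *m (nu y) ^t*) y 0 0.
Proof. by rewrite mxdE. Qed.

(** Since P v = 0, the derivatives of [nu] drop out of the first-order condition on F. What remains
    is the derivative of P along z^k evaluated on v, and [kahler_type_row] turns it into the k-th
    entry of the derivative along v. *)
Lemma mxd_av_null : mxd av P x0 *m v ^t* = 0.
Proof.
have [vP0 Pv0] := vP.
apply/colP => k; have := F_d k; rewrite mxdF Pnu // nu0 vP0 mul0mx addr0.
rewrite -!mulmxA Pv0 mulmx0 add0r mulmxA (kahler_type_row v k ktP Dx0) => h.
by rewrite [RHS]mxE -h [LHS]mxE [RHS]mxE; apply: eq_bigr => j _; rewrite [in RHS]mxE.
Qed.

Lemma mxd_avb_null : v *m mxd avb P x0 = 0.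
Proof.
have [vP0 Pv0] := vP.
apply/rowP => k; have := F_db k; rewrite mxdF Pnu // nu0 vP0 mul0mx addr0.
rewrite -!mulmxA Pv0 mulmx0 add0r (kahler_type_col v k ktP Dx0) => h.
by rewrite [RHS]mxE -h [LHS]mxE [RHS]mxE; apply: eq_bigr => j _; rewrite [in RHS]mxE.
Qed.


Let adjA : A ^t* = B.
Proof.
have adjG' y : D y -> G y = (G y) ^t* by move=> Dy; rewrite adjG.
rewrite /B (mxd_ext sp avb adjG' sG Dx0) (mxd_adj sp avb sG Dx0).
by congr (_ ^t*); apply/matrixP => i j; rewrite !mxdE; apply: dir_coef_ext => j'; rewrite conjCK.
Qed.

(** As [nu] is holomorphic, each of the two derivatives falls on P or on exactly one of the two
    copies of [nu], which leaves four terms; closedness of P brings them to matrix form. *)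
Lemma second_derivative_test_form k l : drv (a k) (drv (ab l) F) x0 =
  (mxd av (mxd avb P) x0 - A *m H x0 *m mxd avb P x0 - mxd av P x0 *m (H x0 *m B)
   + A *m H x0 *m P x0 *m (H x0 *m B)) k l.
Proof.
have [vP0 Pv0] := vP.
set c := A *m H x0; have cE : c ^t* = H x0 *m B.
  by rewrite /c adjmxM adjH adjA.
pose L y := nu y *m mxd (ab l) P y *m (nu y) ^t* - nu y *m P y *m (row l c) ^t*.
have sPl : smooth_mx (mxd (ab l) P) by exact: (smooth_mxd sp).
have sc : smooth_mx (fun=> (row l c) ^t*) by exact: (smooth_mx_cst sp).
have s1 : smooth_mx (fun y => nu y *m mxd (ab l) P y) by exact: (smooth_mxM sp).
have s1' : smooth_mx (fun y => nu y *m mxd (ab l) P y *m (nu y) ^t*).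
  by apply: (smooth_mxM sp) => //; exact: (smooth_mx_adj sp).
have s2 : smooth_mx (fun y => nu y *m P y) by exact: (smooth_mxM sp).
have s2' : smooth_mx (fun y => nu y *m P y *m (row l c) ^t*) by exact: (smooth_mxM sp).
have LE y : D y -> drv (ab l) F y = L y 0 0.
  move=> Dy; rewrite mxdF (Pnu (ab l) Dy) nu_bar // !mul0mx add0r.
  rewrite (_ : mxd (fun j => ((a l j)^*)^*) nu y = - row l c).
    by rewrite /L linearN map_mxN mulmxN.
  rewrite -(nu_d l Dy); apply/matrixP => i j; rewrite !mxdE.
  by apply: dir_coef_ext => j'; rewrite conjCK.
have sL : smooth_mx L by apply: (smooth_mxD sp) => //; exact: (smooth_mxN sp).
have -> : drv (a k) (drv (ab l) F) x0 = mxd (a k) L x0 0 0.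
  rewrite mxdE; apply: esym; apply: (dir_ext sp (f := fun y => L y 0 0)) => // y Dy.
  exact: esym (LE y Dy).
rewrite (mxdD sp (a k) s1' (smooth_mxN sp s2') Dx0) (mxdN sp (a k) s2' Dx0).
rewrite (mxdM sp (a k) s1 (smooth_mx_adj sp snu) Dx0) (mxd_adj sp (a k) snu Dx0) nu_bar //.
rewrite trmx0 map_mx0 mulmx0 addr0 (mxdM sp (a k) snu sPl Dx0).
rewrite (mxdM sp (a k) s2 sc Dx0) (mxd_cst sp) // mulmx0 addr0.
rewrite (mxdM sp (a k) snu sP Dx0) nu_d // -/c nu0.
rewrite !mulmxDl -[_ *m mxd (ab l) P x0 *m _]mulmxA (kahler_type_col v l ktP Dx0).
rewrite (kahler_type_row v k ktP Dx0) !mulNmx !opprD opprK.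
rewrite [LHS]mxE [X in X + _]mxE (kahler_type_hess sp mv oD v k l ktP Dx0).
have rc (U W : 'M[C]_n) : (row k U *m col l W) 0 0 = (U *m W) k l.
  by rewrite !mxE; apply: eq_bigr => j _; rewrite !mxE.
have rl : (row l c) ^t* = col l (H x0 *m B).
  by rewrite -cE; apply/colP => j; rewrite !mxE.
have eD p q (X Y : 'M[C]_(p, q)) i j : (X + Y) i j = X i j + Y i j by rewrite mxE.
have eN p q (X : 'M[C]_(p, q)) i j : (- X) i j = - X i j by rewrite mxE.
rewrite rl -(row_mul k c (P x0)) !(eD, eN) !rc.
by rewrite [- _ + _]addrC -[RHS]addrA [- _ + _ in RHS]addrC.
Qed.


Lemma dir_dir_trace : drv av (drv avb (fun y => \tr (H y *m hess y))) x0 =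
  \tr ((H x0 *m A *m H x0 *m B *m H x0 + H x0 *m B *m H x0 *m A *m H x0
        - H x0 *m K *m H x0) *m hess x0
     - H x0 *m B *m H x0 *m mxd av hess x0 - H x0 *m A *m H x0 *m mxd avb hess x0
     + H x0 *m mxd av (mxd avb hess) x0).
Proof.
have sh := smooth_hess.
have sHb := smooth_mxd sp avb sH; have shb := smooth_mxd sp avb sh.
have s1 := smooth_mxM sp sHb sh; have s2 := smooth_mxM sp sH shb.
rewrite -(dir_ext sp av (f := fun y => \tr (mxd avb H y *m hess y + H y *m mxd avb hess y))); first last.
- exact: Dx0.
- by apply: (smooth_sum sp) => i; exact: (smooth_mxD sp s1 s2).
- by move=> y Dy; rewrite (dir_trace sp avb (smooth_mxM sp sH sh) Dy) (mxdM sp avb sH sh Dy).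
rewrite (dir_trace sp av (smooth_mxD sp s1 s2) Dx0) (mxdD sp av s1 s2 Dx0).
rewrite (mxdM sp av sHb sh Dx0) (mxdM sp av sH shb Dx0).
rewrite (mxd_mxd_inverse sp sG sH HG av avb Dx0) !(mxd_inverse sp sG sH HG _ Dx0).
have reassoc (U V W X Y Z : 'M[C]_n) :
    U + - V *m X + (- W *m Y + Z) = U - V *m X - W *m Y + Z.
  by rewrite !mulNmx !addrA.
exact: congr1 _ (reassoc _ _ _ _ _ _).
Qed.

(** The null conditions eliminate the higher derivatives of f: the Hessian on v is -psi G v, and the
    mixed derivative of the gradient reduces to -psi times a first derivative of G on v. *)
Lemma dir_dir_gradient :
  let x := gradz x0 in let w := mxd av gradz x0 in
  drv av (drv avb (fun y => (gradzb y *m H y *m gradz y) 0 0)) x0 =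
  hform Rv (x ^t* *m H x0) + hform (H x0) ((w - A *m H x0 *m x) ^t*)
  + psi ^+ 2 * hform (G x0) v.
Proof.
move=> x w.
have sX := smooth_gradz; have sY := smooth_gradzb.
have sHb := smooth_mxd sp avb sH; have sXb := smooth_mxd sp avb sX.
have sYb := smooth_mxd sp avb sY.
have sYH := smooth_mxM sp sY sH; have sYHX := smooth_mxM sp sYH sX.
have t1 := smooth_mxM sp sYb sH; have t1' := smooth_mxM sp t1 sX.
have t2 := smooth_mxM sp sY sHb; have t2' := smooth_mxM sp t2 sX.
have t3' := smooth_mxM sp sYH sXb.
pose M y := mxd avb gradzb y *m H y *m gradz y + gradzb y *m mxd avb H y *m gradz y
  + gradzb y *m H y *m mxd avb gradz y.
have sM := smooth_mxD sp (smooth_mxD sp t1' t2') t3'.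
have -> : drv av (drv avb (fun y => (gradzb y *m H y *m gradz y) 0 0)) x0 = mxd av M x0 0 0.
  rewrite mxdE; apply: esym; apply: (dir_ext sp (f := fun y => M y 0 0)) => // y Dy.
  transitivity (mxd avb (fun y => gradzb y *m H y *m gradz y) y 0 0); last by rewrite mxdE.
  by rewrite (mxdM sp avb sYH sX Dy) (mxdM sp avb sY sH Dy) mulmxDl.
rewrite (mxdD sp av (smooth_mxD sp t1' t2') t3' Dx0) (mxdD sp av t1' t2' Dx0).
rewrite (mxdM sp av t1 sX Dx0) (mxdM sp av sYb sH Dx0).
rewrite (mxdM sp av t2 sX Dx0) (mxdM sp av sY sHb Dx0).
rewrite (mxdM sp av sYH sXb Dx0) (mxdM sp av sY sH Dx0).
have [vP0 Pv0] := vP.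
have FP : hess x0 = P x0 - psi *: G x0 by rewrite addrK.
have vh : v *m hess x0 = - psi *: (v *m G x0).
  by rewrite FP mulmxBr vP0 sub0r -scalemxAr scaleNr.
have hv : hess x0 *m v ^t* = - psi *: (G x0 *m v ^t*).
  by rewrite FP mulmxBl Pv0 sub0r -scalemxAl scaleNr.
have sh := smooth_hess.
have hG : smooth_mx (fun y => psi *: G y) by exact: (smooth_mxZ sp).
have da : mxd av hess x0 = mxd av P x0 - psi *: A.
  by rewrite (mxdD sp av sh hG Dx0) (mxdZ sp av psi sG Dx0) addrK.
have db : mxd avb hess x0 = mxd avb P x0 - psi *: B.
  by rewrite (mxdD sp avb sh hG Dx0) (mxdZ sp avb psi sG Dx0) addrK.
have Xab : mxd av (mxd avb gradz) x0 = - psi *: (A *m v ^t*).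
  have sv := smooth_mx_cst sp (v ^t*).
  rewrite -(mxd_ext sp av (fun y Dy => esym (mxd_gradz Dy)) (smooth_mxM sp sh sv) Dx0).
  rewrite (mxdM sp av sh sv Dx0) (mxd_cst sp) // mulmx0 addr0 da mulmxBl mxd_av_null.
  by rewrite sub0r -scalemxAl scaleNr.
have Yab : mxd av (mxd avb gradzb) x0 = - psi *: (v *m B).
  rewrite (mxdC sp av avb mv oD sY Dx0).
  have sv := smooth_mx_cst sp v.
  rewrite -(mxd_ext sp avb (fun y Dy => esym (mxd_gradzb Dy)) (smooth_mxM sp sv sh) Dx0).
  rewrite (mxdM sp avb sv sh Dx0) (mxd_cst sp) // mul0mx add0r db mulmxBr mxd_avb_null.
  by rewrite sub0r -scalemxAr scaleNr.
have Yb : mxd avb gradzb x0 = w ^t*.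
  rewrite (mxd_ext sp avb (fun y Dy => esym (adj_gradz Dy)) sY Dx0) (mxd_adj sp avb sX Dx0).
  by congr (_ ^t*); apply/matrixP => i j; rewrite !mxdE; apply: dir_coef_ext => j'; rewrite conjCK.
rewrite (mxd_mxd_inverse sp sG sH HG av avb Dx0) !(mxd_inverse sp sG sH HG _ Dx0).
rewrite Xab Yab Yb (mxd_gradz Dx0) (mxd_gradzb Dx0) vh hv -(adj_gradz Dx0).
rewrite -(gradient_identity K psi v x w (mulmx_inverse_sym HG Dx0) (HG Dx0) adjH adjA).
by [].
Qed.

(** Three nonnegative terms survive: the curvature traced against P, the curvature evaluated on the
    gradient, and a square. The zero-order term of the equation contributes -al psi G(v, v-bar),
    again because P v = 0. *)
Lemma evolution_inequality :
  0 <= drv av (drv avb (drv at_ f)) x0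
       - \tr (H x0 *m \matrix_(k, l) drv (a k) (drv (ab l) F) x0)
       - (psi ^+ 2 - al * psi) * hform (G x0) v.
Proof.
have sh := smooth_hess; have sX := smooth_gradz; have sY := smooth_gradzb.
have s1 : smth (fun y => \tr (H y *m hess y)).
  by apply: (smooth_sum sp) => i; exact: (smooth_mxM sp sH sh).
have s2 : smth (fun y => (gradzb y *m H y *m gradz y) 0 0).
  exact: (smooth_mxM sp (smooth_mxM sp sY sH) sX).
have s3 : smth (fun y => al * f y) by exact: (smoothM sp (smooth_cst sp al) sf).
have s12 := smoothD sp s1 s2.
have sb := smooth_dir sp avb.
have -> : drv av (drv avb (drv at_ f)) x0 =
    drv av (drv avb (fun y => \tr (H y *m hess y))) x0
    + drv av (drv avb (fun y => (gradzb y *m H y *m gradz y) 0 0)) x0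
    + al * hform (hess x0) v.
  have e y : D y -> drv avb (fun y => \tr (H y *m hess y)) y +
      drv avb (fun y => (gradzb y *m H y *m gradz y) 0 0) y + al * drv avb f y =
      drv avb (drv at_ f) y.
    move=> Dy; rewrite (dir_ext sp avb eq_f (smooth_dir sp at_ sf) Dy).
    by rewrite (dirD sp avb s12 s3 Dy) (dirD sp avb s1 s2 Dy) (dirZ sp avb al sf Dy).
  have s3' := smoothM sp (smooth_cst sp al) (sb f sf).
  rewrite -(dir_ext sp av e (smoothD sp (smoothD sp (sb _ s1) (sb _ s2)) s3') Dx0).
  rewrite (dirD sp av (smoothD sp (sb _ s1) (sb _ s2)) s3' Dx0).
  by rewrite (dirD sp av (sb _ s1) (sb _ s2) Dx0) (dirZ sp av al (sb _ sf) Dx0) (dir_dir_hess Dx0).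
rewrite dir_dir_trace dir_dir_gradient.
have FP : hess x0 = P x0 - psi *: G x0 by rewrite addrK.
have hG : smooth_mx (fun y => psi *: G y) by exact: (smooth_mxZ sp).
have da : mxd av P x0 = mxd av hess x0 + psi *: A.
  by rewrite (mxdD sp av sh hG Dx0) (mxdZ sp av psi sG Dx0).
have db : mxd avb P x0 = mxd avb hess x0 + psi *: B.
  by rewrite (mxdD sp avb sh hG Dx0) (mxdZ sp avb psi sG Dx0).
have dab : mxd av (mxd avb P) x0 = mxd av (mxd avb hess) x0 + psi *: K.
  have e y : D y -> mxd avb P y = mxd avb hess y + psi *: mxd avb G y.
    by move=> Dy; rewrite (mxdD sp avb sh hG Dy) (mxdZ sp avb psi sG Dy).
  have sGb := smooth_mxd sp avb sG.
  rewrite (mxd_ext sp av e (smooth_mxd sp avb sP) Dx0).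
  by rewrite (mxdD sp av (smooth_mxd sp avb sh) (smooth_mxZ sp psi sGb) Dx0) (mxdZ sp av psi sGb Dx0).
have -> : \matrix_(k, l) drv (a k) (drv (ab l) F) x0 =
    mxd av (mxd avb P) x0 - A *m H x0 *m mxd avb P x0 - mxd av P x0 *m (H x0 *m B)
   + A *m H x0 *m P x0 *m (H x0 *m B).
  by apply/matrixP => k l; rewrite mxE second_derivative_test_form.
rewrite dab da db FP.
have := trace_identity A B K (P x0) (mxd av hess x0) (mxd avb hess x0)
  (mxd av (mxd avb hess) x0) psi (HG Dx0).
have hGv : hform (P x0 - psi *: G x0) v = - (psi * hform (G x0) v).
  have [vP0 _] := vP.
  by rewrite /hform mulmxBr vP0 sub0r mulNmx -scalemxAr -scalemxAl mxE [X in - X]mxE.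
rewrite hGv => /eqP; rewrite subr_eq => /eqP ->.
have := trace_sandwich_ge0 Rv0 hP P0 adjH.
move: (Rv0 ((gradz x0) ^t* *m H x0)) (H0 ((mxd av gradz x0 - A *m H x0 *m gradz x0) ^t*)).
move: (\tr (H x0 *m Rv *m H x0 *m P x0)) => t1.
rewrite -/Rv; move: (\tr (H x0 *m _)) (hform Rv _) (hform (H x0) _) (hform (G x0) v) => t2 t3 t4 t5.
move=> t30 t40 t10.
have -> : t1 + t2 + (t3 + t4 + psi ^+ 2 * t5) + al * - (psi * t5) - t2
  - (psi ^+ 2 - al * psi) * t5 = t1 + t3 + t4 by ring.
by rewrite !addr_ge0.
Qed.

End EvolutionInequality.

(** * Space-time cylinders *)

Section Interior.
Context (R : realType) (E : topologicalType) (J : finType).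
Variables (move : J -> R -> E -> E) (mv : move_action move).
Local Notation C := (Cplx R).

Lemma interior_partial (D1 D2 : set E) j f x : nbhs x D1 -> nbhs x D2 ->
  partial move D1 j f x = partial move D2 j f x.
Proof. by move=> n1 n2; rewrite /partial !(interior_step mv). Qed.

Lemma partial_near (D : set E) j f g x : nbhs x D -> (forall y, D y -> f y = g y) ->
  partial move D j f x = partial move D j g x.
Proof.
move=> nD fg; rewrite /partial; congr lim.
have [m0 _ _ _] := mv.
have e : \forall t \near step_filter move D j x, diff_quotient move j f x t =
    diff_quotient move j g x t.
  apply: filterS (step_in move D j x) => t Dt; rewrite !diff_quotientE !fg //.
  exact: nbhs_singleton nD.
apply/seteqP; split => A hA; apply: filterS2 e hA => t /= -> //.
Qed.

Variables (D1 D2 : set E).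
Hypotheses (oD1 : open D1) (D12 : D1 `<=` D2).

Let n1 x : D1 x -> nbhs x D1. Proof. by move=> Dx; exact: open_nbhs_nbhs. Qed.
Let n2 x : D1 x -> nbhs x D2. Proof. by move=> Dx; exact: filterS D12 (n1 Dx). Qed.

(** Smoothness is given on a cylinder closed at t = 0, with one-sided time derivatives. On positive
    times, an open set, these are ordinary derivatives, and all partial derivatives commute
    there. *)
Lemma Ck_open_subset k f : Ck move D2 k f -> Ck move D1 k f.
Proof.
elim: k f => [|k ih] f [cf hf]; split.
- exact: continuous_subspaceW cf.
- exact: I.
- exact: continuous_subspaceW cf.
move=> j; have [h1 h2] := hf j; split.
  move=> x Dx; have := h1 x (D12 Dx).
  by rewrite /has_partial (interior_step mv _ (n1 Dx)) (interior_step mv _ (n2 Dx)).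
apply: (Ck_ext (open_step_proper mv oD1) (f := partial move D2 j f)); last exact: ih.
by move=> y Dy; exact: (interior_partial _ _ (n2 Dy) (n1 Dy)).
Qed.

Lemma smooth_open_subset f : smooth move D2 f -> smooth move D1 f.
Proof. by move=> sf k; exact: Ck_open_subset. Qed.

Lemma dir_open_subset b f x : D1 x -> dir move D1 b f x = dir move D2 b f x.
Proof.
move=> Dx; apply: eq_bigr => j _; congr (_ * _).
exact: (interior_partial _ _ (n1 Dx) (n2 Dx)).
Qed.

Lemma dir_near b f g x : D1 x -> (forall y, D1 y -> f y = g y) ->
  dir move D1 b f x = dir move D1 b g x.
Proof. by move=> Dx fg; apply: eq_bigr => j _; rewrite (partial_near _ (n1 Dx) fg). Qed.

End Interior.

Lemma big_option (V : nmodType) (I : finType) (F : option I -> V) :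
  \sum_(j : option I) F j = F None + \sum_(j : I) F (Some j).
Proof.
rewrite (bigD1 None) //=; congr (_ + _); rewrite (reindex_omap Some id) /=; last by case.
by apply: eq_bigl => j; rewrite eqxx.
Qed.

Section Cylinders.
Context (R : realType) (n : nat).
Local Notation C := (Cplx R).
Local Notation V := 'rV[C]_n.
Local Notation J := ('I_n * bool)%type.
Local Notation smv := (@space_move R n).
Local Notation tmv := (@spacetime_move R n).

Definition cyl (U : set V) (I : set R) : set (V * R) := [set x | U x.1 /\ I x.2].

Lemma spacetime_move_action : move_action tmv.
Proof.
have [m0 mD mc mn] := space_move_action R n.
split.
- by case=> [j|] [z t] /=; rewrite ?m0 ?addr0.
- by case=> [j|] r s [z t] /=; rewrite ?mD // [r + s]addrC addrA.
- case=> [i|] [j|] r s [z t] //=; first by rewrite mc.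
  by rewrite addrAC.
move=> i j [z t] A [[B1 B2] /= [nB1 nB2] BA].
have n0 : B1 z by exact: (@nbhs_singleton (V : topologicalType) z B1 nB1).
have [d1 d10 h1] : exists2 d1 : R, 0 < d1 & forall r s, `|r| <= d1 -> `|s| <= d1 ->
    B1 (if i is Some i' then smv i' r (if j is Some j' then smv j' s z else z)
        else if j is Some j' then smv j' s z else z).
  case: i => [i|]; case: j => [j|].
  - by have [d d0 h] := mn i j z B1 nB1; exists d.
  - have [d d0 h] := mn i i z B1 nB1; exists d => // r s rd sd.
    by have := h r 0; rewrite m0; apply; rewrite ?normr0 // ltW.
  - have [d d0 h] := mn j j z B1 nB1; exists d => // r s rd sd.
    by have := h s 0; rewrite m0; apply; rewrite ?normr0 // ltW.
  - by exists 1.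
have [d2 /= d20 h2] := nB2.
exists (Num.min d1 (d2 / 3)); first by rewrite lt_min d10 divr_gt0.
move=> r s; rewrite !le_min => /andP[r1 r2] /andP[s1 s2]; apply: BA.
have h1' := h1 r s r1 s1.
have h2' (y : R) : `|y| <= d2 / 3 + d2 / 3 -> B2 (t + y).
  by move=> yd; apply: h2; rewrite /ball /= opprD addrA subrr add0r normrN; lra.
have p : 0 <= d2 / 3 by rewrite divr_ge0 // ltW.
have z0 : B2 t by rewrite -[t]addr0; apply: h2'; rewrite normr0; lra.
have dd : `|r + s| <= d2 / 3 + d2 / 3 by rewrite (le_trans (ler_normD _ _)) // lerD.
have ds : `|s| <= d2 / 3 + d2 / 3 by lra.
have dr : `|r| <= d2 / 3 + d2 / 3 by lra.
case: i h1' {h1} => [i|]; case: j => [j|] /= h1'; split => //=; try exact: h2'.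
by rewrite -addrA [s + r]addrC; exact: h2'.
Qed.

Variables (U : set V) (I : set R).
Hypothesis oU : open U.
(** Stated for an arbitrary set of times, so as to cover both [0, T) and (0, T). *)
Hypothesis I_step : forall t, I t -> ProperFilter (within [set h | I (t + h)] (0 : R)^').
Let D := cyl U I.

Lemma slice_cyl t : I t -> [set z | D (z, t)] = U.
Proof. by move=> It; apply/seteqP; split => z; [case | split]. Qed.

Lemma cyl_step_proper j x : D x -> ProperFilter (step_filter tmv D j x).
Proof.
case: x => z t [/= Uz It]; case: j => [j|].
  have -> : step_filter tmv D (Some j) (z, t) = step_filter smv U j z.
    by rewrite -[in RHS](slice_cyl It).
  exact: space_step_proper.
have -> : step_filter tmv D None (z, t) = within [set h | I (t + h)] (0 : R)^'.
  rewrite /step_filter (_ : [set h | D (tmv None h (z, t))] = [set h | I (t + h)]) //.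
  by apply/seteqP; split => h; [case | split].
exact: I_step.
Qed.

Lemma dir_slice (b : option J -> C) (f : V * R -> C) z t : b None = 0 -> I t ->
  dir tmv D b f (z, t) = dir smv U (fun j => b (Some j)) (fun w => f (w, t)) z.
Proof.
move=> b0 It; rewrite /dir big_option b0 mul0r add0r -[in RHS](slice_cyl It).
by apply: eq_bigr.
Qed.

Lemma dir_slice2 (b c : option J -> C) (f : V * R -> C) z t :
  b None = 0 -> c None = 0 -> I t -> dir tmv D b (dir tmv D c f) (z, t) =
  dir smv U (fun j => b (Some j)) (dir smv U (fun j => c (Some j)) (fun w => f (w, t))) z.
Proof.
move=> b0 c0 It; rewrite dir_slice //; congr (dir _ _ _ _ _); apply/funext => w.
exact: dir_slice.
Qed.

Lemma within_continuous_slice f t : I t -> {within D, continuous f} ->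
  {within U, continuous (fun z => f (z, t) : C)}.
Proof.
move=> It /within_continuousP cf; apply/within_continuousP => z Uz.
have h := cf (z, t) (conj Uz It).
apply: (cvg_comp (pair^~ t) f _ h) => A [[B1 B2] /= [n1 n2] BA].
rewrite /within /= in BA *; apply: filterS n1 => w B1w Uw; apply: (BA (w, t)) => //.
by split=> //=; exact: nbhs_singleton n2.
Qed.

Lemma Ck_slice k f t : I t -> Ck tmv D k f -> Ck smv U k (fun z => f (z, t)).
Proof.
move=> It; elim: k f => [|k ih] f [cf hf]; split.
- exact: within_continuous_slice cf.
- exact: Logic.I.
- exact: within_continuous_slice cf.
move=> j; have [h1 h2] := hf (Some j).
have := ih _ h2; have : forall z, D (z, t) -> has_partial tmv D (Some j) f (z, t).
  by move=> z; exact: h1.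
rewrite -(slice_cyl It) => h3 h4; split; first exact: h3.
exact: h4.
Qed.

Lemma smooth_slice f t : I t -> smooth tmv D f -> smooth smv U (fun z => f (z, t)).
Proof. by move=> It sf k; exact: (Ck_slice It (sf k)). Qed.

(** Needed to view the metric, which does not depend on time, as a function on space-time. *)
Lemma Ck_pullback k f : Ck smv U k f -> Ck tmv D k (fun y => f y.1).
Proof.
elim: k f => [|k ih] f hf.
  split; last exact: Logic.I.
  have [/within_continuousP cf _] := hf; apply/within_continuousP => -[z t] [/= Uz It].
  apply: (cvg_comp fst f _ (cf z Uz)) => A nA.
  exists (fun w => U w -> A w, setT) => /=; first by split; [exact: nA | exact: filterT].
  by move=> [w s] /= [Aw _] [/= Uw _]; exact: Aw.
apply: (CkS cyl_step_proper (df := fun j y => if j is Some j' then partial smv U j' f y.1 else 0)).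
- have [/within_continuousP cf _] := hf; apply/within_continuousP => -[z t] [/= Uz It].
  apply: (cvg_comp fst f _ (cf z Uz)) => A nA.
  exists (fun w => U w -> A w, setT) => /=; first by split; [exact: nA | exact: filterT].
  by move=> [w s] /= [Aw _] [/= Uw _]; exact: Aw.
- case=> [j|] [z t] [/= Uz It]; last first.
    apply: (near_cvg (cvg_cst 0)); apply: nearW => h.
    by rewrite diff_quotientE /= subrr mul0r.
  have := Ck_partial j hf Uz; rewrite -(slice_cyl It); exact.
- case=> [j|]; first exact: ih (Ck_pd j hf).
  exact: (Ck_cst cyl_step_proper).
Qed.

Lemma smooth_pullback f : smooth smv U f -> smooth tmv D (fun y => f y.1).
Proof. by move=> sf k; exact: Ck_pullback. Qed.

Lemma dir_pullback (b : option J -> C) f y : b None = 0 -> D y ->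
  dir tmv D b (fun y => f y.1) y = dir smv U (fun j => b (Some j)) f y.1.
Proof. by case: y => z t b0 [/= Uz It]; rewrite dir_slice. Qed.

Hypothesis oI : open I.

Lemma open_cyl : open D.
Proof.
rewrite openE => -[z t] [/= Uz It]; exists (U, I) => //=.
by split; [exact: (@open_nbhs_nbhs V) | exact: (@open_nbhs_nbhs R)].
Qed.

End Cylinders.

(** * Calculus in a chart *)

Section SmoothInverse.
Context (R : realType) (E : topologicalType) (J : finType).
Variables (move : J -> R -> E -> E) (D : set E).
Local Notation C := (Cplx R).
Hypothesis sp : forall j x, D x -> ProperFilter (step_filter move D j x).

Lemma smooth_det p (M : E -> 'M[C]_p) : smooth_mx move D M ->
  smooth move D (fun y => \det (M y)).
Proof.
move=> sM; apply: (smooth_sum sp) => s; apply: (smoothM sp); first exact: (smooth_cst sp).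
by apply: (smooth_prod sp) => i; exact: sM.
Qed.

Lemma smooth_invmx p (M : E -> 'M[C]_p) : smooth_mx move D M ->
  (forall y, D y -> M y \in unitmx) -> smooth_mx move D (fun y => invmx (M y)).
Proof.
move=> sM uM i j.
have d0 y : D y -> \det (M y) != 0 by move=> /uM; rewrite unitmxE unitfE.
have sc : smooth move D (fun y => cofactor (M y) j i).
  apply: (smoothM sp); first exact: (smooth_cst sp).
  apply: smooth_det => k l; apply: (smooth_ext sp _ (sM (lift j k) (lift i l))) => y _.
  by rewrite !mxE.
apply: (smooth_ext sp _ (smoothM sp (smoothV sp d0 (smooth_det sM)) sc)) => y Dy.
by rewrite /invmx (uM y Dy) !mxE.
Qed.

End SmoothInverse.

Lemma big_pair_bool (V : nmodType) (I : finType) (F : I * bool -> V) k :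
  (forall j, j.1 != k -> F j = 0) -> \sum_j F j = F (k, false) + F (k, true).
Proof.
move=> F0; rewrite (bigD1 (k, false)) //=; congr (_ + _).
rewrite (bigD1 (k, true)) ?xpair_eqE ?andbF //= -[RHS]addr0; congr (_ + _); apply: big1 => -[i b].
move=> /andP[h1 h2]; apply: F0; apply: contraNN h2 => /= /eqP ik.
by case: b h1; rewrite ik // eqxx.
Qed.

Section SpaceCalculus.
Context (R : realType) (n : nat).
Local Notation C := (Cplx R).
Local Notation V := 'rV[C]_n.
Local Notation J := ('I_n * bool)%type.
Local Notation smv := (@space_move R n).
Local Open Scope sesquilinear_scope.

Lemma d_dir k (f : V -> C) z : d_ k f z = dir smv setT (dz R k) f z.
Proof.
rewrite /dir (big_pair_bool (k := k)) => [|j /negbTE jk]; last by rewrite /dz jk mul0r.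
by rewrite /dz /= eqxx /d_ mulrBr mulNr mulrA [2^-1 * 'i]mulrC.
Qed.

Lemma dbar_dir k (f : V -> C) z : dbar_ k f z = dir smv setT (dzb R k) f z.
Proof.
rewrite /dir (big_pair_bool (k := k)) => [|j /negbTE jk].
  rewrite /dzb /dz /= eqxx /dbar_ mulrDr mulrA [2^-1 * 'i]mulrC.
  by rewrite rmorphN rmorphM /= conjCi half_toC toC_conj !mulNr opprK.
by rewrite /dzb /dz jk conjC0 mul0r.
Qed.

Variables (U : set V) (oU : open U).
Let sp := space_step_proper oU.
Let mv := space_move_action R n.

Lemma dir_setT b (f : V -> C) z : U z -> dir smv setT b f z = dir smv U b f z.
Proof. by move=> Uz; rewrite (dir_open_subset mv oU (@subsetT _ U)). Qed.

Lemma complex_hessianE f i j z : U z ->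
  complex_hessian f i j z = dir smv U (dz R i) (dir smv U (dzb R j) f) z.
Proof.
move=> Uz; rewrite /complex_hessian d_dir dir_setT //; apply: (dir_near mv oU) => // y Uy.
by rewrite dbar_dir dir_setT.
Qed.

(** The Christoffel symbols are the entries of A H, with A the derivative of G and H its inverse.
    The product rule and the derivative of H give the formula after multiplication by G. *)
Lemma curvatureE (G : V -> 'M[C]_n) i j k l z :
  smooth_mx smv U G -> (forall y, U y -> G y \in unitmx) -> U z ->
  curvature G i j k l z =
  (mxd smv U (dz R k) G z *m invmx (G z) *m mxd smv U (dzb R l) G z
   - mxd smv U (dzb R l) (mxd smv U (dz R k) G) z) i j.
Proof.
move=> sG uG Uz; pose H y := invmx (G y); pose A := mxd smv U (dz R k) G.
have sH : smooth_mx smv U H by exact: (smooth_invmx sp).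
have HG y : U y -> H y *m G y = 1%:M by move=> Uy; rewrite mulVmx // uG.
have sA : smooth_mx smv U A by exact: (smooth_mxd sp).
have chE p y : U y -> christoffel G p i k y = (A y *m H y) i p.
  move=> Uy; rewrite /christoffel mxE; apply: eq_bigr => q _.
  by rewrite mulrC d_dir dir_setT // mxdE.
have dE p : dbar_ l (christoffel G p i k) z = mxd smv U (dzb R l) (fun y => A y *m H y) z i p.
  by rewrite dbar_dir dir_setT // mxdE; apply: (dir_near mv oU) => // y; exact: chE.
rewrite /curvature.
transitivity (- (mxd smv U (dzb R l) (fun y => A y *m H y) z *m G z) i j).
  by rewrite mxE; congr (- _); apply: eq_bigr => p _; rewrite dE mulrC.
rewrite (mxdM sp _ sA sH Uz) (mxd_inverse sp sG sH HG _ Uz) mulmxDl mulmxN mulNmx.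
rewrite -!mulmxA HG // !mulmx1 !mulmxA -/A.
have eD (X Y : 'M[C]_n) : - (X - Y) i j = (Y - X) i j by rewrite -[Y - X]opprB [RHS]mxE.
exact: eD.
Qed.

(** The direction w of differentiation is one of the two vectors of the bisectional curvature, and
    the argument v of the form is the other. In this shape the curvature enters the evolution
    inequality. *)
Lemma curvature_form (G : V -> 'M[C]_n) z : smooth_mx smv U G ->
  (forall y, U y -> G y \in unitmx) -> U z ->
  (forall v w : V, 0 <= \sum_i \sum_j \sum_k \sum_l curvature G i j k l z
    * v 0 i * (v 0 j)^* * w 0 k * (w 0 l)^*) ->
  forall v w : V, 0 <= hform (mxd smv U (dv w) G z *m invmx (G z) *m mxd smv U (dvb w) G z
   - mxd smv U (dv w) (mxd smv U (dvb w) G) z) v.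
Proof.
move=> sG uG Uz R0 v w.
set X := (X in hform X v); have -> : hform X v = \sum_i \sum_j \sum_k \sum_l
    curvature G i j k l z * v 0 i * (v 0 j)^* * w 0 k * (w 0 l)^*; last exact: R0.
rewrite hformE; apply: eq_bigr => i _; apply: eq_bigr => j _.
have -> : X i j = \sum_k \sum_l curvature G i j k l z * w 0 k * (w 0 l)^*.
  have XE : mxd smv U (dv w) G z = \sum_k w 0 k *: mxd smv U (dz R k) G z.
    apply/matrixP => a b; rewrite mxdE dir_dv summxE; apply: eq_bigr => k _.
    by rewrite [RHS]mxE mxdE.
  have YE : mxd smv U (dvb w) G z = \sum_l (w 0 l)^* *: mxd smv U (dzb R l) G z.
    apply/matrixP => a b; rewrite mxdE dir_dvb summxE; apply: eq_bigr => k _.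
    by rewrite [RHS]mxE mxdE.
  have ZE : mxd smv U (dv w) (mxd smv U (dvb w) G) z =
      \sum_k \sum_l (w 0 k * (w 0 l)^*) *: mxd smv U (dzb R l) (mxd smv U (dz R k) G) z.
    apply/matrixP => a b; rewrite mxdE.
    rewrite -(dir_ext sp _ (f := dir smv U (dvb w) (fun y => G y a b))) //; last first.
    - exact: (smooth_dir sp).
    - by move=> y _; rewrite mxdE.
    rewrite (dv_dvb oU) // summxE; apply: eq_bigr => k _; rewrite summxE.
    apply: eq_bigr => l _; rewrite [RHS]mxE mxdE (dirC sp _ _ mv oU) // -mulrA mulrC.
    congr (_ * _); apply: (dir_ext sp) => [y Uy||//]; last exact: (smooth_dir sp).
    by rewrite mxdE.
  rewrite /X XE YE ZE mulmx_suml mulmx_suml -sumrB summxE; apply: eq_bigr => k _.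
  rewrite mulmx_sumr -sumrB summxE; apply: eq_bigr => l _.
  rewrite (curvatureE _ _ _ _ sG uG Uz) -!scalemxAl -scalemxAr scalerA -scalerBr [LHS]mxE.
  by rewrite -mulrA mulrC.
rewrite !mulr_suml; apply: eq_bigr => k _; rewrite !mulr_suml; apply: eq_bigr => l _.
by ring.
Qed.

Lemma is_partial_coord k j z :
  is_partial smv U j (fun y => y 0 k) z ((if j.2 then 'i else 1) * (k == j.1)%:R).
Proof.
apply: (near_cvg (cvg_cst _)); apply: filterS (step_neq0 _ _ _ _) => h h0.
rewrite diff_quotientE; apply: canRL (mulfK _) _; first by rewrite toC_eq0.
by rewrite space_moveE step_addE [RHS]addrC addKr mulrC.
Qed.

Lemma smooth_coord k : smooth smv U (fun y => y 0 k).
Proof.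
have c : {within U, continuous (fun y : V => y 0 k : C)}.
  by apply: continuous_subspaceT => z; exact: coord_continuous.
case=> [|m]; first by split.
apply: (CkS sp (df := fun j y => (if j.2 then 'i else 1) * (k == j.1)%:R) c).
  by move=> j z _; exact: is_partial_coord.
by move=> j; exact: (Ck_cst sp).
Qed.

Lemma dir_coord b k z : U z -> dir smv U b (fun y => y 0 k) z = b (k, false) + 'i * b (k, true).
Proof.
move=> Uz; rewrite /dir.
under eq_bigr => j _ do rewrite (is_partialE sp Uz (@is_partial_coord k j z)).
rewrite (big_pair_bool (k := k)) => [|j]; last by rewrite eq_sym => /negbTE ->; rewrite !mulr0.
by rewrite /= eqxx !mulr1 [in RHS]mulrC.
Qed.

Lemma dz_coord i k z : U z -> dir smv U (dz R i) (fun y => y 0 k) z = (i == k)%:R.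
Proof.
move=> Uz; rewrite dir_coord // /dz /= eq_sym; case: eqP => [_|_]; last by rewrite mulr0 addr0.
by rewrite mulrN mulrA -expr2 sqrCi mulN1r opprK -div1r -splitr.
Qed.

Lemma dzb_coord i k z : U z -> dir smv U (dzb R i) (fun y => y 0 k) z = 0.
Proof.
move=> Uz; rewrite dir_coord // /dzb /dz /= eq_sym; case: eqP => [_|_].
  rewrite rmorphN rmorphM /= conjCi half_toC toC_conj !mulNr opprK.
  by rewrite mulrA -expr2 sqrCi mulN1r subrr.
by rewrite conjC0 mulr0 addr0.
Qed.

Lemma quadratic_lower_first (r k : R) :
  (exists2 d, 0 < d & forall t, 0 < t -> t <= d -> 0 <= 2 * (t * r) + t ^+ 2 * k) -> 0 <= r.
Proof.
move=> [d d0 h]; rewrite leNgt; apply/negP => r0.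
pose t := Num.min d (- r / (`|k| + 1)).
have k1 : 0 < `|k| + 1 by rewrite ltr_wpDl.
have t0 : 0 < t by rewrite lt_min d0 divr_gt0 // oppr_gt0.
have td : t <= d by rewrite ge_min lexx.
have tk : t * (`|k| + 1) <= - r by rewrite -ler_pdivlMr // ge_min lexx orbT.
have kk : k <= `|k| by exact: ler_norm.
have := h t t0 td; apply/negP; rewrite -ltNge; nra.
Qed.

(** * First- and second-order conditions at an interior minimum *)

Section Minimum.
Variables (f : V -> C) (z0 : V).
Hypotheses (sf : smooth smv U f) (rf : forall y, U y -> (f y)^* = f y).
Hypotheses (Uz0 : U z0) (min_f : forall y, U y -> re (f z0) <= re (f y)).

Let taylor_min v (e : R) : 0 < e -> exists2 d : R, 0 < d & forall t : R, 0 < t -> t <= d ->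
  0 <= 2 * (t * re (dir smv U (dv v) f z0))
    + t ^+ 2 * (re (dir smv U (dv v) (dir smv U (dv v) f) z0)
                + re (dir smv U (dv v) (dir smv U (dvb v) f) z0) + e).
Proof.
move=> e0; have [N N0 vN] := in_box_exists v.
have e'0 : 0 < e / N ^+ 2 by rewrite divr_gt0 // exprn_gt0.
have [d d0 hd] := taylor2_re oU sf rf Uz0 e'0.
have [d' d'0 hU] := (nbhs_box z0 U).1 (open_nbhs_nbhs (conj oU Uz0)).
exists (Num.min d d' / N) => [|t t0]; first by rewrite divr_gt0 // lt_min d0.
rewrite ler_pdivlMr // le_min => /andP[tNd tNd'].
have tv : in_box (t * N) (toC t *: v).
  by have := in_boxZ t vN; rewrite gtr0_norm.
have := hd (t * N) (toC t *: v) (mulr_ge0 (ltW t0) (ltW N0)) tNd tv.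
have := min_f (hU _ (in_boxW tNd' tv)).
have dvs g : dir smv U (dv (toC t *: v)) g = fun y => toC t * dir smv U (dv v) g y.
  apply/funext => y; rewrite -dir_coefZ; apply: dir_coef_ext => j; exact: dvZ.
have dvbs g : dir smv U (dvb (toC t *: v)) g = fun y => toC t * dir smv U (dvb v) g y.
  apply/funext => y; rewrite -dir_coefZ; apply: dir_coef_ext => j.
  by rewrite /dvb dvZ rmorphM /= toC_conj.
rewrite !dvs dvbs (dirZ sp _ _ (smooth_dir sp _ sf) Uz0) (dirZ sp _ _ (smooth_dir sp _ sf) Uz0).
rewrite !re_scale.
have -> : e / N ^+ 2 * (t * N) ^+ 2 = e * t ^+ 2 by field; rewrite gt_eqF.
by move=> h1; rewrite ler_norml => /andP[_ h2]; nra.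
Qed.

Let first_ge0 v : 0 <= re (dir smv U (dv v) f z0).
Proof. by have [d d0 hd] := taylor_min v ltr01; apply: quadratic_lower_first; exists d; last exact: hd. Qed.

Let dvZ_fun c v g : dir smv U (dv (c *: v)) g = fun y => c * dir smv U (dv v) g y.
Proof. by apply/funext => y; rewrite -dir_coefZ; apply: dir_coef_ext => j; exact: dvZ. Qed.

Let dvbZ_fun c v g : dir smv U (dvb (c *: v)) g = fun y => c^* * dir smv U (dvb v) g y.
Proof.
apply/funext => y; rewrite -dir_coefZ; apply: dir_coef_ext => j.
by rewrite /dvb dvZ rmorphM.
Qed.

(** The real part of the derivative is nonnegative along v, -v, i v and -i v. *)
Lemma min_dv0 v : dir smv U (dv v) f z0 = 0.
Proof.
have h c := first_ge0 (c *: v).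
have r1 := h 1; have r2 := h (-1); have r3 := h 'i; have r4 := h (- 'i).
rewrite dvZ_fun /= in r1; rewrite dvZ_fun /= in r2.
rewrite dvZ_fun /= in r3; rewrite dvZ_fun /= in r4.
move: (dir _ _ _ _ _) r1 r2 r3 r4 => w.
rewrite mul1r mulN1r mulNr !reN reM re_i im_i mul0r mul1r sub0r => r1 r2 r3 r4.
by apply: eqC; rewrite -toC0 ?re_toC ?im_toC; apply/eqP; rewrite eq_le; apply/andP; split; lra.
Qed.

Lemma min_dvb0 v : dir smv U (dvb v) f z0 = 0.
Proof.
have := congr1 Num.conj (min_dv0 v); rewrite conjC0 => <-.
rewrite -(dir_ext sp _ rf (smooth_conj sp sf) Uz0) (dir_conj sp) //.
by congr (_^*); apply: dir_coef_ext => j; rewrite /dvb conjCK.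
Qed.

(** Replacing v by i v changes the sign of the pure second derivative and keeps the Levi form.
    Adding the two expansions isolates the Levi form. *)
Lemma min_hess_ge0 v : 0 <= hform (hess smv U (@dz R n) f z0) v.
Proof.
have fin (p q : R) : p < 0 -> 0 <= - q + p + - p / 2 -> 0 <= q + p + - p / 2 -> False by lra.
have hS := adj_hess sp mv oU (@dz R n) sf rf Uz0.
have rS := hform_real v hS.
rewrite (real_toC rS) -toC0 toC_le -(dir_dir_hess sp (@dz R n) sf v Uz0).
have eav : dir smv U (av (@dz R n) v) (dir smv U (avb (@dz R n) v) f) z0 =
    dir smv U (dv v) (dir smv U (dvb v) f) z0 by [].
rewrite eav; rewrite leNgt; apply/negP => neg.
(* Half of the supposed negative Levi form in absolute value, so that the sum of the two
   inequalities stays contradictory. *)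
pose e := - re (dir smv U (dv v) (dir smv U (dvb v) f) z0) / 2.
have e0 : 0 < e by rewrite divr_gt0 // oppr_gt0; exact: neg.
have [d d0 hd] := taylor_min v e0; have [d' d'0 hd'] := taylor_min ('i *: v) e0.
pose t := Num.min d d'; have t0 : 0 < t by rewrite lt_min d0.
have := hd t t0; rewrite ge_min lexx => /(_ isT).
have := hd' t t0; rewrite ge_min lexx orbT => /(_ isT).
rewrite !min_dv0 !dvZ_fun dvbZ_fun /=.
rewrite (dirZ sp _ _ (smooth_dir sp _ sf) Uz0) (dirZ sp _ _ (smooth_dir sp _ sf) Uz0).
rewrite !mulrA conjCi mulrN -expr2 sqrCi mulN1r opprK mul1r reN.
rewrite -toC0 re_toC /e mulr0 !add0r; rewrite !(pmulr_rge0 _ (exprn_gt0 2 t0)).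
exact: fin neg.
Qed.

End Minimum.
End SpaceCalculus.

(** * Exclusion of a first null vector *)

Lemma left_quotient_le0 (R : realType) (q : R -> R) (t l : R) :
  (fun s => (q (t + s) - q t) / s) @ (0 : R)^' --> l ->
  (\forall s \near (0 : R)^', s < 0 -> q t <= q (t + s)) -> l <= 0.
Proof.
move=> /cvgrPdist_lt ql qt; rewrite leNgt; apply/negP => l0.
have [d /= d0 hd] : \forall s \near (0 : R)^', s < 0 ->
    `|l - (q (t + s) - q t) / s| < l /\ q t <= q (t + s).
  by apply: filterS2 (ql l l0) qt => s h1 h2 s0; split=> //; exact: h2.
have s0 : - (d / 2) < 0 by rewrite oppr_lt0 divr_gt0.
have bd : ball_ Num.Def.normr 0 d (- (d / 2)).
  by rewrite /= sub0r opprK ger0_norm ?divr_ge0 ?ltW //; lra.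
have [] := hd (- (d / 2)) bd (negbT (lt_eqF s0)) s0.
move=> h1 h2; have : (q (t + - (d / 2)) - q t) / - (d / 2) <= 0.
  by rewrite ler_ndivrMr // mul0r subr_ge0.
by move: h1; rewrite ltr_norml => /andP[_]; lra.
Qed.

Section LocalContradiction.
Context (R : realType) (n : nat).
Local Notation C := (Cplx R).
Local Notation V := 'rV[C]_n.
Local Notation J := ('I_n * bool)%type.
Local Notation smv := (@space_move R n).
Local Notation tmv := (@spacetime_move R n).
Local Open Scope sesquilinear_scope.

Definition time_lift (b : J -> C) : option J -> C := fun j => if j is Some j' then b j' else 0.
Definition dzt (k : 'I_n) : option J -> C := time_lift (dz R k).
Definition dt : option J -> C := fun j => (j == None)%:R.

Lemma dir_dt (D : set (V * R)) f x : dir tmv D dt f x = partial tmv D None f x.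
Proof. by rewrite pd_coef. Qed.

Lemma dv_delta k : @dv R n (delta_mx 0 k) =1 dz R k.
Proof.
move=> j; rewrite /dv (bigD1 k) //= !mxE !eqxx mul1r big1 ?addr0 // => i /negbTE ik.
by rewrite !mxE ik andbF mul0r.
Qed.

Lemma open_interval_step (I : set R) t : open I -> I t ->
  ProperFilter (within [set h | I (t + h)] (0 : R)^').
Proof.
move=> oI It; have [d /= d0 hd] := open_nbhs_nbhs (conj oI It).
rewrite (_ : within _ _ = (0 : R)^'); first exact: Proper_dnbhs_numFieldType.
have dI : \forall h \near (0 : R)^', I (t + h).
  exists d => // h /=; rewrite sub0r normrN => hd' _; apply: hd.
  by rewrite /ball /= opprD addrA subrr sub0r normrN.
apply/seteqP; split => A hA; last by apply: filterS hA => h.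
by apply: filterS2 dI hA => h h1; apply.
Qed.

Variables (U : set V) (I : set R).
Hypotheses (oU : open U) (oI : open I).
Local Notation D := (cyl U I).
Let I_step t := @open_interval_step I t oI.
Let sp := cyl_step_proper oU I_step.
Let spU := space_step_proper oU.
Let mvt := spacetime_move_action R n.
Let oD := open_cyl oU oI.

Lemma mxd_pullback p q b (M : V -> 'M[C]_(p, q)) y : b None = 0 -> D y ->
  mxd tmv D b (fun y => M y.1) y = mxd smv U (fun j => b (Some j)) M y.1.
Proof. by move=> b0 Dy; apply/matrixP => i j; rewrite !mxdE (dir_pullback (fun w => M w i j) b0 Dy). Qed.

Variables (f : V * R -> C) (G : V -> 'M[C]_n) (al : R) (psi : R -> R) (dpsi : R).
Hypotheses (sf : smooth tmv D f) (rf : forall y, D y -> (f y)^* = f y).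
Hypotheses (sG : smooth_mx smv U G) (pG : forall z, U z -> hermitian_posdef (G z)).
Hypothesis kG : forall i j k z, U z ->
  dir smv U (dz R k) (fun w => G w i j) z = dir smv U (dz R i) (fun w => G w k j) z.
Hypothesis curvG : forall z, U z -> forall v w,
  0 <= hform (mxd smv U (dv w) G z *m invmx (G z) *m mxd smv U (dvb w) G z
    - mxd smv U (dv w) (mxd smv U (dvb w) G) z) v.
Hypothesis eq_f : forall y, D y -> dir tmv D dt f y =
  \tr (invmx (G y.1) *m hess tmv D dzt f y)
  + (gradzb tmv D dzt f y *m invmx (G y.1) *m gradz tmv D dzt f y) 0 0 + toC al * f y.
Variables (z0 : V) (t0 : R) (v : V).
Hypotheses (Uz0 : U z0) (It0 : I t0) (v0 : v != 0).
Let P (y : V * R) := hess tmv D dzt f y + toC (psi y.2) *: G y.1.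
Hypothesis P_null : hform (P (z0, t0)) v = 0.
Hypothesis P_ge0 : forall z w, U z -> 0 <= hform (P (z, t0)) w.
Hypothesis P_past : \forall s \near (0 : R)^', s < 0 -> 0 <= hform (P (z0, t0 + s)) v.
Hypothesis psi_d : is_derive t0 1 psi dpsi.
Hypothesis psi_supersolution : 0 < dpsi + psi t0 ^+ 2 - al * psi t0.

Let Gt (y : V * R) := G y.1.
Let Ht (y : V * R) := invmx (G y.1).
Let x0 : V * R := (z0, t0).
Let Dx0 : D x0. Proof. by split. Qed.

Let adjG z : U z -> (G z) ^t* = G z.
Proof. by move=> /pG/hermitian_posdefP[]. Qed.

Let uG z : U z -> G z \in unitmx.
Proof. by move=> /pG/hermitian_posdefP[_ ?]; exact: posdef_unitmx. Qed.

Let sGt : smooth_mx tmv D Gt.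
Proof. by move=> i j; exact: (smooth_pullback oU I_step (sG i j)). Qed.

Let sHt : smooth_mx tmv D Ht.
Proof. by apply: (smooth_invmx sp sGt) => y [Uy _]; exact: uG. Qed.

Let conj_dzt_None k : (dzt k None)^* = 0. Proof. exact: conjC0. Qed.

Let ktG : kahler_type tmv D dzt Gt.
Proof.
split=> // y Dy i j k; have [Uy _] := Dy; split.
  rewrite (dir_pullback (fun w => G w i j) (erefl : dzt k None = 0) Dy).
  by rewrite (dir_pullback (fun w => G w k j) (erefl : dzt i None = 0) Dy); exact: kG.
rewrite (dir_pullback (fun w => G w i j) (conj_dzt_None k) Dy).
rewrite (dir_pullback (fun w => G w i k) (conj_dzt_None j) Dy).
have h a b c : dir smv U (dzb R c) (fun w => G w a b) y.1 =
    (dir smv U (dz R c) (fun w => G w b a) y.1)^*.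
  rewrite (dir_ext spU _ (g := fun w => (G w b a)^*) _ (sG a b) Uy).
    by rewrite (dir_conj spU) //; congr (_^*); apply: dir_coef_ext => j'; rewrite conjCK.
  by move=> w Uw; rewrite -{1}(adjG Uw) !mxE.
by rewrite !h kG.
Qed.

Let av_None : av dzt v None = 0.
Proof. by rewrite /av big1 // => k _; rewrite mulr0. Qed.

Let avb_None : avb dzt v None = 0.
Proof. by rewrite /avb av_None conjC0. Qed.

Let A := mxd tmv D (av dzt v) Gt x0.
Let A_eq : A = mxd smv U (dv v) G z0.
Proof. exact: (mxd_pullback G av_None Dx0). Qed.
Let B_eq : mxd tmv D (avb dzt v) Gt x0 = mxd smv U (dvb v) G z0.
Proof. exact: (mxd_pullback G avb_None Dx0). Qed.
Let K_eq : mxd tmv D (av dzt v) (mxd tmv D (avb dzt v) Gt) x0 =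
  mxd smv U (dv v) (mxd smv U (dvb v) G) z0.
Proof.
rewrite (mxd_ext sp _ (fun y Dy => mxd_pullback G avb_None Dy)) //; last exact: (smooth_mxd sp).
exact: (mxd_pullback (mxd smv U (dvb v) G) av_None Dx0).
Qed.

(** Affine in z, hence holomorphic, and constant in time. Its slope is minus the connection
    contracted with v, so its covariant derivative vanishes at z0. *)
Let nu (y : V * R) : V := v - (y.1 - z0) *m (A *m Ht x0).

Let s1 : smooth_mx tmv D (fun y => y.1).
Proof. by move=> i j; rewrite (ord1 i); exact: (smooth_pullback oU I_step (smooth_coord oU j)). Qed.

Let s2 : smooth_mx tmv D (fun y => y.1 - z0).
Proof. exact: (smooth_mxD sp s1 (smooth_mx_cst sp _)). Qed.

Let s3 : smooth_mx tmv D (fun y => (y.1 - z0) *m (A *m Ht x0)).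
Proof. exact: (smooth_mxM sp s2 (smooth_mx_cst sp _)). Qed.

Let snu : smooth_mx tmv D nu.
Proof. exact: (smooth_mxD sp (smooth_mx_cst sp _) (smooth_mxN sp s3)). Qed.

Let mxd_nu b y : D y -> mxd tmv D b nu y = - (mxd tmv D b (fun y => y.1) y *m (A *m Ht x0)).
Proof.
move=> Dy; rewrite (mxdD sp b (smooth_mx_cst sp v) (smooth_mxN sp s3) Dy) (mxd_cst sp) // add0r.
rewrite (mxdN sp b s3 Dy) (mxdM sp b s2 (smooth_mx_cst sp _) Dy) (mxd_cst sp) // mulmx0 addr0.
congr (- (_ *m _)); rewrite -[RHS]addr0 -(mxd_cst sp b (- z0) Dy).
exact: (mxdD sp b s1 (smooth_mx_cst sp (- z0)) Dy).
Qed.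

Let nu_bar k y : D y -> mxd tmv D (fun j => (dzt k j)^*) nu y = 0.
Proof.
move=> Dy; rewrite mxd_nu // (_ : mxd _ _ _ _ _ = 0) ?mul0mx ?oppr0 //.
apply/rowP => j; rewrite mxdE mxE (dir_pullback (fun w => w 0 j) (conj_dzt_None k) Dy).
by have [Uy _] := Dy; exact: (dzb_coord oU).
Qed.

Let nu_d k y : D y -> mxd tmv D (dzt k) nu y = - row k (A *m Ht x0).
Proof.
move=> Dy; rewrite mxd_nu // rowE (_ : mxd _ _ _ _ _ = delta_mx 0 k) //.
apply/rowP => j; rewrite mxdE [RHS]mxE eqxx /=.
rewrite (dir_pullback (fun w => w 0 j) (erefl : dzt k None = 0) Dy) eq_sym.
by have [Uy _] := Dy; exact: (dz_coord oU).
Qed.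

(** The barrier is frozen at its value at t0. This changes nothing on the slice t = t0, where the
    minimum is taken; the motion of the barrier enters through [time_derivative]. *)
Let Pt (y : V * R) := hess tmv D dzt f y + toC (psi t0) *: Gt y.
Let F y := (nu y *m Pt y *m (nu y) ^t*) 0 0.
Let phi z := F (z, t0).

Let sP : smooth_mx tmv D Pt.
Proof. exact: (smooth_mxD sp (smooth_hess sp dzt sf) (smooth_mxZ sp _ sGt)). Qed.

Let sF : smooth tmv D F.
Proof. exact: (smooth_mxM sp (smooth_mxM sp snu sP) (smooth_mx_adj sp snu)). Qed.

Let sphi : smooth smv U phi.
Proof. exact: (smooth_slice It0 sF). Qed.

Let adj_hess_add c y : D y ->
  (hess tmv D dzt f y + toC c *: Gt y) ^t* = hess tmv D dzt f y + toC c *: Gt y.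
Proof.
move=> Dy; have [Uy _] := Dy.
by apply: hermitian_addZ; [exact: (adj_hess sp mvt oD dzt sf rf Dy) | exact: adjG Uy].
Qed.

Let adjP y : D y -> (Pt y) ^t* = Pt y.
Proof. exact: adj_hess_add. Qed.

Let rphi z : U z -> (phi z)^* = phi z.
Proof. by move=> Uz; apply: hform_real; apply: adjP; split. Qed.

Let phi_ge0 z : U z -> 0 <= phi z.
Proof. by move=> Uz; exact: (P_ge0 (nu (z, t0)) Uz). Qed.

Let nu0 : nu x0 = v.
Proof. by rewrite /nu subrr mul0mx subr0. Qed.

Let phi0 : phi z0 = 0.
Proof. by rewrite /phi /F nu0; exact: P_null. Qed.

Let min_phi z : U z -> re (phi z0) <= re (phi z).
Proof.
move=> Uz; rewrite phi0 -toC0 re_toC -toC_le -(real_toC (rphi Uz)) toC0.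
exact: phi_ge0.
Qed.

Let F_d k : dir tmv D (dzt k) F x0 = 0.
Proof.
rewrite (dir_slice U F z0 (erefl : dzt k None = 0) It0).
rewrite -(min_dv0 oU sphi rphi Uz0 min_phi (delta_mx 0 k)).
by apply: dir_coef_ext => j; rewrite dv_delta.
Qed.

Let F_db k : dir tmv D (fun j => (dzt k j)^*) F x0 = 0.
Proof.
rewrite (dir_slice U F z0 (conj_dzt_None k) It0).
rewrite -(min_dvb0 oU sphi rphi Uz0 min_phi (delta_mx 0 k)).
by apply: dir_coef_ext => j; rewrite /dvb dv_delta.
Qed.

Let posdef_ge0 (S : 'M[C]_n) w : hermitian_posdef S -> 0 <= hform S w.
Proof.
move=> /hermitian_posdefP[_ pS]; have [->|w0] := eqVneq w 0; last exact: ltW (pS w w0).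
by rewrite /hform !mul0mx mxE.
Qed.

Let H_ge0 w : 0 <= hform (Ht x0) w.
Proof.
apply: invmx_psd; [exact: uG Uz0 | exact: adjG Uz0 | move=> u].
exact: posdef_ge0 (pG Uz0).
Qed.

Let adjH : (Ht x0) ^t* = Ht x0.
Proof. by apply: adj_invmx; [exact: uG Uz0 | exact: adjG Uz0]. Qed.

Let trace_ge0 : 0 <= \tr (Ht x0 *m
  \matrix_(k, l) dir tmv D (dzt k) (dir tmv D (fun j => (dzt l j)^*) F) x0).
Proof.
have -> : \matrix_(k, l) dir tmv D (dzt k) (dir tmv D (fun j => (dzt l j)^*) F) x0 =
    hess smv U (@dz R n) phi z0.
  apply/matrixP => k l; rewrite !mxE.
  exact: (dir_slice2 U F z0 (erefl : dzt k None = 0) (conj_dzt_None l) It0).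
rewrite mxtrace_mulC; apply: trace_psd_ge0 => // w.
exact: (min_hess_ge0 oU sphi rphi Uz0 min_phi).
Qed.

Let gam := re (hform (G z0) v).
Let gam_gt0 : 0 < gam.
Proof.
have [hG pG0] := (hermitian_posdefP _).1 (pG Uz0).
by have := pG0 v v0; rewrite (real_toC (hform_real v hG)) -toC0 toC_lt.
Qed.

(** With v and z0 fixed, P(v, v-bar) is nonnegative before t0 and zero at t0, so its time derivative
    is at most 0. Commuting derivatives moves d/dt next to f, where the equation can be used. *)
Let time_derivative : re (dir tmv D (av dzt v) (dir tmv D (avb dzt v) (dir tmv D dt f)) x0)
  + dpsi * gam <= 0.
Proof.
have qid (a b c d s g : R) : (a - b) / s + (c - d) / s * g = (a + c * g - (b + d * g)) / s.
  by rewrite [_ / s * g]mulrAC -mulrDl; congr (_ / _); ring.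
pose h y := hform (hess tmv D dzt f y) v.
have sh : smooth tmv D h.
  have sv := smooth_mx_cst sp v; have sv' := smooth_mx_cst sp (v ^t*).
  exact: (smooth_mxM sp (smooth_mxM sp sv (smooth_hess sp dzt sf)) sv').
have -> : dir tmv D (av dzt v) (dir tmv D (avb dzt v) (dir tmv D dt f)) x0 =
    partial tmv D None h x0.
  rewrite -dir_dt.
  have sav := smooth_dir sp (avb dzt v) sf.
  rewrite -(dir_ext sp dt (fun y Dy => dir_dir_hess sp dzt sf v Dy) (smooth_dir sp _ sav) Dx0).
  rewrite (dirC sp dt _ mvt oD sav Dx0).
  apply: (dir_ext sp) => [y Dy||//]; last by do 2 apply: (smooth_dir sp).
  exact: (dirC sp _ _ mvt oD sf Dy).
have : is_partial tmv D None h x0 (partial tmv D None h x0) by exact: (Ck_partial None (sh 1) Dx0).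
rewrite /is_partial (interior_step mvt None (open_nbhs_nbhs (conj oD Dx0))) => hd.
pose q t := re (h (z0, t)) + psi t * gam.
have qE t : D (z0, t) -> re (hform (P (z0, t)) v) = q t.
  move=> Dt; rewrite /q /P /= /h /hform mulmxDr mulmxDl [in LHS]mxE reD.
  by congr (_ + _); rewrite -scalemxAr -scalemxAl mxE re_scale.
apply: (@left_quotient_le0 _ q t0).
  have [pd1 pd2] := psi_d.
  have pd : (fun s => (psi (t0 + s) - psi t0) / s) @ (0 : R)^' --> dpsi.
    rewrite -pd2; apply: (near_cvg pd1); apply: nearW => s.
    by rewrite /= [_ *: 1]mulr1 [s + t0]addrC mulrC.
  apply: (near_cvg (cvgD (cvg_re hd) (cvgM pd (cvg_cst gam)))); apply: nearW => s.
  rewrite !fctE /= diff_quotientE /= /q mulrC -fmorphV re_scale mulrC reB.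
  exact: qid.
have n0 : \forall s \near (0 : R)^', D (z0, t0 + s).
  have := step_in tmv D None x0.
  by rewrite (interior_step mvt None (open_nbhs_nbhs (conj oD Dx0))).
apply: filterS2 n0 P_past => s Ds hs s0; rewrite -(qE t0 Dx0) -(qE (t0 + s) Ds).
by have := re_mono (hs s0); rewrite -{1}P_null.
Qed.

(** Combining [time_derivative], the nonnegative trace at the minimum and [evolution_inequality]
    would make (psi' + psi^2 - al psi) G(v, v-bar) at most 0. *)
Lemma no_interior_null_vector : False.
Proof.
have := evolution_inequality sp mvt oD sf rf ktG sHt (fun y Dy => adjG (proj1 Dy))
  (fun y Dy => mulVmx (uG (proj1 Dy))) adjH eq_f Dx0 snu nu0 nu_bar nu_d
  (adjP Dx0) (fun w => P_ge0 w Uz0) P_null F_d F_db.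
have RE : A *m Ht x0 *m mxd tmv D (avb dzt v) Gt x0
    - mxd tmv D (av dzt v) (mxd tmv D (avb dzt v) Gt) x0 =
    mxd smv U (dv v) G z0 *m invmx (G z0) *m mxd smv U (dvb v) G z0
    - mxd smv U (dv v) (mxd smv U (dvb v) G) z0.
  have congr4 (X1 X2 Y Z1 Z2 W1 W2 : 'M[C]_n) : X1 = X2 -> Z1 = Z2 -> W1 = W2 ->
      X1 *m Y *m Z1 - W1 = X2 *m Y *m Z2 - W2 by move=> -> -> ->.
  exact: congr4 A_eq B_eq K_eq.
have cR w : 0 <= hform (A *m Ht x0 *m mxd tmv D (avb dzt v) Gt x0
    - mxd tmv D (av dzt v) (mxd tmv D (avb dzt v) Gt) x0) w.
  by rewrite RE; exact: curvG.
move=> /(_ cR H_ge0).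
have [hG _] := (hermitian_posdefP _).1 (pG Uz0).
rewrite [hform (Gt x0) v](real_toC (hform_real v hG)) -/gam.
move: trace_ge0 time_derivative psi_supersolution gam_gt0.
set tr := \tr _; move: tr (dir _ _ _ _ _) => tr d tr0 d0 s0 g0.
rewrite subr_ge0 -rmorphXn -rmorphM -rmorphB -rmorphM.
move=> /re_mono; rewrite re_toC reB => h.
have := re_mono tr0; rewrite -toC0 re_toC => tr0'.
by have := mulr_gt0 s0 g0; nra.
Qed.
End LocalContradiction.

(** * The logarithm of the solution and the barrier *)

Section LogEquation.
Context (R : realType) (E : topologicalType) (J : finType).
Variables (move : J -> R -> E -> E) (D : set E).
Local Notation C := (Cplx R).
Local Notation drv := (dir move D).
Hypothesis sp : forall j x, D x -> ProperFilter (step_filter move D j x).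
Variables (n : nat) (a : 'I_n -> J -> C) (u : E -> R).
Let uC y := toC (u y).
Let f y := toC (ln (u y)).
Hypotheses (u0 : forall y, D y -> 0 < u y) (su : smooth move D uC).

Lemma hess_ln y : D y -> hess move D a f y =
  (uC y)^-1 *: hess move D a uC y - gradz move D a f y *m gradzb move D a f y.
Proof.
move=> Dy; apply/matrixP => k l; rewrite 3!mxE [X in _ + X]mxE [X in _ - X]mxE big_ord1 !mxE.
have uC0 x : D x -> uC x != 0 by move=> /u0 h; rewrite toC_eq0 gt_eqF.
have sf := smooth_ln sp u0 su; have sV := smoothV sp uC0 su.
have sl := smooth_dir sp (fun j => (a l j)^*) su.
have e x : D x -> (uC x)^-1 * drv (fun j => (a l j)^*) uC x = drv (fun j => (a l j)^*) f x.
  by move=> Dx; rewrite (dir_ln sp).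
rewrite -(dir_ext sp (a k) e (smoothM sp sV sl) Dy) (dirM sp _ sV sl Dy) (dirV sp _ uC0 su Dy).
rewrite -(e y Dy) (dir_ln sp (a k) u0 su Dy) -/uC; ring.
Qed.

(** After division by u, the rank-one term of [hess_ln] traced against the inverse metric is the
    gradient term. *)
Lemma log_equation (H : 'M[C]_n) (b : J -> C) (al : R) y : D y ->
  drv b uC y = \tr (H *m hess move D a uC y) + toC (al * u y * ln (u y)) ->
  drv b f y = \tr (H *m hess move D a f y)
    + (gradzb move D a f y *m H *m gradz move D a f y) 0 0 + toC al * f y.
Proof.
move=> Dy e; rewrite (dir_ln sp b u0 su Dy) e (hess_ln Dy) mulmxBr linearB /= -scalemxAr linearZ /=.
have -> : \tr (H *m (gradz move D a f y *m gradzb move D a f y)) =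
    (gradzb move D a f y *m H *m gradz move D a f y) 0 0.
  by rewrite mulmxA mxtrace_mulC mulmxA /mxtrace big_ord1.
have uy0 : toC (u y) != 0 by rewrite toC_eq0 gt_eqF // u0.
rewrite subrK mulrDr; congr (_ + _); rewrite !toCM mulrA mulrCA !mulrA.
by rewrite divfK.
Qed.

End LogEquation.

(** * The barrier and its differential inequality *)

Section Barrier.
Context (R : realType) (a : R).
Hypothesis a0 : a != 0.

(** The solution of eta' = 1 - a eta that vanishes at 0. It is increasing whatever the sign of a,
    and 1 / eta(t) is the coefficient in the theorem. *)
Definition eta (s : R) := (1 - expR (- (a * s))) / a.

Lemma eta0 : eta 0 = 0.
Proof. by rewrite /eta mulr0 oppr0 expR0 subrr mul0r. Qed.

Lemma eta_derive (s : R) : is_derive s (1 : R) eta (expR (- (a * s))).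
Proof.
have h1 : is_derive s (1 : R) ( *%R (- a)) (- a).
  by have := is_deriveZ (- a) (is_derive_id s (1 : R)); rewrite [_ *: 1]mulr1.
have h2 := @is_derive1_comp R expR _ s _ _ (is_derive_expR _) h1.
have h3 := is_deriveZ a^-1 (is_deriveB (is_derive_cst (1 : R) s (1 : R)) h2).
rewrite (_ : eta = a^-1 \*: (cst 1 - (expR \o *%R (- a)))); last first.
  apply/funext => t.
  rewrite (_ : (_ \*: _) t = a^-1 * (1 - expR (- a * t))) // mulNr.
  by rewrite /eta mulrC.
apply: (is_derive_eq h3); rewrite sub0r /GRing.scale /= !mulrN opprK.
by rewrite mulrCA mulVf // mulr1 mulNr.
Qed.

Lemma eta_continuous (s : R) : {for s, continuous eta}.
Proof. by apply: differentiable_continuous; apply/derivable1_diffP; case: (eta_derive s). Qed.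

Lemma eta_lt s t : s < t -> eta s < eta t.
Proof.
move=> st; have [a_lt0|a_gt0|/eqP] := ltgtP a 0; last by rewrite (negbTE a0).
  rewrite ltr_ndivrMr // divfK // ltrD2l ltrN2 ltr_expR ltrN2.
  by rewrite ltr_nM2l.
by rewrite ltr_pdivrMr // divfK // ltrD2l ltrN2 ltr_expR ltrN2 ltr_pM2l.
Qed.

Lemma eta_gt0 s : 0 < s -> 0 < eta s.
Proof. by move=> s0; rewrite -eta0 eta_lt. Qed.

Definition barrier (k s t : R) := k / eta (t + s).

Lemma barrier_derive (k s t : R) : 0 < t + s -> exists2 d, is_derive t (1 : R) (barrier k s) d &
  d + barrier k s t ^+ 2 - a * barrier k s t = k * (k - 1) / eta (t + s) ^+ 2.
Proof.
move=> ts.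
exists (- k * expR (- (a * (t + s))) / eta (t + s) ^+ 2).
  have en0 : (eta (t + s) != 0) by rewrite gt_eqF // eta_gt0.
  have h1 := @is_derive1_comp R eta (shift s) t _ _ (eta_derive (t + s)) (is_derive_shift t (1 : R) s).
  have h2 := is_deriveZ k (@is_deriveV R (eta \o shift s) t _ _ en0 h1).
  apply: (is_derive_eq h2); rewrite /GRing.scale /= mulr1; field; exact: en0.
have e0 := gt_eqF (eta_gt0 ts).
(* This is eta' = 1 - a eta; it makes the expression rational in eta. *)
have -> : expR (- (a * (t + s))) = 1 - a * eta (t + s).
  by rewrite /eta [in RHS]mulrC divfK // opprB [RHS]addrC subrK.
rewrite /barrier; field; by rewrite e0.
Qed.

End Barrier.

Lemma cvg_bigsum (R : realType) (T : Type) (F : set_system T) {FF : Filter F} (I : Type)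
    (r : seq I) (f : I -> T -> Cplx R) (l : I -> Cplx R) :
  (forall i, f i @ F --> l i) ->
  (fun t => \sum_(i <- r) f i t) @ F --> \sum_(i <- r) l i.
Proof.
move=> fl; elim: r => [|i r ih].
  rewrite big_nil; apply: (near_cvg (cvg_cst 0)); apply: nearW => t.
  by rewrite big_nil.
rewrite big_cons; apply: (near_cvg (cvgD (fl i) ih)); apply: nearW => t.
by rewrite big_cons.
Qed.

Lemma cvg_hform (R : realType) (T : Type) (F : set_system T) {FF : Filter F} n
    (S : T -> 'M[Cplx R]_n) (S0 : 'M[Cplx R]_n) v :
  (forall i j, (fun t => S t i j) @ F --> S0 i j) -> (fun t => hform (S t) v) @ F --> hform S0 v.
Proof.
move=> cS.
have h : (fun t => \sum_i \sum_j S t i j * v 0 i * (v 0 j)^*) @ F -->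
    \sum_i \sum_j S0 i j * v 0 i * (v 0 j)^*.
  apply: cvg_bigsum => i; apply: cvg_bigsum => j.
  by apply: cvgM; [apply: cvgM; [exact: cS | exact: cvg_cst] | exact: cvg_cst].
by rewrite hformE; apply: (near_cvg h); apply: nearW => t; rewrite hformE.
Qed.

Section PosdefNear.
Context (R : realType) (n : nat) (T : Type) (F : set_system T) (FF : Filter F).
Local Notation C := (Cplx R).
Local Open Scope sesquilinear_scope.

Lemma posdef_near (M : T -> 'M[C]_n) (M0 : 'M[C]_n) : hermitian_posdef M0 ->
  (forall i j, (fun y => M y i j) @ F --> M0 i j) -> (\forall y \near F, (M y) ^t* = M y) ->
  \forall y \near F, hermitian_posdef (M y).
Proof.
move=> pM0 cM hM; have [d d0 hd] := posdef_lower pM0.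
(* An entrywise change of size e moves the form by at most n e times the squared norm, and n e <
   d. *)
pose e := d / (n%:R + 1).
have n0 : 0 < n%:R + 1 :> R by rewrite ltr_wpDl.
have e0 : 0 < e by rewrite divr_gt0.
have near_all : \forall y \near F, forall i j, `|M y i j - M0 i j| <= toC e.
  apply: filter_forall => i; apply: filter_forall => j.
  have /cvgCP/(_ e e0) := cM i j; apply: filterS => y h.
  by rewrite distrC ltW.
apply: filterS2 hM near_all => y hy ey; apply/hermitian_posdefP; split=> // v v0.
have [h0 _] := (hermitian_posdefP _).1 pM0.
have -> : hform (M y) v = hform M0 v + hform (M y - M0) v.
  by rewrite -hformD addrC subrK.
have hd' : (M y - M0) ^t* = M y - M0 by rewrite linearB map_mxB /= hy h0.
have rD := real_toC (hform_real v hd').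
have up : `|hform (M y - M0) v| <= toC (n%:R * e) * sqnorm v.
  by apply: hform_upper => i j; rewrite !mxE; exact: ey.
have sq := sqnorm_gt0 v0.
have lt1 : toC (n%:R * e) * sqnorm v < toC d * sqnorm v.
  rewrite ltr_pM2r // toC_lt /e mulrCA gtr_pMr // ltr_pdivrMr // mul1r.
  by rewrite ltrDl.
rewrite rD in up *; apply: lt_le_trans (lerD (hd v) (_ : - (toC (n%:R * e) * sqnorm v) <= _)).
  by rewrite subr_gt0.
move: up; rewrite real_ler_norml => [/andP[]//|].
by rewrite realE -toC0 !toC_le le_total.
Qed.

End PosdefNear.

(** * The maximum principle on the manifold *)

(** The infimum of the times where P fails would be a first failure: closedness gives P there, and
    openness gives it a little beyond. *)
Lemma interval_induction (R : realType) (P : R -> Prop) (t1 : R) : 0 <= t1 -> P 0 ->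
  (forall t, 0 <= t -> t < t1 -> P t ->
     exists2 d, 0 < d & forall s, t <= s -> s < t + d -> s <= t1 -> P s) ->
  (forall t, 0 < t -> t <= t1 -> (forall s, 0 <= s -> s < t -> P s) -> P t) -> P t1.
Proof.
move=> t10 P0 Popen Pclosed; apply: contrapT => nP1.
pose B := [set t | [/\ 0 <= t, t <= t1 & ~ P t]].
have B1 : B t1 by split.
have lB : lbound B 0 by move=> t [].
have iB : has_inf B by split; [exists t1 | exists 0].
pose t := inf B.
have t0 : 0 <= t by apply: lb_le_inf => //; exists t1.
have tt1 : t <= t1 by apply: ge_inf => //; exists 0.
have past s : 0 <= s -> s < t -> P s.
  move=> s0 st; apply: contrapT => nPs.
  have : t <= s by apply: ge_inf; [exists 0 | split=> //; exact: le_trans (ltW st) tt1].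
  by rewrite leNgt st.
have Pt : P t.
  by move: t0; rewrite le_eqVlt => /orP[/eqP <-//|t0]; exact: Pclosed.
have {}tt1 : t < t1 by rewrite lt_neqAle tt1 andbT; apply/eqP => e; apply: nP1; rewrite -e.
have [d d0 hd] := Popen t t0 tt1 Pt.
have [b [b0 b1 nPb] btd] := inf_adherent d0 iB.
have tb : t <= b by apply: ge_inf; [exists 0 | split].
exact: nPb (hd b tb btd b1).
Qed.

Section Manifold.
Context (R : realType) (n : nat) (M : topologicalType).
Variables (X : complex_atlas R n M) (g : kahler_metric X) (a : R) (T : \bar R) (u : M -> R -> R).
Local Notation C := (Cplx R).
Local Notation V := 'rV[C]_n.
Local Notation smv := (@space_move R n).
Local Notation tmv := (@spacetime_move R n).
Local Open Scope sesquilinear_scope.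
Hypothesis (T_gt0 : (0 < T)%E).
Hypothesis u0 : forall p t, 0 <= t -> (t%:E < T)%E -> 0 < u p t.
Hypothesis su : smooth_on_cylinder X T u.
Implicit Types (c : chart_index X) (p : M).

Definition times : set R := [set t | 0 <= t /\ (t%:E < T)%E].
Definition positive_times : set R := [set t | 0 < t /\ (t%:E < T)%E].
Local Notation U := (@chart_image R n M X).
Local Notation D0 c := (cyl (U c) times).
Local Notation D1 c := (cyl (U c) positive_times).
Local Notation G c := (metric g c).
Definition lnu c (y : V * R) : C := toC (ln (u (chart_inv c y.1) y.2)).
Definition lnu_hess c := hess tmv (D0 c) (@dzt R n) (lnu c).
(** The coefficient r of the metric is a free parameter: it receives the values of the barrier and
    is also sent to infinity for the initial time. *)
Definition harnack c (r : R) (y : V * R) := lnu_hess c y + toC r *: G c y.1.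

Let oU c : open (U c). Proof. exact: chart_image_open. Qed.
Arguments oU c : clear implicits.

Let open_lt_T : open [set t : R | (t%:E < T)%E].
Proof.
case: T => [r| |]; last 2 first.
- by rewrite (_ : [set t | _] = setT); [exact: openT | apply/seteqP; split => // t _; exact: ltry].
- by rewrite (_ : [set t | _] = set0); [exact: open0 | apply/seteqP; split].
rewrite (_ : [set t | _] = [set t | t < r]); first exact: open_lt.
by apply/seteqP; split => t /=; rewrite lte_fin.
Qed.

Lemma open_positive_times : open positive_times.
Proof. by apply: openI; [exact: open_gt | exact: open_lt_T]. Qed.

Lemma times_step (t : R) : times t -> ProperFilter (within [set h | times (t + h)] (0 : R)^').
Proof.
move=> [t0 tT]; have [d /= d0 hd] : \forall s \near t, (s%:E < T)%E by exact: open_nbhs_nbhs.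
apply: Build_ProperFilter_ex => A [e /= e0 he].
pose h := Num.min d e / 2.
have h0 : 0 < h by rewrite divr_gt0 // lt_min d0.
have hm : h < Num.min d e by rewrite /h; have : 0 < Num.min d e; [rewrite lt_min d0 | lra].
move: hm; rewrite lt_min => /andP[hd' he'].
exists h; apply: he; rewrite /= ?sub0r ?normrN ?gtr0_norm ?gt_eqF //.
split; first by rewrite addr_ge0 // ltW.
by apply: hd; rewrite /= opprD addrA subrr sub0r normrN gtr0_norm.
Qed.

Let sp0 c := cyl_step_proper (oU c) times_step.
Let mvt := spacetime_move_action R n.
Let D01 c : D1 c `<=` D0 c.
Proof. by move=> [z t] [/= Uz [/ltW t0 tT]]; split. Qed.
Let oD1 c : open (D1 c). Proof. exact: (open_cyl (oU c) open_positive_times). Qed.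
Arguments oD1 c : clear implicits.

Lemma smooth_lnu c : smooth tmv (D0 c) (lnu c).
Proof.
have u0' y : D0 c y -> 0 < u (chart_inv c y.1) y.2 by move=> [_ [/= t0 tT]]; exact: u0.
have su' : smooth tmv (D0 c) (fun y => toC (u (chart_inv c y.1) y.2)) by exact: (su c).
exact: (smooth_ln (@sp0 c) u0' su').
Qed.

Lemma lnu_real c y : (lnu c y)^* = lnu c y. Proof. exact: toC_conj. Qed.

Lemma hess_open_cylinder c h y : D1 c y -> hess tmv (D1 c) (@dzt R n) h y = hess tmv (D0 c) (@dzt R n) h y.
Proof.
move=> Dy; apply/matrixP => i j; rewrite !mxE.
have e b k w : D1 c w -> dir tmv (D1 c) b k w = dir tmv (D0 c) b k w.
  exact: (dir_open_subset mvt (oD1 c) (@D01 c)).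
rewrite -(e _ _ y Dy); apply: (dir_near mvt (oD1 c) _ Dy) => w Dw.
exact: e.
Qed.

Lemma hess_slice c h z t : times t ->
  hess tmv (D0 c) (@dzt R n) h (z, t) = hess smv (U c) (@dz R n) (fun w => h (w, t)) z.
Proof.
move=> It; apply/matrixP => k l; rewrite !mxE.
exact: (@dir_slice2 R n (U c) times (dzt R k) (fun j => (dzt R l j)^*) h z t erefl (conjC0 _) It).
Qed.

Let adjG c z : U c z -> (G c z) ^t* = G c z.
Proof. by move=> /metric_posdef-/(_ g)/hermitian_posdefP[]. Qed.

Let s_slice c t : times t -> smooth smv (U c) (fun w => lnu c (w, t)).
Proof. by move=> It; exact: (smooth_slice It (smooth_lnu c)). Qed.

Lemma harnack_adj c r y : D0 c y -> (harnack c r y) ^t* = harnack c r y.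
Proof.
case: y => z t [/= Uz It]; apply: hermitian_addZ; last exact: adjG Uz.
rewrite /lnu_hess hess_slice //.
exact: (adj_hess (space_step_proper (oU c)) (space_move_action R n) (oU c) (@dz R n) (s_slice c It) (fun w _ => lnu_real c (w, t)) Uz).
Qed.

Lemma chart_mem c p : chart_dom c p -> U c (chart c p).
Proof. by move=> cp; exists p. Qed.

Lemma harnack_hform c r y v : re (hform (harnack c r y) v) =
  re (hform (lnu_hess c y) v) + r * re (hform (G c y.1) v).
Proof. by rewrite /harnack hformD hformZ reD re_scale. Qed.

Lemma metric_chart_change c c' p : chart_dom c p -> chart_dom c' p ->
  let A := 'J (chart c' \o chart_inv c) (chart c p) in
  G c (chart c p) = A *m G c' (chart c' p) *m A ^t*.
Proof. by move=> cp cp' A; rewrite (metric_transition g cp cp') map_trmx. Qed.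

Lemma lnu_hess_form c p t v : chart_dom c p -> times t ->
  hform (lnu_hess c (chart c p, t)) v =
  dir smv (U c) (dv v) (dir smv (U c) (dvb v) (fun w => lnu c (w, t))) (chart c p).
Proof.
move=> cp It; rewrite /lnu_hess (hess_slice c (lnu c) (chart c p) It).
exact: esym (dir_dir_hess (space_step_proper (oU c)) (@dz R n) (s_slice c It) v (chart_mem cp)).
Qed.

(** The metric part follows from the transformation law, and the Hessian part from
    [levi_form_transition] on the slice at time t. *)
Lemma harnack_transition c c' p t r v : chart_dom c p -> chart_dom c' p -> times t ->
  re (hform (harnack c r (chart c p, t)) v) =
  re (hform (harnack c' r (chart c' p, t)) (v *m 'J (chart c' \o chart_inv c) (chart c p))).
Proof.
move=> cp cp' It; set w := v *m _; set Phi := chart c' \o chart_inv c.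
have PhiE : Phi (chart c p) = chart c' p by rewrite /Phi /= chartK.
have near_Phi : \forall z \near chart c p, [/\ U c z, differentiable Phi z, U c' (Phi z) &
    lnu c (z, t) = lnu c' (Phi z, t)].
  have nU := open_nbhs_nbhs (conj (oU c) (chart_mem cp)).
  have ch : chart_inv c @ within (U c) (nbhs (chart c p)) --> chart_inv c (chart c p).
    exact: ((subspace_continuousP _ _).1 (@chart_inv_continuous _ _ _ X c) _ (chart_mem cp)).
  rewrite chartK // in ch.
  have nd := ch _ (open_nbhs_nbhs (conj (chart_dom_open c') cp')).
  apply: filterS2 nU nd => z Uz /(_ Uz); case: Uz => q cq <-.
  rewrite /= chartK // => cq'; split.
  - by exists q.
  - exact: chart_holomorphic.
  - by rewrite /Phi /= chartK //; exact: chart_mem.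
  - by rewrite /lnu /Phi /= !chartK.
have eG : re (hform (G c (chart c p)) v) = re (hform (G c' (chart c' p)) w).
  by rewrite (metric_chart_change cp cp') hform_congr.
have eH : re (hform (lnu_hess c (chart c p, t)) v) = re (hform (lnu_hess c' (chart c' p, t)) w).
  apply: etrans (congr1 re (lnu_hess_form v cp It)) _.
  apply: etrans _ (esym (congr1 re (lnu_hess_form w cp' It))).
  have := levi_form_transition (oU c) (oU c') (s_slice c It) (s_slice c' It)
    (fun y _ => lnu_real c (y, t)) (fun y _ => lnu_real c' (y, t)) near_Phi v.
  by rewrite PhiE.
by rewrite (harnack_hform c) (harnack_hform c') eH /= eG.
Qed.

Lemma harnack_posdefP c p t r : chart_dom c p -> times t ->
  hermitian_posdef (harnack c r (chart c p, t)) <->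
  forall v : V, v != 0 -> 0 < re (hform (harnack c r (chart c p, t)) v).
Proof.
move=> cp It; have Dy : D0 c (chart c p, t) by split=> //; exact: chart_mem.
have hS := harnack_adj r Dy; rewrite hermitian_posdefP; split=> [[_ h]|h].
  by move=> v v0; have := h v v0; rewrite (real_toC (hform_real v hS)) -toC0 toC_lt.
split=> // v v0; rewrite (real_toC (hform_real v hS)) -toC0 toC_lt; exact: h.
Qed.

Lemma harnack_chart_independent c c' p t r : chart_dom c p -> chart_dom c' p -> times t ->
  hermitian_posdef (harnack c' r (chart c' p, t)) -> hermitian_posdef (harnack c r (chart c p, t)).
Proof.
move=> cp cp' It /harnack_posdefP h; apply/harnack_posdefP => // v v0.
rewrite (harnack_transition r v cp cp' It); apply: h => //.
(* The Jacobian cannot kill v, since the metric would then vanish on v. *)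
apply/eqP => vA; have := metric_posdef g (chart_mem cp) => /hermitian_posdefP[_ /(_ v v0)].
rewrite (metric_chart_change cp cp') /= hform_congr vA /hform !mul0mx mxE.
by rewrite ltxx.
Qed.

(** * Continuity of P along points, times and coefficients *)

Section Limits.
Context (S : Type) (F : set_system S) (FF : Filter F) (c : chart_index X) (p : M) (t0 : R).
Variables (al : S -> M) (be : S -> R).
Hypotheses (cp : chart_dom c p) (It0 : times t0).
Hypotheses (alp : al @ F --> p) (bet : be @ F --> t0) (Ibe : \forall s \near F, times (be s)).

Lemma chart_dom_near : \forall s \near F, chart_dom c (al s).
Proof. exact: (alp (open_nbhs_nbhs (conj (chart_dom_open c) cp))). Qed.

Lemma chart_cvg : (fun s => chart c (al s)) @ F --> chart c p.
Proof.
have h : chart c @ within (chart_dom c) (nbhs p) --> chart c p.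
  exact: ((subspace_continuousP _ _).1 (@chart_continuous _ _ _ X c) _ cp).
move=> A /h hA; have := alp hA; apply: filterS2 chart_dom_near => s ds; exact.
Qed.

Lemma metric_cvg i j : (fun s => G c (chart c (al s)) i j) @ F --> G c (chart c p) i j.
Proof.
have [/within_continuousP/(_ _ (chart_mem cp)) h _] := metric_smooth g c i j 0.
move=> A /h hA; have := chart_cvg hA; apply: filterS2 chart_dom_near => s ds; apply.
exact: chart_mem.
Qed.

Lemma lnu_hess_cvg i j :
  (fun s => lnu_hess c (chart c (al s), be s) i j) @ F --> lnu_hess c (chart c p, t0) i j.
Proof.
have [/within_continuousP ch _] := smooth_hess (@sp0 c) (@dzt R n) (smooth_lnu c) i j 0.
have h := ch _ (conj (chart_mem cp) It0 : D0 c (chart c p, t0)).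
move=> A /h [[B1 B2] /= [n1 n2] hA].
have nB : \forall s \near F, B1 (chart c (al s)) /\ B2 (be s).
  by apply: filterI; [exact: chart_cvg n1 | exact: bet n2].
apply: filterS (filterI nB (filterI chart_dom_near Ibe)) => s [[b1 b2] [ds Is]].
exact: (hA (chart c (al s), be s) (conj b1 b2) (conj (chart_mem ds) Is)).
Qed.

Variables (r : S -> R) (r0 : R).
Hypothesis cr : r @ F --> r0.

(** An arbitrary filter serves both for limits from the left in time at a fixed point and for the
    product filters of the compactness arguments. *)
Lemma harnack_cvg i j : (fun s => harnack c (r s) (chart c (al s), be s) i j) @ F -->
  harnack c r0 (chart c p, t0) i j.
Proof.
rewrite /harnack; have h := cvgD (@lnu_hess_cvg i j) (cvgM (cvg_toC cr) (@metric_cvg i j)).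
have {}h := h FF FF FF.
rewrite [X in _ --> X]mxE [X in _ --> _ + X]mxE; apply: (near_cvg h); apply: nearW => s.
by rewrite !fctE /= [RHS]mxE [X in _ = _ + X]mxE.
Qed.

Lemma harnack_near : hermitian_posdef (harnack c r0 (chart c p, t0)) ->
  \forall s \near F, hermitian_posdef (harnack c (r s) (chart c (al s), be s)).
Proof.
move=> /(posdef_near FF); apply; first exact: harnack_cvg.
by apply: filterS2 chart_dom_near Ibe => s ds Is; apply: harnack_adj; split=> //; exact: chart_mem.
Qed.

End Limits.

(* Multiplying by the reciprocal [r] of the coefficient of the metric turns the behaviour as
   that coefficient tends to infinity into continuity at [r = 0]. *)
Lemma harnack_near_infty (S : Type) (F : set_system S) (FF : Filter F) c p (t0 : R)
    (al : S -> M) (r : S -> R) : chart_dom c p -> times t0 -> al @ F --> p -> r @ F --> (0 : R) ->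
  (\forall s \near F, 0 < r s) ->
  \forall s \near F, hermitian_posdef (harnack c (r s)^-1 (chart c (al s), t0)).
Proof.
move=> cp It0 alp r0 rpos.
have It : \forall s \near F, times t0 by exact: nearW.
have bt : (fun=> t0) @ F --> t0 by exact: cvg_cst.
have : \forall s \near F,
    hermitian_posdef (G c (chart c (al s)) + toC (r s) *: lnu_hess c (chart c (al s), t0)).
  apply: (posdef_near FF (metric_posdef g (chart_mem cp))).
    move=> i j.
    have h := cvgD (metric_cvg (i := i) (j := j) FF cp alp)
      (cvgM (cvg_toC r0) (lnu_hess_cvg (i := i) (j := j) FF cp It0 alp bt It)).
    have {}h := h FF FF FF; rewrite toC0 mul0r addr0 in h; apply: (near_cvg h); apply: nearW => s.
    by rewrite !fctE /= [RHS]mxE [X in _ = _ + X]mxE.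
  have nd := chart_dom_near cp alp; apply: filterS nd => s ds.
  have Dy : D0 c (chart c (al s), t0) by split=> //; exact: chart_mem.
  apply: hermitian_addZ; first exact: adjG (chart_mem ds).
  by have := harnack_adj 0 Dy; rewrite /harnack toC0 scale0r addr0.
apply: filterS2 (filterI rpos (chart_dom_near cp alp)) => s [rs ds] /hermitian_posdefP[_ pN].
apply/harnack_posdefP => // v v0; rewrite harnack_hform.
have := pN v v0; rewrite hformD hformZ ltC => /andP[_].
rewrite reD re_scale -toC0 re_toC => h.
by rewrite -(pmulr_rgt0 _ rs) mulrDr mulrA divff ?gt_eqF // mul1r addrC.
Qed.

Hypothesis heat : log_heat_solution g a T u.
Hypothesis curv : nonneg_bisectional g.
Hypothesis a0 : a != 0.

Lemma lnu_equation c y : D1 c y ->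
  dir tmv (D1 c) (@dt R n) (lnu c) y =
  \tr (invmx (G c y.1) *m hess tmv (D1 c) (@dzt R n) (lnu c) y)
  + (gradzb tmv (D1 c) (@dzt R n) (lnu c) y *m invmx (G c y.1)
       *m gradz tmv (D1 c) (@dzt R n) (lnu c) y) 0 0 + toC a * lnu c y.
Proof.
move=> Dy.
pose v (y : V * R) := u (chart_inv c y.1) y.2.
have v0 w : D1 c w -> 0 < v w by move=> [_ [/= /ltW t0 tT]]; exact: u0.
have sv : smooth tmv (D0 c) (fun y => toC (v y)) by exact: (su c).
apply: (log_equation (open_step_proper mvt (oD1 c)) v0 (smooth_open_subset mvt (oD1 c) (@D01 c) sv)) => //.
rewrite dir_dt hess_open_cylinder //.
have nD := open_nbhs_nbhs (conj (oD1 c) Dy).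
rewrite (interior_partial mvt _ _ nD (filterS (@D01 c) nD)).
case: y Dy {nD} => z t [[q cq /= <-] [t0 tT]].
have := heat cq (ltW t0) tT; rewrite /v /= chartK // => e; apply: etrans e _.
congr (_ + _); rewrite hess_slice; last by split => //; exact: ltW.
(* [metric_inv] transposes the inverse matrix, so the double sum is the trace of a matrix
   product. *)
rewrite /laplacian /mxtrace exchange_big; apply: eq_bigr => l _; rewrite [RHS]mxE.
apply: eq_bigr => k _; rewrite /metric_inv (complex_hessianE (oU c)) //; last exact: chart_mem.
by rewrite [in RHS]mxE.
Qed.

(** The closedness step of the induction on time. Limits from the left give P >= 0 at t1 on all of
    M, so failure of positivity yields a null vector, which the local argument excludes in the chart
    at hand. *)
Lemma harnack_persist (k s t1 : R) : 1 < k -> 0 < s -> positive_times t1 ->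
  (forall t, 0 <= t -> t < t1 -> forall c p, chart_dom c p ->
     hermitian_posdef (harnack c (barrier a k s t) (chart c p, t))) ->
  forall c p, chart_dom c p -> hermitian_posdef (harnack c (barrier a k s t1) (chart c p, t1)).
Proof.
move=> k1 s0 It1 past c p cp; have [t10 t1T] := It1.
have ts : 0 < t1 + s by rewrite addr_gt0.
have [db bd bde] := barrier_derive a0 k ts.
have It1' : times t1 by split => //; exact: ltW.
have bc : barrier a k s @ t1 --> barrier a k s t1.
  by apply: differentiable_continuous; apply/derivable1_diffP; case: bd.
have past_times t : 0 <= t -> t < t1 -> times t.
  by move=> t0 tt1; split=> //; apply: lt_trans t1T; rewrite lte_fin.
have nt : \forall t \near t1^'-, 0 <= t /\ t < t1.
  by apply: filterI; [exact: nbhs_left_ge | exact: nbhs_left_lt].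
have posdef_re d q t w : chart_dom d q -> times t ->
    hermitian_posdef (harnack d (barrier a k s t) (chart d q, t)) ->
    0 <= re (hform (harnack d (barrier a k s t) (chart d q, t)) w).
  move=> dq It /harnack_posdefP h; have [->|w0] := eqVneq w 0; last exact: ltW (h _ _ _ w0).
  by rewrite /hform !mul0mx mxE -toC0 re_toC.
have ge0_re d q w : chart_dom d q ->
    0 <= re (hform (harnack d (barrier a k s t1) (chart d q, t1)) w).
  move=> dq.
  have aq : (fun=> q) @ t1^'- --> q by exact: cvg_cst.
  have at1 : id @ t1^'- --> t1 by move=> A nA; exact: (cvg_within _).
  have Ibt : \forall t \near t1^'-, times t by apply: filterS nt => t [? ?]; exact: past_times.
  have cr : barrier a k s @ t1^'- --> barrier a k s t1 by exact: cvg_at_left_filter bc.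
  have h : (fun t => hform (harnack d (barrier a k s t) (chart d q, t)) w) @ t1^'- -->
      hform (harnack d (barrier a k s t1) (chart d q, t1)) w.
    by apply: cvg_hform => i j; exact: (harnack_cvg (i := i) (j := j) _ dq It1' aq at1 Ibt cr).
  apply: (cvgr_to_ge (cvg_re h)); apply: filterS nt => t [t0 tt1] /=.
  by apply: posdef_re; [|exact: past_times|exact: past].
have Dz q t : chart_dom c q -> times t -> D0 c (chart c q, t).
  by move=> cq It; split=> //; exact: chart_mem.
have ge0 q w t : chart_dom c q -> times t ->
    0 <= re (hform (harnack c (barrier a k s t) (chart c q, t)) w) ->
    0 <= hform (harnack c (barrier a k s t) (chart c q, t)) w.
  move=> cq It h; have hS := harnack_adj (barrier a k s t) (Dz q t cq It).
  by rewrite (real_toC (hform_real w hS)) -toC0 toC_le.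
apply/harnack_posdefP => // v v0; rewrite lt_neqAle eq_sym ge0_re // andbT; apply/eqP => null.
have P_null : hform (harnack c (barrier a k s t1) (chart c p, t1)) v = 0.
  have hS := harnack_adj (barrier a k s t1) (Dz p t1 cp It1').
  by rewrite (real_toC (hform_real v hS)) null toC0.
have hE y r : D1 c y -> hess tmv (D1 c) (@dzt R n) (lnu c) y + toC r *: G c y.1 = harnack c r y.
  by move=> Dy; rewrite hess_open_cylinder.
have D1z q t : chart_dom c q -> 0 < t -> t <= t1 -> D1 c (chart c q, t).
  move=> cq t0 tt1; split; first exact: chart_mem.
  by split=> //; apply: le_lt_trans t1T; rewrite lee_fin.
have kG i j l z : U c z -> dir smv (U c) (dz R l) (fun w => G c w i j) z =
    dir smv (U c) (dz R i) (fun w => G c w l j) z.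
  by move=> Uz; have := metric_kahler g i l j Uz; rewrite !d_dir !(dir_setT (oU c)).
have uG z : U c z -> G c z \in unitmx.
  by move=> /(metric_posdef g)/hermitian_posdefP[_]; exact: posdef_unitmx.
have cG z : U c z -> forall v w : V,
    0 <= hform (mxd smv (U c) (dv w) (G c) z *m invmx (G c z) *m mxd smv (U c) (dvb w) (G c) z
      - mxd smv (U c) (dv w) (mxd smv (U c) (dvb w) (G c)) z) v.
  move=> Uz; apply: (curvature_form (oU c) (metric_smooth g c) uG Uz).
  by case: Uz => q cq <-; exact: curv cq.
have P0 : forall z w, U c z -> 0 <= hform (hess tmv (D1 c) (@dzt R n) (lnu c) (z, t1)
    + toC (barrier a k s t1) *: G c z) w.
  move=> z w [q cq <-]; rewrite (hE (chart c q, t1)); last exact: D1z.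
  by apply: ge0 => //; exact: ge0_re.
have Pp : \forall h \near (0 : R)^', h < 0 -> 0 <= hform (hess tmv (D1 c) (@dzt R n) (lnu c)
    (chart c p, t1 + h) + toC (barrier a k s (t1 + h)) *: G c (chart c p)) v.
  have nh : \forall h \near (0 : R)^', 0 < t1 + h.
    exists t1 => // h /=; rewrite sub0r normrN => ht _.
    by move: ht; rewrite ltr_norml => /andP[ht _]; rewrite -ltrBlDl sub0r.
  apply: filterS nh => h h1 h0; have h2 : t1 + h < t1 by rewrite gtrDl.
  rewrite (hE (chart c p, t1 + h)); last by apply: D1z => //; exact: ltW.
  have It := past_times _ (ltW h1) h2.
  by apply: ge0 => //; apply: posdef_re => //; apply: past => //; exact: ltW.
have bs : 0 < db + barrier a k s t1 ^+ 2 - a * barrier a k s t1.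
  by rewrite bde divr_gt0 ?exprn_gt0 ?eta_gt0 // mulr_gt0 ?subr_gt0 // (lt_trans ltr01).
have Pn : hform (hess tmv (D1 c) (@dzt R n) (lnu c) (chart c p, t1)
    + toC (barrier a k s t1) *: G c (chart c p)) v = 0.
  by rewrite (hE (chart c p, t1)) //; exact: D1z.
exact: (@no_interior_null_vector R n (U c) positive_times (oU c) open_positive_times (lnu c) (metric g c) a
  (barrier a k s) db (smooth_open_subset mvt (oD1 c) (@D01 c) (smooth_lnu c))
  (fun y _ => lnu_real c y) (metric_smooth g c) (fun z Uz => metric_posdef g Uz) kG cG
  (@lnu_equation c) (chart c p) t1 v (chart_mem cp) It1 v0 Pn P0 Pp bd bs).
Qed.

Hypothesis cptM : compact [set: M].

Let barrier_continuous (k s t : R) : 0 < t + s -> barrier a k s @ t --> barrier a k s t.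
Proof.
move=> ts; have [db bd _] := barrier_derive a0 k ts.
by apply: differentiable_continuous; apply/derivable1_diffP; case: bd.
Qed.

Let times0 : times 0. Proof. by split. Qed.

(** At time 0 the barrier tends to infinity as s tends to 0. Compactness turns positivity near each
    point for small s into a single s valid on all of M. *)
Lemma harnack_initial t1 : 0 < t1 -> exists2 s, 0 < s &
  forall c p, chart_dom c p ->
  hermitian_posdef (harnack c (barrier a (eta a (t1 + s) / eta a t1) s 0) (chart c p, 0)).
Proof.
move=> t10; have e1 := eta_gt0 a0 t10.
(* The reciprocal of the barrier at time 0; it tends to 0 since eta(s) does while eta(t1 + s) tends
   to eta(t1) > 0. *)
pose r s := eta a s * eta a t1 / eta a (t1 + s).
have r0 : r @ (0 : R)^'+ --> (0 : R).
  have c1 : (fun s => eta a (t1 + s)) @ (0 : R)^'+ --> eta a t1.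
    apply: cvg_at_right_filter.
    have h : (fun s => t1 + s) @ (0 : R) --> t1.
      by rewrite -[X in _ --> X](addr0 t1); apply: cvgD; [exact: cvg_cst | exact: cvg_id].
    have ce : eta a @ t1 --> eta a t1 by exact: eta_continuous.
    exact: (@cvg_comp _ _ _ (fun s => t1 + s) (eta a) _ _ _ h ce).
  have c0 : eta a @ (0 : R)^'+ --> (0 : R).
    by apply: cvg_at_right_filter; rewrite -{2}(eta0 a); exact: eta_continuous.
  have := cvgM (cvgM c0 (cvg_cst (eta a t1))) (cvgV (lt0r_neq0 e1) c1).
  move=> /(_ _ _ _ _) h; rewrite !mul0r in h; exact: h.
have rpos : \forall s \near (0 : R)^'+, 0 < r s.
  have pos : \forall s \near (0 : R)^'+, 0 < s by exact: nbhs_right_gt.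
  apply: filterS pos => s s0; have ts : 0 < t1 + s by rewrite addr_gt0.
  exact: (divr_gt0 (mulr_gt0 (eta_gt0 a0 s0) e1) (eta_gt0 a0 ts)).
pose P s p := forall c, chart_dom c p -> hermitian_posdef (harnack c (r s)^-1 (chart c p, 0)).
have cover p : \forall q \near p & s \near (0 : R)^'+, P s q.
  have [c cp] := chart_cover X p.
  have c1 : fst @ filter_prod (nbhs p) (0 : R)^'+ --> p by exact: cvg_fst.
  have c2 : snd @ filter_prod (nbhs p) (0 : R)^'+ --> (0 : R)^'+ by exact: cvg_snd.
  have c3 : (fun q : M * R => r q.2) @ filter_prod (nbhs p) (0 : R)^'+ --> (0 : R).
    exact: (@cvg_comp _ _ _ snd r _ _ _ c2 r0).
  have c4 : \forall q \near filter_prod (nbhs p) (0 : R)^'+, 0 < r q.2 by exact: (c2 _ rpos).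
  have FP : Filter (filter_prod (nbhs p) (0 : R)^'+) by exact: filter_prod_filter.
  have nP := harnack_near_infty FP cp times0 c1 c3 c4.
  have nd := chart_dom_near cp c1.
  have h : \forall q \near filter_prod (nbhs p) (0 : R)^'+, P q.2 q.1.
    apply: filterS2 nP nd => -[q s] /= hq dq c' dq'.
    exact: (harnack_chart_independent dq' dq times0 hq).
  exact: h.
(* Compactness in the form of near coverings: what holds for points near each p and for small s
   holds for all points at once and for small s. Chart independence makes [P s q] a property of the
   point alone. *)
have := (compact_near_coveringP _).1 cptM _ _ P _ (fun p _ => cover p).
move=> nP; have pos : \forall s \near (0 : R)^'+, 0 < s by exact: nbhs_right_gt.
have [s [s0 Ps]] := filter_ex (filterI pos (nP _)).
exists s => // c p cp; have := Ps p Logic.I c cp.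
rewrite (_ : (r s)^-1 = barrier a (eta a (t1 + s) / eta a t1) s 0) //.
by rewrite /r /barrier add0r invf_div invfM [_^-1 * _]mulrC mulrA.
Qed.


(** The openness step of the induction on time. Neighbourhoods are taken relative to [times], so
    that the step also starts from t = 0. *)
Lemma harnack_open (k s t0 : R) : 0 < s -> times t0 ->
  (forall c p, chart_dom c p -> hermitian_posdef (harnack c (barrier a k s t0) (chart c p, t0))) ->
  \forall t \near within times (nbhs t0), forall c p, chart_dom c p ->
    hermitian_posdef (harnack c (barrier a k s t) (chart c p, t)).
Proof.
move=> s0 It0 good0; pose F := within times (nbhs t0).
have ts : 0 < t0 + s by case: It0 => t00 _; rewrite ltr_wpDl.
pose P t p := forall c, chart_dom c p -> hermitian_posdef (harnack c (barrier a k s t) (chart c p, t)).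
have cover p : \forall q \near p & t \near F, P t q.
  have [c cp] := chart_cover X p.
  have c1 : fst @ filter_prod (nbhs p) F --> p by exact: cvg_fst.
  have c2 : snd @ filter_prod (nbhs p) F --> F by exact: cvg_snd.
  have c2' : snd @ filter_prod (nbhs p) F --> t0.
    by move=> A nA; apply: c2; exact: cvg_within.
  have c3 : (fun q : M * R => barrier a k s q.2) @ filter_prod (nbhs p) F --> barrier a k s t0.
    exact: (@cvg_comp _ _ _ snd (barrier a k s) _ _ _ c2' (barrier_continuous ts)).
  have c4 : \forall q \near filter_prod (nbhs p) F, times q.2.
    by apply: (c2 times); exact: withinT.
  have FP : Filter (filter_prod (nbhs p) F) by exact: filter_prod_filter.
  have nP := harnack_near FP cp It0 c1 c2' c4 c3 (good0 c p cp).
  have nd := chart_dom_near cp c1.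
  have h : \forall q \near filter_prod (nbhs p) F, P q.2 q.1.
    apply: filterS2 c4 (filterI nP nd) => -[q t] /= It [hq dq] c' dq'.
    exact: (harnack_chart_independent dq' dq It hq).
  exact: h.
have nP := (compact_near_coveringP _).1 cptM _ F P _ (fun p _ => cover p).
have FF : Filter F by exact: within_filter.
have {}nP := nP FF.
exact: (@filterS _ F _ _ _ (fun t Pt c p => Pt p Logic.I c) nP).
Qed.

Lemma harnack_posdef t1 : positive_times t1 -> forall c p, chart_dom c p ->
  hermitian_posdef (harnack c (a / (1 - expR (- (a * t1)))) (chart c p, t1)).
Proof.
move=> [t10 t1T]; have [s s0 init] := harnack_initial t10.
set k := eta a (t1 + s) / eta a t1 in init.
have e1 := eta_gt0 a0 t10.
have k1 : 1 < k by rewrite /k ltr_pdivlMr // mul1r (eta_lt a0) // ltrDl.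
(* The choice of k makes the barrier take the desired value at t1 exactly. *)
have -> : a / (1 - expR (- (a * t1))) = barrier a k s t1.
  rewrite /barrier /k mulrAC divff ?mul1r ?invf_div //.
  by rewrite gt_eqF // eta_gt0 // addr_gt0.
apply: (interval_induction (P := fun t => forall c p, chart_dom c p ->
  hermitian_posdef (harnack c (barrier a k s t) (chart c p, t))) (ltW t10) init).
  move=> t t0 tt1 good; have It : times t.
    by split=> //; apply: lt_trans t1T; rewrite lte_fin.
  have [d /= d0 hd] := harnack_open s0 It good.
  exists d; first exact: d0.
  move=> r tr rd rt1.
  have br : ball_ Num.Def.normr t d r by rewrite /= distrC ger0_norm ?subr_ge0 // ltrBlDl.
  have Ir : times r.
    by split; [exact: le_trans tr | apply: le_lt_trans t1T; rewrite lee_fin].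
  exact: (hd r br Ir).
move=> t t0 tt1 past; apply: (harnack_persist k1 s0) => //.
by split=> //; apply: le_lt_trans t1T; rewrite lee_fin.
Qed.

End Manifold.

Theorem theorem1p1 (R : realType) (n : nat) (M : topologicalType)
    (X : complex_atlas R n M) (g : kahler_metric X)
    (a : R) (T : \bar R) (u : M -> R -> R) :
  hausdorff_space M ->
  compact [set: M] ->
  nonneg_bisectional g ->
  a != 0 ->
  (0 < T)%E ->
  (forall p t, 0 <= t -> (t%:E < T)%E -> 0 < u p t) ->
  smooth_on_cylinder X T u ->
  log_heat_solution g a T u ->
  forall (t : R), 0 < t -> (t%:E < T)%E ->
  forall (c : chart_index X) (p : M), chart_dom c p ->
  hermitian_posdef (\matrix_(i, j)
    (complex_hessian (local_rep (fun q => ln (u q t)) c) i j (chart c p)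
     + (a / (1 - expR (- (a * t))))%:C%C * metric g c (chart c p) i j)).
Proof.
move=> _ cptM curv a0 T0 u0 su heat t t0 tT c p cp.
have := harnack_posdef T0 u0 su heat curv a0 cptM (conj t0 tT) cp.
congr hermitian_posdef; apply/matrixP => i j.
rewrite [RHS]mxE [LHS]mxE [X in _ + X]mxE; congr (_ + _).
have oU : open (chart_image c) by exact: chart_image_open.
have It : times T t by split=> //; exact: ltW.
rewrite (complex_hessianE oU _ _ _ (chart_mem cp)) /lnu_hess (hess_slice c _ _ It) mxE.
by [].
Qed.
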